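(* Let $X$ be a Polish space, let $E$ be a countable Borel equivalence relation on $X$, and let $\mu$ be an $E$-invariant Borel probability measure on $X$. Suppose that there is a free Borel action of a countable non-abelian free group on $X$ whose orbit equivalence relation is a subequivalence relation of $E$ with respect to which $\mu$ is ergodic. Then for every countable non-abelian free group $\Gamma$, there is a Borel $\mu$-stratification of $E$ by free actions of $\Gamma$ on $X$ whose orbit equivalence relations are such that $\mu$ is ergodic with respect to each of them.
   Context: An equivalence relation is countable if all its classes are countable. For $B\subseteq X$, $E\upharpoonright B=E\cap(B\times B)$ and $\mu\upharpoonright B$ is the restriction of $\mu$ to $B$. The orbit equivalence relation generated by an action of $\Gamma$ on $X$ relates $x$ and $y$ iff $\gamma\cdot x=y$ for some $\gamma\in\Gamma$. An action is free if $\gamma\cdot x=x$ only for $\gamma=\mathrm{id}$. A Borel probability measure $\mu$ on $X$ is ergodic with respect to a countable Borel equivalence relation $F$ if every $F$-invariant Borel set is $\mu$-null or $\mu$-conull. It is $E$-invariant if $\mu(B)=\mu(T(B))$ for every Borel $B\subseteq X$ and every Borel automorphism $T\colon X\to X$ whose graph is contained in $E$. A sequence $(E_r)_{r\in\mathbb{R}}$ of subequivalence relations of $E$ is a stratification of $E$ if for all reals $r<s$ every $E_r$-class is properly contained in an $E_s$-class. It is a $\mu$-stratification of $E$ if it is a stratification and moreover, for all $\mu$-positive Borel sets $B\subseteq X$ and all reals $r<s$, the $(E_r\upharpoonright B)$-class of $(\mu\upharpoonright B)$-almost every point of $B$ is properly contained in an $(E_s\upharpoonright B)$-class. A sequence $(\cdot_r)_{r\in\mathbb{R}}$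 of actions of $\Gamma$ on $X$ is a ($\mu$-)stratification of $E$ if the corresponding sequence of orbit equivalence relations is a ($\mu$-)stratification of $E$; it is Borel if $\{(r,((\gamma,x),y)) : \gamma\cdot_r x=y\}$ is a Borel subset of $\mathbb{R}\times((\Gamma\times X)\times X)$. *)

(* Defs.v *)
From HB Require Import structures.
From mathcomp Require Import all_boot all_order all_algebra.
From mathcomp Require Import all_classical all_reals all_analysis.
Export numFieldNormedType.Exports.

Set Implicit Arguments.
Unset Strict Implicit.
Unset Printing Implicit Defensive.

Import Order.TTheory GRing.Theory Num.Theory.

Local Open Scope classical_set_scope.
Local Open Scope ring_scope.
Local Open Scope ereal_scope.

Definition is_metric (R : realType) (X : Type) (d : X -> X -> R) : Prop :=
  [/\ forall x y, (0 <= d x y)%R,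
      forall x y, d x y = 0%R <-> x = y,
      forall x y, d x y = d y x &
      forall x y z, (d x z <= d x y + d y z)%R].

Definition metric_compatible (R : realType) (X : topologicalType)
    (d : X -> X -> R) : Prop :=
  forall (x : X) (A : set X),
    nbhs x A <-> exists2 e : R, (0 < e)%R & [set y | (d x y < e)%R] `<=` A.

Definition metric_complete (R : realType) (X : topologicalType)
    (d : X -> X -> R) : Prop :=
  forall u : nat -> X,
    (forall e : R, (0 < e)%R ->
       exists N, forall m n, (N <= m)%N -> (N <= n)%N -> (d (u m) (u n) < e)%R) ->
    exists x : X, u @ \oo --> x.

Definition separable (X : topologicalType) : Prop :=
  exists2 D : set X, countable D & dense D.

Definition polish (R : realType) (X : topologicalType) : Prop :=
  separable X /\
  exists d : X -> X -> R,
    [/\ is_metric d, metric_compatible d & metric_complete d].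

Definition borel (T : topologicalType) : set (set T) := <<s (@open T) >>.

(* [X] with its Borel sigma-algebra: here [measurable] is [@borel X]. *)
Notation borelType X := (g_sigma_algebraType (@open X)).

Definition borel_fun (S T : topologicalType) (f : S -> T) : Prop :=
  forall B : set T, borel B -> borel (f @^-1` B).

Definition borel_automorphism (X : topologicalType) (T : X -> X) : Prop :=
  exists2 S : X -> X, cancel T S /\ cancel S T & borel_fun T /\ borel_fun S.

Definition equivalence (X : Type) (E : set (X * X)) : Prop :=
  [/\ forall x, E (x, x),
      forall x y, E (x, y) -> E (y, x) &
      forall x y z, E (x, y) -> E (y, z) -> E (x, z)].

Definition subequivalence (X : Type) (F E : set (X * X)) : Prop :=
  equivalence F /\ F `<=` E.

Definition eclass (X : Type) (E : set (X * X)) (x : X) : set X :=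
  [set y | E (x, y)].

Definition erestr (X : Type) (E : set (X * X)) (B : set X) : set (X * X) :=
  E `&` (B `*` B).

Definition countable_borel_equivalence (X : topologicalType)
    (E : set (X * X)) : Prop :=
  [/\ equivalence E, borel E & forall x, countable (eclass E x)].

Definition ergodic (R : realType) (X : ptopologicalType)
    (mu : probability (borelType X) R) (F : set (X * X)) : Prop :=
  forall B : set X, borel B ->
    (forall x y, F (x, y) -> B x -> B y) ->
    mu B = 0 \/ mu (~` B) = 0.

Definition measure_invariant (R : realType) (X : ptopologicalType)
    (mu : probability (borelType X) R) (E : set (X * X)) : Prop :=
  forall T : X -> X, borel_automorphism T -> (forall x, E (x, T x)) ->
  forall B : set X, borel B -> mu B = mu (T @` B).

(* The pair (s, false) stands for the letter s, and (s, true) for s^-1. *)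
Definition word_prod (G : groupType) (w : seq (G * bool)) : G :=
  (\prod_(l <- w) (if l.2 then l.1^-1 else l.1))%g.

Definition reduced (G : groupType) (w : seq (G * bool)) : bool :=
  sorted (fun k l : G * bool => ~~ ((k.1 == l.1) && (k.2 != l.2))) w.

Definition freely_generates (G : groupType) (S : set G) : Prop :=
  forall g : G, exists! w : seq (G * bool),
    [/\ forall l, l \in w -> S l.1, reduced w & word_prod w = g].

Definition free_group (G : groupType) : Prop :=
  exists S : set G, freely_generates S.

Definition countable_nonabelian_free_group (G : groupType) : Prop :=
  [/\ countable [set: G], free_group G & ~ forall x y : G, commute x y].

Definition group_action (G : groupType) (X : Type) (a : G -> X -> X) : Prop :=
  (forall x, a 1%g x = x) /\ (forall g h x, a (g * h)%g x = a g (a h x)).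

Definition free_action (G : groupType) (X : Type) (a : G -> X -> X) : Prop :=
  group_action a /\ forall g x, a g x = x -> g = 1%g.

Definition borel_action (G : groupType) (X : topologicalType)
    (a : G -> X -> X) : Prop :=
  borel_fun (fun p : discrete_topology G * X => a p.1 p.2).

Definition orbit_equivalence (G : Type) (X : Type) (a : G -> X -> X) :
  set (X * X) := [set p | exists g, a g p.1 = p.2].

Definition borel_action_sequence (R : realType) (G : groupType)
    (X : topologicalType) (a : R -> G -> X -> X) : Prop :=
  borel [set p : R * ((discrete_topology G * X) * X) |
          a p.1 p.2.1.1 p.2.1.2 = p.2.2].

Definition stratification (R : realType) (X : Type) (E : set (X * X))
    (F : R -> set (X * X)) : Prop :=
  (forall r, subequivalence (F r) E) /\
  (forall r s : R, (r < s)%R ->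
     forall x, exists y, eclass (F r) x `<` eclass (F s) y).

Definition mu_stratification (R : realType) (X : ptopologicalType)
    (mu : probability (borelType X) R) (E : set (X * X))
    (F : R -> set (X * X)) : Prop :=
  stratification E F /\
  (forall (B : set (borelType X)) (mB : measurable B), 0 < mu B ->
     forall r s : R, (r < s)%R ->
     {ae mrestr mu mB, forall x, B x ->
        exists2 y, B y &
          eclass (erestr (F r) B) x `<` eclass (erestr (F s) B) y}).

(* Main.v *)
Require Import Defs.
From mathcomp Require Import all_boot all_order all_algebra.
From mathcomp Require Import all_classical all_reals all_analysis.
From mathcomp Require Import measurable_realfun.
From mathcomp Require Import zify ring lra.

Set Implicit Arguments.
Unset Strict Implicit.
Unset Printing Implicit Defensive.

Import Order.TTheory GRing.Theory Num.Theory.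
Local Open Scope classical_set_scope.

(** Let [D] be the free group that acts freely with [mu] ergodic. As [mu] is
[E]-invariant, it is preserved by every Borel automorphism that moves each point
inside its [D]-orbit, so all the actions are built inside the orbits of [D].

_The shape of the actions._ One element [i0] of the basis of the given group acts
by an automorphism [F] that is ergodic by itself, a second one [i1] by an
automorphism [V r] that depends on the real [r], and the others by fixed elements
of [D]. The orbits thus grow with [r] inside the orbits of a single generator,
while the group stays the same. How far [F] and [V r] move a point depends on the
point, but each of these generators moves points by elements of a subgroup of [D]
of its own, and these subgroups, called blocks, play ping-pong in [D]. Hence a
reduced word moves every point by an element of [D] other than [1]: the action is
free ([free_act_free]), not only almost everywhere. By the same argument, a point
that is reached inside one block is reached by the generator of this block alone
([free_act_block]), so that orbits which are strictly larger along [V s] than along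
[V r] remain so for the whole actions ([orbit_strict]). Ergodicity comes from [F],
and it turns strictness at every point into strictness inside every positive set
([strat_act_strict]).

_The automorphisms [V r]._ Along the orbits of one element of [D] the points get
labels in the countable set [seq rat] so that each label recurs infinitely often in
both directions ([recurrent_labels]). Deleting the rationals below [r] from the
labels identifies more and more labels as [r] grows, strictly, and [V r] takes a
point to the next one with the same label after this deletion.

_An ergodic block._ In a free group with basis elements [x] and [y], the elements
[x ^+ m * y * x ^+ m * t], with [t] the unit or a basis element, play ping-pong if
the exponents [m] are sparse ([spike_pingpong]). Along a sequence of exponents for
which the correlations of all sets of a dense sequence with their translates by
[x ^+ m * y * x ^+ m] converge, a set that is invariant under infinitely many of
these elements for [t = 1] and for [t = s] has the same correlation with itself and
with its translate by [s], hence is invariant under [s] up to a null set. So one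
block with infinitely many elements for each [t] is ergodic, and infinitely many
other blocks are left ([ergodic_pingpong]).

_The automorphism [F]._ Inside the ergodic block, any two disjoint sets of equal
measure are exchanged by an involution, up to null sets ([matching]). This gives
automorphisms of period [2 ^ n] almost everywhere, each of them obtained from the former
by gluing its orbits in pairs. If an orbit
that visits a set often is glued to one that visits it rarely, the numbers of visits
of the glued orbits are nearly the same ([tower_step]); doing this for each set of a
dense sequence makes the limit ergodic ([ergodic_automorphism]). *)

(** * Words *)

Section Words.
Variable J : eqType.
Implicit Types (l : J * bool) (w : seq (J * bool)).

Definition flip l : J * bool := (l.1, ~~ l.2).

Definition reducedw w := sorted (fun k l => l != flip k) w.

Definition push l w : seq (J * bool) :=
  if w is k :: w' then if k == flip l then w' else l :: w else [:: l].

Definition invw w := rev (map flip w).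

Lemma flipK : involutive flip.
Proof. by case=> j e; rewrite /flip /= negbK. Qed.

Lemma reducedw_cons l w : reducedw (l :: w) -> reducedw w.
Proof. by case: w => //= k w /andP[]. Qed.

Lemma reducedw_catl w1 w2 : reducedw (w1 ++ w2) -> reducedw w1.
Proof. by move=> /cat_sorted2[]. Qed.

Lemma reducedw_push l w : reducedw w -> reducedw (push l w).
Proof.
case: w => [//|k w] /= rw; case: ifP => [_|/negbT kl]; first exact: path_sorted rw.
by rewrite /= kl.
Qed.

Lemma mem_push l w k : k \in push l w -> k = l \/ k \in w.
Proof.
case: w => [|k' w] /=; first by rewrite inE => /eqP; left.
case: ifP => _; first by rewrite inE => ->; right; rewrite orbT.
by rewrite inE => /orP[/eqP|]; [left|right].
Qed.

Lemma reducedw_cat u x w : reducedw (rcons u x) -> reducedw w ->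
  ~~ prefix [:: flip x] w -> reducedw (u ++ x :: w).
Proof.
rewrite /reducedw sorted_cat_cons => -> /=.
by case: w => [//|k w] /= ->; rewrite andbT prefix0s andbT eq_sym.
Qed.

Lemma foldr_push_cat p w : reducedw (p ++ w) -> foldr push w p = p ++ w.
Proof.
elim: p => [//|l p IHp] /= r; rewrite IHp ?(reducedw_cons r) //.
by case: (p ++ w) r => [//|k q] /= /andP[/negbTE ->].
Qed.

(** The letters of the first factor are cancelled from right to left, so that [x] is
reached only if the second factor begins with the inverse of [x v]. *)
Lemma prefix_push u x v w : reducedw (u ++ x :: v) -> reducedw w ->
  ~~ prefix (invw (x :: v)) w -> prefix (rcons u x) (foldr push w (u ++ x :: v)).
Proof.
elim/last_ind: v w => [|v l IHv] w.
  rewrite /invw /= cats1 => ru rw npw.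
  rewrite -cats1 foldr_push_cat -?catA /= ?cats1 -?cat_rcons ?prefix_prefix //.
  by rewrite cat_rcons; exact: reducedw_cat.
rewrite -rcons_cons -rcons_cat => ruvl rw.
rewrite /invw map_rcons rev_rcons foldr_rcons.
have ruv : reducedw (u ++ x :: v) by move: ruvl; rewrite -cats1 => /reducedw_catl.
case: (boolP (prefix [:: flip l] w)) => [|npl npw].
  case: w rw => [|k w] //= rw; rewrite prefix0s andbT => /eqP <-.
  by rewrite !eqxx /=; apply: IHv => //; exact: reducedw_cons rw.
have -> : push l w = l :: w.
  by case: w npl {rw npw} => [//|k w] /=; rewrite prefix0s andbT eq_sym => /negbTE ->.
rewrite foldr_push_cat; last exact: reducedw_cat.
by rewrite -catA /= -cat_rcons; exact: prefix_prefix.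
Qed.
End Words.

(** * Free groups *)

Section Values.
Variables (J : eqType) (G : groupType) (c : J -> G).
Implicit Types (l : J * bool) (w : seq (J * bool)).
Local Open Scope group_scope.

Definition lval l := if l.2 then (c l.1)^-1 else c l.1.
Definition wval w := \prod_(l <- w) lval l.

Lemma lval_flip l : lval (flip l) = (lval l)^-1.
Proof. by case: l => j []; rewrite /lval /= ?invgK. Qed.

Lemma wval_nil : wval [::] = 1. Proof. by rewrite /wval big_nil. Qed.

Lemma wval_cons l w : wval (l :: w) = lval l * wval w.
Proof. by rewrite /wval big_cons. Qed.

Lemma wval_cat w1 w2 : wval (w1 ++ w2) = wval w1 * wval w2.
Proof. by rewrite /wval big_cat. Qed.

Lemma wval_push l w : wval (push l w) = lval l * wval w.
Proof.
case: w => [|k w] /=; first by rewrite wval_cons.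
by case: eqP => [->|_]; rewrite !wval_cons // lval_flip mulVKg.
Qed.

Lemma wval_invw w : wval (invw w) = (wval w)^-1.
Proof.
elim: w => [|l w IHw]; first by rewrite wval_nil invg1.
by rewrite /invw /= rev_cons -cats1 wval_cat IHw !wval_cons wval_nil mulg1
  lval_flip invgM.
Qed.

Lemma wval_nseq n l : wval (nseq n l) = lval l ^+ n.
Proof. by elim: n => [|n IHn]; rewrite ?wval_nil //= wval_cons IHn expgS. Qed.

Lemma reduce_word (P : pred J) w : all (fun l => P l.1) w ->
  exists w', [/\ all (fun l => P l.1) w', reducedw w' & wval w' = wval w].
Proof.
elim: w => [|l w IHw] /=; first by exists [::].
case/andP=> Pl /IHw[w' [/allP aw' rw' vw']].
exists (push l w'); split; [|exact: reducedw_push|by rewrite wval_push vw' wval_cons].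
by apply/allP => k /mem_push[->//|/aw'].
Qed.
End Values.

Section NormalForm.
Variables (G : groupType) (S : set G) (Sfree : freely_generates S).
Local Open Scope group_scope.
Implicit Types (l : G * bool) (w : seq (G * bool)) (g : G).

Lemma reducedE w : reduced w = reducedw w.
Proof.
rewrite /reduced /reducedw; congr sorted; apply/funext => k; apply/funext => -[s e].
by case: k => t f; rewrite /flip xpair_eqE /= [s == t]eq_sym; case: (t == s); case: e; case: f.
Qed.

Definition letters w := forall l, l \in w -> S l.1.

Lemma letters_cons l w : letters (l :: w) <-> S l.1 /\ letters w.
Proof.
split=> [h|[Sl h] k]; last by rewrite inE => /orP[/eqP->|/h].
split=> [|k kw]; first by apply: h; rewrite inE eqxx.
by apply: h; rewrite inE kw orbT.
Qed.

Definition nf g : seq (G * bool) := projT1 (cid (Sfree g)).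

Lemma nfP g : [/\ letters (nf g), reducedw (nf g) & wval id (nf g) = g].
Proof. by rewrite /nf; case: cid => w /= [[? ? ?] _]; rewrite -reducedE. Qed.

Lemma nf_uniq w : letters w -> reducedw w -> nf (wval id w) = w.
Proof.
rewrite /nf => lw rw; case: cid => v /= [_]; apply; split=> //.
by rewrite reducedE.
Qed.

Lemma nf1 : nf 1 = [::].
Proof. by rewrite -[1](wval_nil id) nf_uniq. Qed.

Lemma nf_lval l g : S l.1 -> nf (lval id l * g) = push l (nf g).
Proof.
move=> Sl; have [lg rg vg] := nfP g.
rewrite -{1}vg -wval_push nf_uniq //; last exact: reducedw_push.
by move=> k /mem_push[->//|/lg].
Qed.

Lemma nf_wval w g : letters w -> nf (wval id w * g) = foldr (@push _) (nf g) w.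
Proof.
elim: w => [|l w IHw]; first by rewrite wval_nil mul1g.
by case/letters_cons=> Sl /IHw /= <-; rewrite wval_cons -mulgA nf_lval.
Qed.

Lemma free_gen_ind (P : G -> Prop) : P 1 ->
  (forall s g, S s -> P g -> P (s * g)) ->
  (forall s g, S s -> P g -> P (s^-1 * g)) -> forall g, P g.
Proof.
move=> P1 PM PV g; have [+ _ <-] := nfP g.
elim: (nf g) => [|[s e] w IHw]; first by rewrite wval_nil.
by case/letters_cons=> /= Ss /IHw; rewrite wval_cons; case: e; [apply: PV|apply: PM].
Qed.

(** In a non-abelian free group the basis has two elements, for powers of a
single element commute. *)
Lemma nonabelian_two : ~ (forall x y : G, commute x y) ->
  exists a b, [/\ S a, S b & a <> b].
Proof.
move=> nab; apply: contrapT => no2; apply: nab => x.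
have com1 s t : S s -> S t -> s = t.
  by move=> Ss St; apply: contrapT => st; apply: no2; exists s, t.
have cS s y : S s -> commute s y.
  move=> Ss; elim/free_gen_ind: y => [|t g St cg|t g St cg]; first exact: commute1.
    by rewrite (com1 _ _ St Ss); apply: commuteM => //; exact: commute_refl.
  rewrite (com1 _ _ St Ss); apply: commuteM => //.
  by apply: commuteV; exact: commute_refl.
elim/free_gen_ind: x => [|s g Ss cg|s g Ss cg] y.
- by apply: commute_sym; exact: commute1.
- by apply: commute_sym; apply: commuteM; apply: commute_sym; [exact: cS|exact: cg].
- apply: commute_sym; apply: commuteM; last by apply: commute_sym.
  by apply: commuteV; apply: commute_sym; exact: cS.
Qed.
End NormalForm.

(** * Ping-pong *)

Definition subgroup_set (G : groupType) (K : set G) : Prop :=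
  [/\ K 1%g, forall g h, K g -> K h -> K (g * h)%g & forall g, K g -> K g^-1%g].

(** Ping-pong is played by the translations of the group on itself: then
the [K j] generate their free product, which applies in every orbit of a free action
of the group. *)
Definition pingpong (J : Type) (G : groupType) (K C : J -> set G) : Prop :=
  [/\ forall j, subgroup_set (K j), forall i j g, C i g -> C j g -> i = j,
      forall j, ~ C j 1%g &
      forall j h g, K j h -> h <> 1%g -> ~ C j g -> C j (h * g)%g].

Section Blocks.
Variables (I J : eqType) (G : groupType) (c : I -> G) (C : I * bool -> set G).
Variable blk : I -> J.
Hypothesis Cdisj : forall k l g, C k g -> C l g -> k = l.
Hypothesis C1 : forall l, ~ C l 1%g.
Hypothesis Cstep : forall l g, ~ C (flip l) g -> C l (lval c l * g)%g.

Definition block (j : J) : set G :=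
  [set h | exists2 w, all (fun l => blk l.1 == j) w & h = wval c w].

Definition block_zone (j : J) : set G := [set g | exists2 l, blk l.1 = j & C l g].

Lemma block_subgroup j : subgroup_set (block j).
Proof.
split=> [|g h [v av ->] [w aw ->]|g [v av ->]].
- by exists [::]; rewrite ?wval_nil.
- by exists (v ++ w); rewrite ?all_cat ?av ?aw ?wval_cat.
- exists (invw v); last by rewrite wval_invw.
  by rewrite /invw all_rev all_map; apply: sub_all av => -[].
Qed.

Lemma block_gen i : block (blk i) (c i).
Proof. by exists [:: (i, false)]; rewrite /= ?eqxx // wval_cons wval_nil mulg1. Qed.

(** The letters play ping-pong one by one; in a reduced word of letters of one block,
each of them moves the zone of the letter on its right into its own. *)
Lemma block_pingpong : pingpong block block_zone.
Proof.
split=> [|i j g [k <- Ck] [l <- Cl]|j [l _ /C1]//|].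
- exact: block_subgroup.
- by rewrite (Cdisj Ck Cl).
move=> j h g [w aw ->] v1 ng; move: aw v1.
case/(reduce_word c (P := fun i => blk i == j)) => v [av rv <-] v1.
case: v av rv v1 => [|l v] av rv v1; first by rewrite wval_nil in v1.
have jl : blk l.1 = j by case/andP: av => /eqP.
exists l => //; elim: v l {jl v1} av rv => [|k v IHv] l /= /andP[/eqP jl av] rv.
  by rewrite wval_cons wval_nil mulg1; apply: Cstep => Cl; apply: ng; exists (flip l).
rewrite wval_cons -mulgA; apply: Cstep => Cl.
move: rv => /= /andP[/eqP + rv]; apply.
by rewrite (Cdisj Cl (IHv _ av rv)).
Qed.
End Blocks.

Section PingPongFamily.
Variables (G : groupType) (S : set G) (Sfree : freely_generates S).
Variables (a b : G) (Sa : S a) (Sb : S b) (ab : a <> b).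
Local Open Scope group_scope.

Definition spike m := a ^+ m * b * a ^+ m.

Variables (m_ : nat -> nat) (t : nat -> G).
Hypothesis m_gt0 : forall k, 0 < m_ k.
Hypothesis m_gap : forall i j, i < j -> (m_ i).+1 < m_ j.
Hypothesis t_gen : forall k, t k = 1 \/ S (t k).

Let la := (a, false).
Let lb := (b, false).
Let tw g : seq (G * bool) := if g == 1 then [::] else [:: (g, false)].
Let up k := nseq (m_ k) la.
Let down k := nseq (m_ k) la ++ tw (t k).

(** The zone of a letter consists of the words that begin with the part of
[spike (m_ k) * t k], or of its inverse, that ends with the letter [b], or with its
inverse: this part is what remains in the products. *)
Definition spike_zone (l : nat * bool) : set G :=
  [set g | prefix (if l.2 then invw (lb :: down l.1) else rcons (up l.1) lb)
             (nf Sfree g)].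

Lemma reducedw_const e (w : seq (G * bool)) : all (fun l => l.2 == e) w -> reducedw w.
Proof.
elim: w => // l [//|k w] IHw /= /andP[/eqP le akw].
apply/andP; split; last exact: IHw.
apply/eqP => kl; move: akw => /= /andP[/eqP ke _].
by move: ke; rewrite kl /= le; case: (e).
Qed.

Lemma all_up k : all (fun l => l.2 == false) (up k).
Proof. by apply/allP => l /nseqP[->]. Qed.

Lemma all_down k : all (fun l => l.2 == false) (down k).
Proof. by rewrite all_cat all_up /= /tw; case: ifP. Qed.

Lemma all_invw e (w : seq (G * bool)) :
  all (fun l => l.2 == e) (invw w) = all (fun l => l.2 == ~~ e) w.
Proof.
by rewrite all_rev all_map; apply: eq_all => -[g f] /=; case: e; case: f.
Qed.

Lemma letters_up k : letters S (up k).
Proof. by move=> l /nseqP[->]. Qed.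

Lemma letters_down k : letters S (down k).
Proof.
move=> l; rewrite mem_cat => /orP[/letters_up//|]; rewrite /tw.
by case: eqP => // nt; rewrite inE => /eqP -> /=; case: (t_gen k).
Qed.

Lemma letters_invw w : letters S w -> letters S (invw w).
Proof. by move=> lw l; rewrite mem_rev => /mapP[k /lw Sk ->]. Qed.

Lemma letters_cat v w : letters S v -> letters S w -> letters S (v ++ w).
Proof. by move=> lv lw l; rewrite mem_cat => /orP[/lv|/lw]. Qed.

Lemma wval_spike k : wval id (up k ++ lb :: down k) = spike (m_ k) * t k.
Proof.
rewrite wval_cat wval_cons wval_cat !wval_nseq /spike -!mulgA /lval /=.
congr (_ * (_ * (_ * _))); rewrite /tw; case: eqP => [->|_].
  exact: wval_nil.
by rewrite wval_cons wval_nil mulg1.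
Qed.

Lemma spike_step l g : ~ spike_zone (flip l) g ->
  spike_zone l (lval (fun k => spike (m_ k) * t k) l * g).
Proof.
case: l => k e; rewrite /spike_zone /flip /= => /negP; have [lg rg vg] := nfP Sfree g.
have lW : letters S (up k ++ lb :: down k).
  by apply: letters_cat; [exact: letters_up|apply/letters_cons; split=> //; exact: letters_down].
rewrite /lval -wval_spike; case: e => /= np; last first.
  rewrite nf_wval //; apply: prefix_push => //; apply: (@reducedw_const false).
  by rewrite all_cat /= all_up all_down.
rewrite -wval_invw nf_wval; last exact: letters_invw.
have -> : invw (up k ++ lb :: down k) = invw (down k) ++ flip lb :: invw (up k).
  by rewrite /invw map_cat rev_cat /= rev_cons cat_rcons.
have -> : invw (lb :: down k) = rcons (invw (down k)) (flip lb).
  by rewrite /invw /= rev_cons.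
apply: prefix_push => //.
  by apply: (@reducedw_const true); rewrite all_cat /= !all_invw all_up all_down.
by rewrite /invw /= map_rev rev_cons revK (mapK (@flipK _)) flipK.
Qed.

Lemma prefix_nseq (A B : G * bool) m n w : A != B ->
  prefix (rcons (nseq m A) B) w -> prefix (rcons (nseq n A) B) w -> m = n.
Proof.
move=> AB; elim: m n w => [|m IHm] [|n] [|l w] //=.
- by case: eqP => //= <-; rewrite (negbTE AB).
- by case: eqP => //= <-; rewrite eq_sym (negbTE AB).
- by move=> /andP[_ p] /andP[_ q]; rewrite (IHm _ _ p q).
Qed.

Lemma m_inj i j : m_ i = m_ j -> i = j.
Proof. by case: (ltngtP i j) => // /m_gap + eqm; rewrite eqm ltnNge leqnSn. Qed.

Lemma spike_disj k l g : spike_zone k g -> spike_zone l g -> k = l.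
Proof.
have ltf i j h : spike_zone (i, true) h -> ~ spike_zone (j, false) h.
  rewrite /spike_zone /=; move: (nf Sfree h) => w.
  have : all (fun l => l.2 == true) (invw (lb :: down i)) by rewrite all_invw /= all_down.
  have : size (invw (lb :: down i)) != 0 by rewrite size_rev size_map.
  case: (invw _) => [//|x p] _ /= /andP[/eqP x2 _].
  case: w => [//|y w] /= /andP[/eqP xy _]; rewrite /up.
  case: (m_ j) (m_gt0 j) => // n _ /=; rewrite -xy => /andP[/eqP xa _].
  by rewrite -xa in x2.
case: k l => [i e] [j f]; case: e; case: f.
- rewrite /spike_zone /=; move: (nf _ _) => w.
  have E k : invw (lb :: down k) = invw (tw (t k)) ++ rcons (nseq (m_ k) (flip la)) (flip lb).
    by rewrite /invw /= rev_cons map_cat rev_cat rcons_cat /= map_nseq rev_nseq.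
  have AB : flip la != flip lb by rewrite xpair_eqE /= andbT; apply/eqP.
  rewrite !E /tw; do 2 (case: eqP => [?|?]; rewrite /invw /=).
  + by move=> p q; rewrite (m_inj (prefix_nseq AB p q)).
  (* If [t j] is [a], then it lengthens the power of [a] by one. *)
  + move=> p; case: (eqVneq (t j) a) => [-> q|ta].
      have := prefix_nseq AB p (q : prefix (rcons (nseq (m_ j).+1 (flip la)) (flip lb)) w).
      by case: (ltngtP i j) => [/m_gap|/m_gap|-> //]; lia.
    move: p; case: (m_ i) (m_gt0 i) => //= n _; case: w => //= x w /andP[/eqP <- _].
    by rewrite xpair_eqE /= (negbTE ta).
  + move=> + p; case: (eqVneq (t i) a) => [-> q|ta].
      have := prefix_nseq AB p (q : prefix (rcons (nseq (m_ i).+1 (flip la)) (flip lb)) w).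
      by case: (ltngtP i j) => [/m_gap|/m_gap|-> //]; lia.
    move: p; case: (m_ j) (m_gt0 j) => //= n _; case: w => //= x w /andP[/eqP <- _].
    by rewrite xpair_eqE /= (negbTE ta).
  + case: w => //= x w /andP[_ p] /andP[_ q].
    by rewrite (m_inj (prefix_nseq AB p q)).
- by move=> /ltf h /h.
- by move=> + /ltf h => /h.
- rewrite /spike_zone /= => p q; rewrite (m_inj (prefix_nseq _ p q)) //.
  by rewrite xpair_eqE /= andbT; apply/eqP.
Qed.

Lemma spike_zone1 l : ~ spike_zone l 1.
Proof.
rewrite /spike_zone /= nf1 prefixs0 -size_eq0.
by case: (l.2); rewrite ?size_rev ?size_rcons ?size_map.
Qed.

Lemma spike_order k n : (spike (m_ k) * t k) ^+ n.+1 <> 1.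
Proof.
have h : spike_zone (k, false) ((spike (m_ k) * t k) ^+ n.+1).
  elim: n => [|n IHn].
    by rewrite expg1 -[_ * t k]mulg1; apply: (@spike_step (k, false)); exact: spike_zone1.
  by rewrite expgS; apply: (@spike_step (k, false)) => h; have := spike_disj IHn h.
by move=> E; rewrite E in h; exact: spike_zone1 h.
Qed.

(** The letter [b] between the two powers of [a] in a spike survives every
cancellation, for these powers have different exponents in distinct spikes; the gap
two between the exponents keeps this true if a spike is followed by the letter [a]. *)
Lemma spike_pingpong (J : eqType) (blk : nat -> J) :
  pingpong (block (fun k => spike (m_ k) * t k) blk) (block_zone spike_zone blk).
Proof.
apply: block_pingpong; first exact: spike_disj; first exact: spike_zone1.
exact: spike_step.
Qed.
End PingPongFamily.

(** * Actions of free groups *)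

Section ActionLemmas.
Variables (D : groupType) (X : Type) (b : D -> X -> X) (bF : free_action b).
Local Open Scope group_scope.

Lemma actK g : cancel (b g) (b g^-1).
Proof. by have [[b1 bM] _] := bF; move=> x; rewrite -bM mulVg b1. Qed.

Lemma actVK g : cancel (b g^-1) (b g).
Proof. by have [[b1 bM] _] := bF; move=> x; rewrite -bM mulgV b1. Qed.

Lemma free_action_inj g h x : b g x = b h x -> g = h.
Proof.
have [[b1 bM] bf] := bF => gh; rewrite -[g]invgK; apply: mulg1_eq.
by apply: (bf _ x); rewrite bM -gh actK.
Qed.
End ActionLemmas.

Section RunSplitting.
Variables (J : eqType).

Lemma split_run (l : J * bool) w : reducedw (l :: w) ->
  exists n w', [/\ l :: w = nseq n.+1 l ++ w', reducedw w' &
    if w' is k :: _ then k.1 != l.1 else true].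
Proof.
elim: w => [|k w IHw] in l *; first by exists 0, [::].
move=> /= /andP[kl rw]; have [kE|kl'] := eqVneq k l.
  have [n [w' [E rw' hw']]] := IHw l (etrans (congr1 (fun z => reducedw (z :: w)) (esym kE)) rw).
  by exists n.+1, w'; split=> //=; rewrite kE E.
exists 0, (k :: w); split=> //=; apply: contra kl => /eqP E.
by move: kl'; case: k l E {rw} => j e [i f] /= ->; rewrite !xpair_eqE !eqxx /=; case: e; case: f.
Qed.
End RunSplitting.

Section FreeGroupAction.
Variables (X : Type) (G : groupType) (S : set G) (Sfree : freely_generates S).
Variables (V V' : G -> X -> X).
Hypothesis VK : forall s, cancel (V s) (V' s).
Hypothesis V'K : forall s, cancel (V' s) (V s).
Local Open Scope group_scope.

Definition lmap (l : G * bool) : X -> X := if l.2 then V' l.1 else V l.1.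
Definition wmap (w : seq (G * bool)) (x : X) : X := foldr lmap x w.
Definition free_act (g : G) : X -> X := wmap (nf Sfree g).

Lemma lmap_flip l x : lmap l (lmap (flip l) x) = x.
Proof. by case: l => s []; rewrite /lmap /= (VK, V'K). Qed.

Lemma wmap_push l w x : wmap (push l w) x = lmap l (wmap w x).
Proof. by case: w => [//|k w] /=; case: eqP => // ->; rewrite /= lmap_flip. Qed.

Lemma wmap_cat v w x : wmap (v ++ w) x = wmap v (wmap w x).
Proof. by rewrite /wmap foldr_cat. Qed.

Lemma wmap_nseq n l x : wmap (nseq n l) x = iter n (lmap l) x.
Proof. by elim: n => //= n ->. Qed.

Lemma free_act_gen s e : S s -> free_act (lval id (s, e)) = lmap (s, e).
Proof.
by move=> Ss; apply/funext => x; rewrite /free_act -[lval _ _]mulg1 nf_lval // nf1.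
Qed.

Lemma free_act_action : group_action free_act.
Proof.
have actS s e g x : S s -> free_act (lval id (s, e) * g) x = lmap (s, e) (free_act g x).
  by move=> Ss; rewrite /free_act nf_lval // wmap_push.
split=> [x|g h x]; first by rewrite /free_act nf1.
elim/(free_gen_ind Sfree): g => [|s g Ss IHg|s g Ss IHg].
- by rewrite mul1g /free_act nf1.
- by rewrite -mulgA (actS s false) // IHg (actS s false).
- by rewrite -mulgA (actS s true) // IHg (actS s true).
Qed.

Section PingPongAction.
Variables (D : groupType) (b : D -> X -> X) (bF : free_action b).
Variables (J : Type) (K C : J -> set D) (KC : pingpong K C).
Variables (blk : G -> J).
Hypothesis blk_inj : forall s t, S s -> S t -> blk s = blk t -> s = t.
Hypothesis VD : forall s x, S s -> exists2 h, K (blk s) h & V s x = b h x.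
Hypothesis V_aperiodic : forall s n x, S s -> iter n.+1 (V s) x <> x.

Lemma lmapD l x : S l.1 -> exists2 h, K (blk l.1) h & lmap l x = b h x.
Proof.
case: l => s [] /= Ss; rewrite /lmap /=; last exact: VD.
have [h Kh E] := VD (V' s x) Ss; exists h^-1.
  by have [KS _ _ _] := KC; have [_ _] := KS (blk s); apply.
by rewrite V'K in E; rewrite [in RHS]E actK.
Qed.

Lemma lmap_iterD n l x : S l.1 ->
  exists2 h, K (blk l.1) h & iter n (lmap l) x = b h x.
Proof.
move=> Sl; have [[b1 bM] _] := bF; have [KS _ _ _] := KC.
have [K1 KM _] := KS (blk l.1).
elim: n => [|n [h Kh /= ->]]; first by exists 1; rewrite ?b1.
by have [k Kk ->] := lmapD (b h x) Sl; exists (k * h); rewrite ?bM //; exact: KM.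
Qed.

Lemma lmap_aperiodic n l x : S l.1 -> iter n.+1 (lmap l) x <> x.
Proof.
case: l => s [] /= Ss; rewrite /lmap /= -iterS => E; last exact: (V_aperiodic Ss E).
apply: (@V_aperiodic s n x Ss); rewrite -[in LHS]E.
by elim: n.+1 => [//|m IHm]; rewrite iterSr [iter m.+1 (V' s) x]iterS V'K.
Qed.

(** A run of equal letters acts on its point by an element of the block of this
letter, and not by the unit since the generators are aperiodic; successive runs are
in different blocks. So ping-pong applies to the runs, although the elements of [D]
by which they act depend on the point. *)
Lemma wmap_zone l w x : letters S (l :: w) -> reducedw (l :: w) ->
  exists2 h, C (blk l.1) h & wmap (l :: w) x = b h x.
Proof.
have [[b1 bM] _] := bF; have [KS Cd C1 Kstep] := KC.
have [m] := ubnP (size w); elim: m => // m IHm in l w * => sw lw rw.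
have [n [w' [E rw' hw']]] := split_run rw.
have Sl : S l.1 by apply: lw; rewrite inE eqxx.
rewrite E wmap_cat wmap_nseq.
have [g ng ->] : exists2 g, ~ C (blk l.1) g & wmap w' x = b g x.
  case: w' E rw' hw' => [|k w'] E rw' hw'; first by exists 1; rewrite ?b1.
  have lw' : letters S (k :: w') by move=> i iw'; apply: lw; rewrite E mem_cat iw' orbT.
  have [|g Cg ->] := IHm k w' _ lw' rw'.
    by move: (congr1 size E) sw; rewrite size_cat size_nseq /=; lia.
  exists g => // Cg'; move/eqP: hw'; apply; apply: blk_inj => //.
    by apply: lw'; rewrite inE eqxx.
  exact: Cd Cg Cg'.
have [h Kh hE] := lmap_iterD n.+1 (b g x) Sl.
exists (h * g); last by rewrite hE bM.
apply: Kstep => // h1; apply: (@lmap_aperiodic n l (b g x) Sl).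
by rewrite hE h1 b1.
Qed.

Lemma free_act_free : free_action free_act.
Proof.
split=> [|g x]; first exact: free_act_action.
have [[b1 bM] bf] := bF; have [_ _ C1 _] := KC.
have [lg rg vg] := nfP Sfree g; rewrite /free_act -{2}vg.
case: (nf Sfree g) lg rg => [|l w] lw rw; first by rewrite wval_nil.
have [h Ch ->] := wmap_zone x lw rw.
by move=> /bf h1; rewrite h1 in Ch; case: (C1 _ Ch).
Qed.

(** If a reduced word moves [x] by an element of the block of [s], then its first run
consists of letters [s] by ping-pong, and so the rest of the word moves [x] by an
element of the same block. A rest that is not empty starts with another letter, and
moves [x] into the zone of another block. *)
Lemma free_act_block g s h x : S s -> K (blk s) h -> free_act g x = b h x ->
  exists n e, free_act g x = iter n (lmap (s, e)) x.
Proof.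
move=> Ss Kh; have [[b1 bM] bf] := bF; have [KS Cd C1 Kstep] := KC.
have [K1 KM KV] := KS (blk s).
have [lg rg _] := nfP Sfree g; rewrite /free_act.
case: (nf Sfree g) lg rg => [|l w] lw rw gE; first by exists 0, false.
have [h' Ch' h'E] := wmap_zone x lw rw.
have {h'E} hh' : h' = h by apply: (free_action_inj bF (x := x)); rewrite -h'E.
have h1 : h <> 1 by move=> h1; apply: (C1 (blk l.1)); rewrite -h1 -hh'.
have Ch : C (blk s) h by rewrite -[h]mulg1; apply: Kstep.
have Sl : S l.1 by apply: lw; rewrite inE eqxx.
have ls : l.1 = s by apply: blk_inj => //; apply: Cd Ch; rewrite -hh'.
have [n [w' [E rw' hw']]] := split_run rw.
exists n.+1, l.2; rewrite -ls -surjective_pairing E wmap_cat wmap_nseq.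
case: w' E rw' hw' => [//|k w'] E rw' hw'.
have lw' : letters S (k :: w') by move=> i iw'; apply: lw; rewrite E mem_cat iw' orbT.
have [f Cf fE] := wmap_zone x lw' rw'.
have [p Kp pE] := lmap_iterD n.+1 (b f x) Sl.
move: gE; rewrite E wmap_cat wmap_nseq fE pE -bM => /(free_action_inj bF) pf.
have Kf : K (blk s) f.
  by rewrite (_ : f = p^-1 * h); [apply: KM => //; apply: KV; rewrite -ls|rewrite -pf mulKg].
have f1 : f <> 1 by move=> f1; apply: (C1 (blk k.1)); rewrite -f1.
have Cf' : C (blk s) f by rewrite -[f]mulg1; apply: Kstep.
have Sk : S k.1 by apply: lw'; rewrite inE eqxx.
by move/eqP: hw'; case; rewrite ls; apply: blk_inj => //; exact: Cd Cf Cf'.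
Qed.
End PingPongAction.
End FreeGroupAction.

Local Open Scope ring_scope.

(** * Measurable predicates *)

Lemma countable_enum (I : Type) : countable [set: I] -> I ->
  exists e : nat -> I, forall i, exists n, e n = i.
Proof.
move=> /countable_injP[f finj] i0.
exists (fun n => if pselect (exists i, f i = n) is left h then projT1 (cid h) else i0).
move=> i; exists (f i); case: pselect => [h|[]]; last by exists i.
by apply: finj; rewrite ?inE //; case: cid.
Qed.

Section MeasurablePredicates.
Context {d : measure_display} {T : measurableType d}.
Implicit Types P Q : T -> Prop.

Lemma mset_not P : measurable [set x | P x] -> measurable [set x | ~ P x].
Proof. exact: measurableC. Qed.

Lemma mset_and P Q : measurable [set x | P x] -> measurable [set x | Q x] ->
  measurable [set x | P x /\ Q x].
Proof. exact: measurableI. Qed.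

Lemma mset_or P Q : measurable [set x | P x] -> measurable [set x | Q x] ->
  measurable [set x | P x \/ Q x].
Proof. exact: measurableU. Qed.

Lemma mset_imp P Q : measurable [set x | P x] -> measurable [set x | Q x] ->
  measurable [set x | P x -> Q x].
Proof.
move=> mP mQ; rewrite (_ : [set x | P x -> Q x] = [set x | ~ P x \/ Q x]).
  by apply: mset_or => //; exact: mset_not.
apply/seteqP; split=> x /= h; last by case: h.
by have [/h|] := pselect (P x); [right|left].
Qed.

Lemma mset_cst (P : Prop) : measurable [set _ : T | P].
Proof.
have [p|np] := pselect P.
  by rewrite (_ : [set _ | _] = setT) //; apply/seteqP; split.
by rewrite (_ : [set _ | _] = set0) //; apply/seteqP; split.
Qed.

Lemma mset_ex (I : Type) (P : I -> T -> Prop) : countable [set: I] ->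
  (forall i, measurable [set x | P i x]) -> measurable [set x | exists i, P i x].
Proof.
move=> cI mP; rewrite (_ : [set x | _] = \bigcup_i [set x | P i x]).
  exact: countable_bigcupT_measurable.
by apply/seteqP; split=> x [i]; [exists i|exists i].
Qed.

Lemma mset_all (I : Type) (P : I -> T -> Prop) : countable [set: I] ->
  (forall i, measurable [set x | P i x]) -> measurable [set x | forall i, P i x].
Proof.
move=> cI mP; rewrite (_ : [set x | _] = [set x | ~ exists i, ~ P i x]).
  by apply: mset_not; apply: mset_ex => // i; exact: mset_not.
by apply/seteqP; split=> x /= h; [case=> i; apply|move=> i; apply: contrapT => np; apply: h; exists i].
Qed.

Lemma mset_preimage d' (T' : measurableType d') (f : T -> T') (A : set T') :
  measurable_fun setT f -> measurable A -> measurable [set x | A (f x)].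
Proof. by move=> mf mA; rewrite -[X in measurable X]setTI; exact: mf. Qed.

Lemma measurable_fun_countable d' (T' : measurableType d') (I : Type)
    (f : T -> T') (c : T -> I -> Prop) (g : I -> T -> T') : countable [set: I] ->
  (forall i, measurable [set x | c x i]) -> (forall i, measurable_fun setT (g i)) ->
  (forall x, exists2 i, c x i & f x = g i x) -> (forall x i, c x i -> f x = g i x) ->
  measurable_fun setT f.
Proof.
move=> cI mc mg ex un _ A mA; rewrite setTI.
rewrite (_ : f @^-1` A = [set x | exists i, c x i /\ A (g i x)]).
  apply: mset_ex => // i; apply: mset_and => //; exact: mset_preimage.
apply/seteqP; split=> x /=; last by move=> [i [/un ->]].
by have [i ci ->] := ex x; exists i.
Qed.
End MeasurablePredicates.

(** * Real-valued probabilities *)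

Section RealProbability.
Context {d : measure_display} {T : measurableType d} {R : realType}.
Variable mu : probability T R.
Implicit Types A B : set T.

Definition pr A : R := fine (mu A).

Lemma prE A : measurable A -> mu A = (pr A)%:E.
Proof. by move=> mA; rewrite /pr fineK // fin_num_measure. Qed.

Lemma pr_ge0 A : 0 <= pr A. Proof. by rewrite /pr fine_ge0. Qed.

Lemma prT : pr setT = 1. Proof. by rewrite /pr probability_setT. Qed.

Lemma pr0 : pr set0 = 0. Proof. by rewrite /pr measure0. Qed.

Lemma pr_eq0 A : measurable A -> mu A = 0%E <-> pr A = 0.
Proof. by move=> mA; rewrite prE //; split=> [[]|->]. Qed.

Lemma pr_le A B : measurable A -> measurable B -> A `<=` B -> pr A <= pr B.
Proof.
by move=> mA mB AB; rewrite -lee_fin -!prE //; apply: le_measure => //; rewrite inE.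
Qed.

Lemma pr_le1 A : measurable A -> pr A <= 1.
Proof. by move=> mA; rewrite -prT; exact: pr_le. Qed.

Lemma pr_DI A B : measurable A -> measurable B -> pr A = pr (A `\` B) + pr (A `&` B).
Proof.
move=> mA mB; apply: EFin_inj; rewrite EFinD -!prE //; first exact: measureDI.
  exact: measurableI.
exact: measurableD.
Qed.

Lemma pr_C A : measurable A -> pr (~` A) = 1 - pr A.
Proof.
move=> mA; rewrite -prT [X in _ = X - _](pr_DI _ mA) // setTD setTI; lra.
Qed.

Lemma pr_U A B : measurable A -> measurable B -> A `&` B = set0 ->
  pr (A `|` B) = pr A + pr B.
Proof.
move=> mA mB AB; apply: EFin_inj; rewrite EFinD -!prE //; first exact: measureU.
exact: measurableU.
Qed.

Lemma pr_leU A B : measurable A -> measurable B -> pr (A `|` B) <= pr A + pr B.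
Proof.
move=> mA mB; rewrite -lee_fin EFinD -!prE //; first exact: measureU2.
exact: measurableU.
Qed.

Lemma pr_bigcup0 (I : Type) (F : I -> set T) : countable [set: I] ->
  (forall i, measurable (F i)) -> (forall i, pr (F i) = 0) -> pr (\bigcup_i F i) = 0.
Proof.
move=> cI mF F0; apply/pr_eq0; first exact: countable_bigcupT_measurable.
have [[i0]|nI] := pselect (inhabited I); last first.
  rewrite (_ : \bigcup_i F i = set0) ?measure0 //.
  by apply/seteqP; split=> // x [i]; case: nI.
have [e eP] := countable_enum cI i0.
rewrite (_ : \bigcup_i F i = \bigcup_n F (e n)); last first.
  apply/seteqP; split=> x [i _ Fx]; last by exists (e i).
  by have [n en] := eP i; exists n; rewrite ?en.
apply/negligibleP; first exact: bigcupT_measurable.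
by apply: negligible_bigcup => n; apply/negligibleP => //; apply/pr_eq0.
Qed.

Lemma pr_cvg (F : nat -> set T) : (forall i, measurable (F i)) ->
  (forall i, F i `<=` F i.+1) -> pr (F n) @[n --> \oo] --> pr (\bigcup_n F n).
Proof.
move=> mF ndF; have mU : measurable (\bigcup_n F n) by exact: bigcupT_measurable.
apply: (fine_cvg (f := mu \o F)); rewrite -prE //; apply: nondecreasing_cvg_mu => //.
by apply/nondecreasing_seqP => n; apply/subsetPset; exact: ndF.
Qed.

Lemma pr_cvg_cap (F : nat -> set T) : (forall i, measurable (F i)) ->
  (forall i, F i.+1 `<=` F i) -> pr (F n) @[n --> \oo] --> pr (\bigcap_n F n).
Proof.
move=> mF niF; have mU : measurable (\bigcap_n F n) by exact: bigcapT_measurable.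
apply: (fine_cvg (f := mu \o F)); rewrite -prE //; apply: nonincreasing_cvg_mu => //.
  exact: (le_lt_trans (probability_le1 mu (mF 0%N)) (ltry 1)).
by apply/nonincreasing_seqP => n; apply/subsetPset; exact: niF.
Qed.

(** The distance of two sets in the measure algebra. *)
Definition pdist A B : R := pr (A `\` B) + pr (B `\` A).

Lemma pdist_ge0 A B : 0 <= pdist A B.
Proof. by rewrite addr_ge0 // pr_ge0. Qed.

Lemma pdist_sym A B : pdist A B = pdist B A.
Proof. by rewrite /pdist addrC. Qed.

Lemma pr_dist A B : measurable A -> measurable B -> `|pr A - pr B| <= pdist A B.
Proof.
move=> mA mB; rewrite /pdist (pr_DI mA mB) (pr_DI mB mA) (setIC B).
have := pr_ge0 (A `\` B); have := pr_ge0 (B `\` A).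
by rewrite ler_norml; lra.
Qed.

Lemma pdist_tri A B C : measurable A -> measurable B -> measurable C ->
  pdist A C <= pdist A B + pdist B C.
Proof.
have half A' B' C' : measurable A' -> measurable B' -> measurable C' ->
    pr (A' `\` C') <= pr (A' `\` B') + pr (B' `\` C').
  move=> mA mB mC; apply: le_trans (pr_leU (measurableD mA mB) (measurableD mB mC)).
  apply: pr_le; [exact: measurableD|by apply: measurableU; exact: measurableD|].
  by move=> x [Ax nCx]; have [Bx|nBx] := pselect (B' x); [right|left].
move=> mA mB mC; have := half _ _ _ mA mB mC; have := half _ _ _ mC mB mA.
by rewrite /pdist; lra.
Qed.
End RealProbability.

(** * An ergodic subgroup of infinite corank *)

(** The 2-adic valuation takes every value infinitely often. *)
Definition rep (n : nat) : nat := logn 2 n.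

Lemma rep_inf i N : exists2 n, (N <= n)%N & rep n = i.
Proof.
exists (2 ^ i * N.*2.+1)%N.
  have : (0 < 2 ^ i)%N by rewrite expn_gt0.
  rewrite -muln2; nia.
rewrite /rep lognM ?expn_gt0 // lognX logn_prime // eqxx muln1.
by rewrite lognE /= dvdn2 /= odd_double addn0.
Qed.

Section SimultaneousLimits.
Variables (R : realType) (f : nat -> nat -> R).
Hypothesis f01 : forall i m, 0 <= f i m <= 1.

(** The limits along an ultrafilter that contains the neighbourhoods of infinity are
cluster values of all the sequences at the same time. *)
Lemma simultaneous_cluster : exists q : nat -> R, forall N k (e : R), 0 < e ->
  exists2 m, (N <= m)%N & forall i, (i <= k)%N -> `|f i m - q i| < e.
Proof.
have [G [GU oG]] := ultraFilterLemma eventually_filter.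
have lim i : exists q : R, forall e : R, 0 < e -> G [set m | `|f i m - q| < e].
  have [|q [_ qG]] := @segment_compact R 0 1 (f i @ G) _.
    by rewrite /= /fmap /=; apply: filterS filterT => m _; rewrite /= in_itv /= f01.
  exists q => e e0; have [//|Gn] := in_ultra_setVsetC [set m | `|f i m - q| < e] GU.
  have [|z [zn zq]] := qG (~` ball q e) (ball q e) _ (nbhsx_ballx _ _ e0).
    apply: (@filterS _ G _ _ (f i @^-1` (~` ball q e)) _ Gn) => m /= h; apply: contra_not h.
    by rewrite /ball /= distrC.
  by have := zn zq.
have [q qP] := choice lim; exists q => N k e e0.
have GN : G [set m | (N <= m)%N] by apply: oG; exists N.
have Gk : G [set m | forall i, (i <= k)%N -> `|f i m - q i| < e].
  elim: k => [|k IHk]; first by apply: filterS (qP 0%N e e0) => m h [|].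
  apply: filterS2 IHk (qP k.+1 e e0) => m h h' i; rewrite leq_eqVlt ltnS.
  by case/predU1P => [->|/h].
by have [m [Nm h]] := filter_ex (filterI GN Gk); exists m.
Qed.

Lemma simultaneous_subseq : exists (m_ : nat -> nat) (q : nat -> R),
  [/\ forall k, (0 < m_ k)%N, forall i j, (i < j)%N -> ((m_ i).+1 < m_ j)%N &
      forall i k, (i <= k)%N -> `|f i (m_ k) - q i| < k.+1%:R^-1].
Proof.
have [q qP] := simultaneous_cluster.
have nxt (p : nat * nat) : exists m, (p.1 <= m)%N /\
    forall i, (i <= p.2)%N -> `|f i m - q i| < p.2.+1%:R^-1.
  by have [|m] := qP p.1 p.2 p.2.+1%:R^-1; [rewrite invr_gt0 ltr0n|exists m].
have [g gP] := choice nxt.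
pose m_ := fix m_ k := if k is k'.+1 then g ((m_ k').+2, k) else g (1%N, 0%N).
have mS k : ((m_ k).+1 < m_ k.+1)%N by have [+ _] := gP ((m_ k).+2, k.+1).
exists m_, q; split.
- case=> [|k]; first by have [+ _] := gP (1%N, 0%N).
  exact: leq_trans (mS k).
- move=> i j; elim: j => // j IHj; rewrite ltnS leq_eqVlt => /predU1P[->//|/IHj ij].
  by apply: leq_trans ij _; apply: leq_trans (mS j); rewrite leqW.
- move=> i [|k] ik; first by have [_] := gP (1%N, 0%N); apply.
  by have [_] := gP ((m_ k).+2, k.+1); apply.
Qed.
End SimultaneousLimits.

Section Ergodicity.
Context {d : measure_display} {T : measurableType d} {R : realType}.
Variable mu : probability T R.
Variables (D : groupType) (b : D -> T -> T).
Hypothesis bA : group_action b.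
Hypothesis bm : forall g, measurable_fun setT (b g).
Hypothesis binv : forall g A, measurable A -> pr mu (b g @^-1` A) = pr mu A.
Local Notation pr := (pr mu).
Local Notation dist := (pdist mu).

Definition ergodic_under (K : set D) : Prop := forall B, measurable B ->
  (forall g x, K g -> B x -> B (b g x)) -> pr B = 0 \/ pr B = 1.

Lemma bpre g A : measurable A -> measurable (b g @^-1` A).
Proof. by move=> mA; rewrite -[X in measurable X]setTI; exact: bm. Qed.

Lemma preM g h A : b (g * h)%g @^-1` A = b h @^-1` (b g @^-1` A).
Proof. by have [_ bM] := bA; apply/seteqP; split=> x /=; rewrite bM. Qed.

Lemma invariant_pre (K : set D) B g : subgroup_set K ->
  (forall g x, K g -> B x -> B (b g x)) -> K g -> b g @^-1` B = B.
Proof.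
move=> [_ _ KV] Binv Kg; have [b1 bM] := bA; apply/seteqP; split=> x /=; last exact: Binv.
by move/(Binv g^-1%g _ (KV _ Kg)); rewrite -bM mulVg b1.
Qed.

Lemma pdistI A B C E : measurable A -> measurable B -> measurable C -> measurable E ->
  `|pr (A `&` B) - pr (C `&` E)| <= dist A C + dist B E.
Proof.
move=> mA mB mC mE.
have mI : measurable (A `&` B) by exact: measurableI.
have mI' : measurable (C `&` E) by exact: measurableI.
apply: le_trans (pr_dist _ mI mI') _.
have := pr_leU mu (measurableD mA mC) (measurableD mB mE).
have := pr_leU mu (measurableD mC mA) (measurableD mE mB).
have : pr ((A `&` B) `\` (C `&` E)) <= pr ((A `\` C) `|` (B `\` E)).
  apply: pr_le; [exact: measurableD|by apply: measurableU; exact: measurableD|].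
  move=> x [[Ax Bx] nCE]; have [Cx|nCx] := pselect (C x); last by left.
  by right; split=> // Ex; apply: nCE.
have : pr ((C `&` E) `\` (A `&` B)) <= pr ((C `\` A) `|` (E `\` B)).
  apply: pr_le; [exact: measurableD|by apply: measurableU; exact: measurableD|].
  move=> x [[Ax Bx] nCE]; have [Cx|nCx] := pselect (A x); last by left.
  by right; split=> // Ex; apply: nCE.
rewrite /pdist; lra.
Qed.

Lemma pdist_pre g A B : measurable A -> measurable B ->
  dist (b g @^-1` A) (b g @^-1` B) = dist A B.
Proof.
move=> mA mB; rewrite /pdist.
have E X Y : b g @^-1` X `\` b g @^-1` Y = b g @^-1` (X `\` Y) by [].
by rewrite !E !binv //; exact: measurableD.
Qed.

Variable A_ : nat -> set T.
Hypothesis mA : forall i, measurable (A_ i).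
Hypothesis A_dense : forall B, measurable B -> forall e : R, 0 < e ->
  exists i, dist B (A_ i) < e.
Variables (S : set D) (Sgen : forall P : D -> Prop, P 1%g ->
  (forall s g, S s -> P g -> P (s * g)%g) ->
  (forall s g, S s -> P g -> P (s^-1 * g)%g) -> forall g, P g).
Hypothesis cD : countable [set: D].
Hypothesis erg : ergodic_under setT.

(** The correlations of a set with its translates by the elements [g k] converge.
If [B] is invariant under infinitely many [g k] and under infinitely many
[g k * t], then the limit is the measure of [B] in the first case, and the measure
of the intersection of [B] with its translate by [t] in the second. *)
Lemma ergodic_twins (g t : nat -> D) (q : nat -> R) (K : set D) :
  (forall i k, (i <= k)%N -> `|pr (b (g k) @^-1` A_ i `&` A_ i) - q i| < k.+1%:R^-1) ->
  subgroup_set K ->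
  (forall s, s = 1%g \/ S s -> forall N, exists k, [/\ (N <= k)%N, t k = s & K (g k * t k)%g]) ->
  ergodic_under K.
Proof.
move=> gq KS twin B mB Binv; have [b1 bM] := bA.
have Kpre h : K h -> b h @^-1` B = B by apply: invariant_pre.
have corr i k C : (i <= k)%N -> measurable C -> b (g k) @^-1` B = C ->
    `|pr (C `&` B) - q i| < dist B (A_ i) + dist B (A_ i) + k.+1%:R^-1.
  move=> ik mC CE; have mC' := bpre (g k) (mA i); have := gq i k ik.
  have := pdistI (bpre (g k) mB) mB mC' (mA i); move: (k.+1%:R^-1 : R) => v.
  rewrite pdist_pre // CE ler_norml ltr_norml => /andP[? ?] /andP[? ?].
  by rewrite ltr_norml; lra.
(* Compare the correlations for two indices [k] and [l] beyond [N]: the first gives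
   the measure of [B], the second its correlation with its translate by [s]. *)
have step s : S s -> pr (b s^-1%g @^-1` B `&` B) = pr B.
  move=> Ss; apply/eqP; rewrite -subr_eq0 -normr_eq0 eq_le normr_ge0 andbT.
  apply/ler_addgt0Pl => e e0; rewrite addr0.
  have e8 : 0 < e / 8 by lra.
  have [i Bi] := A_dense mB e8.
  have [N] := ltr_add_invr e8; rewrite add0r => N0.
  have inv k : (N <= k)%N -> k.+1%:R^-1 < e / 8.
    by move=> Nk; apply: le_lt_trans N0; rewrite lef_pV2 ?posrE ?ltr0n // ler_nat.
  have [k [Nk tk Kk]] := twin 1%g (or_introl erefl) (maxn i N).
  have [l [Nl tl Kl]] := twin s (or_intror Ss) (maxn i N).
  have Bk : b (g k) @^-1` B = B by rewrite -{2}(Kpre _ Kk) tk mulg1.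
  have Bl : b (g l) @^-1` B = b s^-1%g @^-1` B.
    by rewrite -{2}(Kpre _ Kl) tl -preM -mulgA mulgV mulg1.
  move: Nk Nl; rewrite !geq_max => /andP[ik /inv k8] /andP[il /inv l8].
  have := corr i k _ ik mB Bk; have := corr i l _ il (bpre _ mB) Bl.
  move: (k.+1%:R^-1 : R) (l.+1%:R^-1 : R) k8 l8 => u v k8 l8.
  rewrite setIid !ltr_norml => /andP[? ?] /andP[? ?].
  by rewrite ler_norml; lra.
have null0 s : S s -> dist B (b s^-1%g @^-1` B) = 0.
  move=> Ss; have := step s Ss; have mB' := bpre s^-1%g mB.
  have := pr_DI mu mB mB'; have := pr_DI mu mB' mB; rewrite binv // (setIC B) /pdist.
  lra.
have all0 g' : dist B (b g' @^-1` B) = 0.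
  elim/Sgen: g' => [|s h Ss IHh|s h Ss IHh].
  - by rewrite (_ : _ @^-1` _ = B) ?/pdist ?setDv ?pr0 ?addr0 //; apply/seteqP; split=> x; rewrite /= b1.
  - rewrite preM; apply/eqP; rewrite eq_le pdist_ge0 andbT.
    apply: le_trans (pdist_tri _ mB (bpre h mB) (bpre h (bpre s mB))) _.
    rewrite IHh add0r pdist_pre //; last exact: bpre.
    rewrite -(pdist_pre s^-1%g) //; last exact: bpre.
    by rewrite -preM mulgV pdist_sym (_ : b 1%g @^-1` B = B) ?null0 //; apply/seteqP; split=> x; rewrite /= b1.
  - rewrite preM; apply/eqP; rewrite eq_le pdist_ge0 andbT.
    apply: le_trans (pdist_tri _ mB (bpre h mB) (bpre h (bpre _ mB))) _.
    by rewrite IHh add0r pdist_pre // ?null0 //; exact: bpre.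
pose B' := [set x | forall g, B (b g x)].
have mB' : measurable B' by apply: mset_all => // h; exact: bpre.
have B'B : B' `<=` B by move=> x /(_ 1%g); rewrite b1.
have BB' : pr (B `\` B') = 0.
  rewrite (_ : B `\` B' = \bigcup_g (B `\` b g @^-1` B)); last first.
    apply/seteqP; split=> x; last by move=> [h _ [Bx nB]]; split=> // /(_ h).
    by move=> [Bx /existsNP[h nB]]; exists h.
  apply: pr_bigcup0 => // h; first by apply: measurableD => //; exact: bpre.
  have := all0 h; rewrite /pdist; have := pr_ge0 mu (B `\` b h @^-1` B).
  by have := pr_ge0 mu (b h @^-1` B `\` B); lra.
have prB : pr B = pr B' by rewrite (pr_DI mu mB mB') BB' add0r setIidr.
rewrite prB; apply: erg => // h x _ Bx k; rewrite -bM; exact: Bx.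
Qed.
End Ergodicity.

(** * Matching sets of equal measure *)

Section Matching.
Context {d : measure_display} {T : measurableType d} {R : realType}.
Variable mu : probability T R.
Variables (D : groupType) (b : D -> T -> T).
Hypothesis bA : group_action b.
Hypothesis bm : forall g, measurable_fun setT (b g).
Hypothesis binv : forall g A, measurable A -> pr mu (b g @^-1` A) = pr mu A.
Variable K : set D.
Hypothesis KS : subgroup_set K.
Hypothesis cD : countable [set: D].
Hypothesis erg : ergodic_under mu b K.
Local Notation pr := (pr mu).

Lemma subgroup_enum : exists e : nat -> D, (forall n, K (e n)) /\ forall h, K h -> exists n, e n = h.
Proof.
have [e eP] := countable_enum cD 1%g.
exists (fun n => if pselect (K (e n)) is left _ then e n else 1%g); split=> [n|h Kh].
  by case: pselect => // _; case: KS.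
by have [n en] := eP h; exists n; case: pselect => //; rewrite en.
Qed.

Variables (A B : set T) (mA : measurable A) (mB : measurable B).
Hypothesis AB : A `&` B = set0.
Hypothesis prAB : pr A = pr B.

(** Each element of [K] in turn matches the points left over in [A] that it takes to
points left over in [B]. At the end, no element of [K] takes a point left over in [A]
to one left over in [B]. The two remainders have equal measure; if it were positive, the
[K]-saturation of the first would be conull by ergodicity, and would meet the second. *)
Lemma matching : exists (s : T -> T) (A' B' : set T),
  [/\ [/\ involutive s, measurable_fun setT s & forall x, exists2 h, K h & s x = b h x],
      [/\ measurable A', measurable B', A' `<=` A & B' `<=` B],
      pr (A `\` A') = 0 /\ pr (B `\` B') = 0 &
      [/\ forall x, A' x -> B' (s x), forall x, B' x -> A' (s x) &
          forall x, ~ A' x -> ~ B' x -> s x = x]].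
Proof.
have [b1 bM] := bA; have [K1 _ KV] := KS; have [e [eK eP]] := subgroup_enum.
(* [left_ k] is the pair of the sets of points left over by the first [k] elements. *)
pose hit (p : set T * set T) k := p.1 `&` b (e k) @^-1` p.2.
pose left_ := fix left_ k : set T * set T := if k is k'.+1 then
  ((left_ k').1 `\` hit (left_ k') k',
   (left_ k').2 `\` b (e k')^-1%g @^-1` hit (left_ k') k') else (A, B).
pose M k := hit (left_ k) k.
pose M' k := b (e k)^-1%g @^-1` M k.
have bpre' := @bpre _ _ _ b bm.
have mleft k : measurable (left_ k).1 /\ measurable (left_ k).2.
  elim: k => [//|k [m1 m2]] /=; have mh : measurable (hit (left_ k) k).
    by apply: measurableI => //; exact: bpre'.
  by split; apply: measurableD => //; exact: bpre'.
have mM k : measurable (M k).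
  by have [m1 m2] := mleft k; apply: measurableI => //; exact: bpre'.
have mM' k : measurable (M' k) by exact: bpre'.
have left_dec k l : (k <= l)%N ->
    (left_ l).1 `<=` (left_ k).1 /\ (left_ l).2 `<=` (left_ k).2.
  elim: l => [|l IHl]; first by rewrite leqn0 => /eqP ->; split.
  rewrite leq_eqVlt ltnS => /predU1P[->|/IHl[s1 s2]]; first by split.
  by split=> x [lx _]; [apply: s1|apply: s2].
have M'E k y : M' k (b (e k) y) = M k y by rewrite /M' /= -bM mulVg b1.
have MB k x : M k x -> (left_ k).2 (b (e k) x) by case.
have M'B k x : M' k x -> (left_ k).2 x.
  by rewrite /M' /= => /MB; rewrite -bM mulgV b1.
have Muniq k l x : M k x -> M l x -> k = l.
  wlog kl : k l / (k <= l)%N.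
    by move=> H kx lx; have [/H|/ltnW/H] := leqP k l; [apply|move=> h; apply/esym/h].
  move: kl; rewrite leq_eqVlt => /predU1P[//|kl] kx [lx _].
  by have [/(_ _ lx)[]] := left_dec _ _ kl.
have M'uniq k l x : M' k x -> M' l x -> k = l.
  wlog kl : k l / (k <= l)%N.
    by move=> H kx lx; have [/H|/ltnW/H] := leqP k l; [apply|move=> h; apply/esym/h].
  move: kl; rewrite leq_eqVlt => /predU1P[//|kl] kx /M'B lx.
  by have [_ /(_ _ lx)[]] := left_dec _ _ kl.
have MA k x : M k x -> A x by case=> + _; have [+ _] := left_dec _ _ (leq0n k); apply.
have M'B0 k x : M' k x -> B x by move/M'B; have [_ +] := left_dec _ _ (leq0n k); apply.
have MM' k l x : M k x -> ~ M' l x.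
  by move=> /MA Ax /M'B0 Bx; have : (A `&` B) x by []; rewrite AB.
pose rel x y := [\/ exists2 k, M k x & y = b (e k) x, exists2 k, M k y & x = b (e k) y |
  [/\ forall k, ~ M k x, forall k, ~ M' k x & y = x]].
have rel_ex x : exists y, rel x y.
  have [[k kx]|n1] := pselect (exists k, M k x); first by exists (b (e k) x); apply: Or31; exists k.
  have [[k kx]|n2] := pselect (exists k, M' k x).
    by exists (b (e k)^-1%g x); apply: Or32; exists k => //; rewrite -bM mulgV b1.
  by exists x; apply: Or33; split=> // k kx; [apply: n1|apply: n2]; exists k.
have rel_un x y z : rel x y -> rel x z -> y = z.
  have MM k y' z' : M k y' -> forall l, M l z' -> b (e k) y' = b (e l) z' -> y' = z'.
    move=> ky' l lz' E; have kl : k = l.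
      by apply: (M'uniq _ _ (b (e k) y')); [rewrite M'E|rewrite E M'E].
    move: E; rewrite kl => /(congr1 (b (e l)^-1%g)).
    by rewrite -!bM mulVg !b1.
  case=> [[k kx ->]|[k ky ->]|[n1 n2 ->]]; case=> [[l lx ->]|[l lz E]|[n3 n4 ->]] //.
  - by rewrite (Muniq _ _ _ kx lx).
  - by case: (MM' _ l _ kx); rewrite E M'E.
  - by case: (n3 k).
  - by case: (MM' _ k _ lx); rewrite M'E.
  - exact: MM ky _ lz E.
  - by case: (n4 k); rewrite M'E.
  - by case: (n1 l).
  - by case: (n2 l); rewrite E M'E.
have rel_sym x y : rel x y -> rel y x.
  case=> [[k kx yE]|[k ky xE]|[n1 n2 ->]]; [by apply: Or32; exists k|by apply: Or31; exists k|].
  by apply: Or33.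
have [s sP] := choice rel_ex.
have MsE k x : M k x -> s x = b (e k) x.
  by move=> kx; apply: rel_un (sP x) _; apply: Or31; exists k.
have M'sE k x : M' k x -> s x = b (e k)^-1%g x.
  move=> kx; apply: rel_un (sP x) _; apply: Or32; exists k => //.
  by rewrite -bM mulgV b1.
pose Ai := \bigcap_k (left_ k).1; pose Bi := \bigcap_k (left_ k).2.
have mAi : measurable Ai by apply: bigcapT_measurable => k; have [] := mleft k.
have mBi : measurable Bi by apply: bigcapT_measurable => k; have [] := mleft k.
have prk k : pr (left_ k).1 = pr (left_ k).2.
  elim: k => //= k; have [m1 m2] := mleft k; rewrite -/(M k) -/(M' k).
  rewrite (pr_DI mu m1 (mM k)) (pr_DI mu m2 (mM' k)).
  rewrite (_ : _.1 `&` M k = M k); last by apply/setIidr => x [].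
  rewrite (_ : _.2 `&` M' k = M' k); last by apply/setIidr => x /M'B.
  by rewrite /M' binv //; exact: addIr.
have prAiBi : pr Ai = pr Bi.
  have cA : pr (left_ n).1 @[n --> \oo] --> pr Ai.
    by apply: pr_cvg_cap => k; [case: (mleft k)|case: (left_dec _ _ (leqnSn k))].
  have cB : pr (left_ n).2 @[n --> \oo] --> pr Bi.
    by apply: pr_cvg_cap => k; [case: (mleft k)|case: (left_dec _ _ (leqnSn k))].
  by move: cA; rewrite (funext prk) => cA; exact: (cvg_unique (@norm_hausdorff _ _) cA cB).
have AiBi k x : Ai x -> ~ Bi (b (e k) x).
  move=> Ax Bx; have [] : (left_ k.+1).1 x by apply: Ax.
  by move=> lx; apply; split=> //; exact: Bx.
have prAi : pr Ai = 0.
  pose C := [set x | exists k, Ai (b (e k) x)].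
  have mC : measurable C by apply: mset_ex => // k; exact: bpre'.
  have [|C0|C1] := erg mC.
  - move=> g x Kg [k Ak]; have [|l le] := eP (e k * g^-1)%g.
      by case: KS => _ KM _; apply: KM => //; exact: KV.
    by exists l; rewrite le -bM -mulgA mulVg mulg1.
  - apply/eqP; rewrite eq_le pr_ge0 andbT -C0; apply: pr_le => // x Ax.
    by have [k k1] := eP _ K1; exists k; rewrite k1 b1.
  - rewrite prAiBi; apply/eqP; rewrite eq_le pr_ge0 andbT.
    apply: (@le_trans _ _ (pr (~` C))); last by rewrite pr_C // C1 subrr.
    apply: pr_le => // [|x Bx [k Ak]]; first exact: measurableC.
    have [l le] := eP _ (KV _ (eK k)).
    by apply: (AiBi l _ Ak); rewrite le -bM mulVg b1.
exists s, (\bigcup_k M k), (\bigcup_k M' k); split; split.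
- by move=> x; exact: rel_un (sP (s x)) (rel_sym _ _ (sP x)).
- apply: (@measurable_fun_countable _ _ _ _ (option (bool * nat)) s
    (fun x i => match i with Some (true, k) => M k x | Some (false, k) => M' k x
      | None => (forall k, ~ M k x) /\ forall k, ~ M' k x end)
    (fun i => match i with Some (true, k) => b (e k) | Some (false, k) => b (e k)^-1%g
      | None => id end)).
  + exact: countableP.
  + move=> [[[] k]|]; [exact: mM|exact: mM'|].
    apply: mset_and; [apply: mset_all; [exact: countableP|move=> k; apply: (mset_not (mM k))]|apply: mset_all; [exact: countableP|move=> k; apply: (mset_not (mM' k))]].
  + by move=> [[[] k]|] //; exact: measurable_id.
  + move=> x; case: (sP x) => [[k kx E]|[k kx E]|[n1 n2 E]].
    * by exists (Some (true, k)).
    * by exists (Some (false, k)); [rewrite E M'E|rewrite [in RHS]E -bM mulVg b1].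
    * by exists None.
  + move=> x [[[] k]|] /=; [exact: MsE|exact: M'sE|].
    by move=> [n1 n2]; apply: rel_un (sP x) _; apply: Or33.
- move=> x; case: (sP x) => [[k kx E]|[k kx E]|[n1 n2 E]].
  + by exists (e k).
  + by exists (e k)^-1%g; [exact: KV|rewrite [in RHS]E -bM mulVg b1].
  + by exists 1%g; rewrite ?b1.
- exact: bigcupT_measurable.
- exact: bigcupT_measurable.
- by move=> x [k _ /MA].
- by move=> x [k _ /M'B0].
- rewrite (_ : _ `\` _ = Ai) //; apply/seteqP; split=> x.
    move=> [Ax nM] k _; elim: k => [//|k IHk] /=; split=> // Mk.
    by apply: nM; exists k.
  by move=> Ax; split=> [|[k _ Mk]]; [exact: (Ax 0%N)|have [] := Ax k.+1 I].
- rewrite (_ : _ `\` _ = Bi) -?prAiBi //; apply/seteqP; split=> x.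
    move=> [Ax nM] k _; elim: k => [//|k IHk] /=; split=> // Mk.
    by apply: nM; exists k.
  by move=> Ax; split=> [|[k _ Mk]]; [exact: (Ax 0%N)|have [] := Ax k.+1 I].
- by move=> x [k _ kx]; exists k => //; rewrite (MsE _ _ kx) M'E.
- by move=> x [k _ kx]; exists k => //; rewrite (M'sE _ _ kx).
- move=> x n1 n2; apply: rel_un (sP x) _; apply: Or33; split=> // k kx.
    by apply: n1; exists k.
  by apply: n2; exists k.
Qed.
End Matching.

Section RealPredicates.
Context {d : measure_display} {T : measurableType d} {R : realType}.
Variables f g : T -> R.
Hypotheses (mf : measurable_fun setT f) (mg : measurable_fun setT g).

Lemma mset_lt : measurable [set x | f x < g x].
Proof.
have : measurable (setT `&` (fun x => f x < g x) @^-1` [set true]).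
  exact: measurable_fun_ltr.
by rewrite setTI.
Qed.

Lemma mset_le : measurable [set x | f x <= g x].
Proof.
have : measurable (setT `&` (fun x => f x <= g x) @^-1` [set true]).
  exact: measurable_fun_ler.
by rewrite setTI.
Qed.

Lemma mset_eq : measurable [set x | f x = g x].
Proof.
rewrite (_ : [set x | _] = [set x | f x <= g x] `\` [set x | f x < g x]).
  by apply: measurableD; [exact: mset_le|exact: mset_lt].
apply/seteqP; split=> x /=; first by move=> ->; rewrite lexx ltxx.
by move=> [fg]; rewrite lt_neqAle fg andbT => /negP; rewrite negbK => /eqP.
Qed.
End RealPredicates.

(** * Cutting a set at the median of a function *)

Section Median.
Context {d : measure_display} {T : measurableType d} {R : realType}.
Variable mu : probability T R.
Local Notation pr := (pr mu).

(** The measure of the part below [c] is continuous in [c], since no value of [psi] has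
positive measure. *)
Lemma median_cut (B : set T) (psi : T -> R) (M : R) : measurable B ->
  measurable_fun setT psi -> (forall x, 0 <= psi x < M) ->
  (forall c, pr [set x | psi x = c] = 0) ->
  exists c, pr (B `&` [set x | psi x < c]) = pr B / 2.
Proof.
move=> mB mpsi psiM psi0; pose low c := B `&` [set x | psi x < c].
have mlow c : measurable (low c) by apply: measurableI => //; exact: mset_lt.
have low_le c c' : c <= c' -> pr (low c) <= pr (low c').
  by move=> cc; apply: pr_le => // x [Bx /= xc]; split=> //=; exact: lt_le_trans cc.
have [B0|B0] := eqVneq (pr B) 0.
  exists 0; rewrite B0 mul0r; apply/eqP; rewrite eq_le pr_ge0 andbT -[X in _ <= X]B0.
  by apply: pr_le => //; exact: mlow.
have {}B0 : 0 < pr B by rewrite lt_neqAle eq_sym B0 pr_ge0.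
pose C := [set c | pr (low c) <= pr B / 2].
have ubC : ubound C M.
  move=> c; rewrite {1}/C /= => Cc; rewrite leNgt; apply/negP => /ltW/low_le.
  rewrite (_ : low M = B); first lra.
  by apply/setIidl => x _ /=; case/andP: (psiM x).
have C0 : C 0.
  rewrite /C /= (_ : low 0 = set0) ?pr0; first lra.
  by apply/seteqP; split=> // x [_ /=]; case/andP: (psiM x) => /le_lt_trans h _ /h; rewrite ltxx.
have supC : has_sup C by split; [exists 0|exists M].
exists (sup C); apply/eqP; rewrite eq_le -/(low _); apply/andP; split.
  have -> : low (sup C) = \bigcup_n low (sup C - n.+1%:R^-1).
    apply/seteqP; split=> x.
      move=> [Bx /= xC]; have [n] := ltr_add_invr xC => xn; exists n => //.
      by split=> //=; rewrite ltrBrDr.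
    move=> [n _ [Bx /= xn]]; split=> //=; apply: lt_le_trans xn _.
    by rewrite lerBlDr lerDl invr_ge0.
  have : pr (low (sup C - n.+1%:R^-1)) @[n --> \oo] -->
      pr (\bigcup_n low (sup C - n.+1%:R^-1)).
    apply: pr_cvg => // n x [Bx /= xn]; split=> //=; apply: lt_le_trans xn _.
    by rewrite lerB // lef_pV2 ?posrE ?ltr0n // ler_nat.
  move=> h; rewrite -(cvg_lim (@norm_hausdorff _ _) h); apply: limr_le.
    by apply/cvg_ex; eexists; exact: h.
  near=> n; have [|c Cc lec] := @sup_adherent _ C n.+1%:R^-1 _ supC.
    by rewrite invr_gt0.
  by apply: le_trans (low_le _ _ (ltW lec)) Cc.
have lowC : pr (low (sup C)) = pr (\bigcap_n low (sup C + n.+1%:R^-1)).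
  apply/eqP; rewrite eq_le; apply/andP; split.
    apply: pr_le => //; first exact: bigcapT_measurable.
    move=> x [Bx /= xC] n _; split=> //=; apply: lt_le_trans xC _.
    by rewrite lerDl invr_ge0.
  have m0 : measurable [set x | psi x = sup C] by exact: mset_eq.
  apply: (@le_trans _ _ (pr (low (sup C) `|` [set x | psi x = sup C]))).
    apply: pr_le; [exact: bigcapT_measurable|exact: measurableU|].
    move=> x xn; have Bx : B x by have [] := xn 0%N I.
    have [xC|Cx] := ltP (psi x) (sup C); [by left|right=> /=].
    apply/eqP; rewrite eq_le Cx andbT leNgt; apply/negP => /ltr_add_invr[n xn'].
    by have [_ /=] := xn n I; rewrite ltNge => /negP; apply; exact: ltW.
  by apply: le_trans (pr_leU mu _ m0) _ => //; rewrite psi0 addr0.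
rewrite lowC.
have : pr (low (sup C + n.+1%:R^-1)) @[n --> \oo] -->
    pr (\bigcap_n low (sup C + n.+1%:R^-1)).
  apply: pr_cvg_cap => // n x [Bx /= xn]; split=> //=; apply: lt_le_trans xn _.
  by rewrite lerD // lef_pV2 ?posrE ?ltr0n // ler_nat.
move=> h; rewrite -(cvg_lim (@norm_hausdorff _ _) h); apply: limr_ge.
  by apply/cvg_ex; eexists; exact: h.
near=> n; rewrite leNgt; apply/negP => /ltW Cn.
have := ub_le_sup (ex_intro _ M ubC : has_ubound C) Cn.
by rewrite leNgt ltrDl invr_gt0 ltr0n.
Unshelve. all: by end_near.
Qed.

(** The injective function [phi] breaks the ties of the integer-valued function
[N], so that the median is attained on a null set only. *)
Lemma integer_median (B : set T) (N : T -> nat) (M : nat) (phi : T -> R) :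
  measurable B -> measurable_fun setT (fun x => (N x)%:R : R) ->
  (forall x, (N x < M)%N) -> measurable_fun setT phi ->
  (forall x, 0 <= phi x < 1) -> injective phi -> (forall x, pr [set x] = 0) ->
  exists (H L : set T) (m : nat),
  [/\ measurable H /\ measurable L, H `|` L = B /\ H `&` L = set0,
      pr H = pr B / 2 /\ pr L = pr B / 2, forall x, H x -> (m <= N x)%N &
      forall x, L x -> (N x <= m)%N].
Proof.
move=> mB mN NM mphi phi01 phi_inj pt0; pose psi x := (N x)%:R + phi x.
have psiN x : Num.truncn (psi x) = N x.
  by apply: truncn_def; rewrite /psi -natr1; have := phi01 x; lra.
have mpsi : measurable_fun setT psi by exact: measurable_funD.
have psi_inj : injective psi.
  move=> x y xy; apply: phi_inj; have := xy; rewrite /psi -!psiN xy.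
  exact: addrI.
have [|c|c cP] := @median_cut B psi (M%:R + 1) mB mpsi.
- move=> x; rewrite /psi; have := phi01 x.
  have : (N x)%:R <= M%:R :> R by rewrite ler_nat ltnW.
  by have : 0 <= (N x)%:R :> R by []; lra.
- have [[x xc]|nx] := pselect (exists x, psi x = c).
    rewrite (_ : [set _ | _] = [set x]) //; apply/seteqP; split=> y /=; last by move=> ->.
    by move=> yc; apply: psi_inj; rewrite yc xc.
  by rewrite (_ : [set _ | _] = set0) ?pr0 //; apply/seteqP; split=> // y yc; apply: nx; exists y.
have mlow : measurable [set x | psi x < c] by exact: mset_lt.
exists (B `\` [set x | psi x < c]), (B `&` [set x | psi x < c]), (Num.truncn c).
split; first by split; [exact: measurableD|exact: measurableI].
- by split; [rewrite -setDDr setDv setD0|rewrite setDE setIACA setICl setI0].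
- by split=> //; have := pr_DI mu mB mlow; rewrite cP; lra.
- by move=> x [_ /= /negP]; rewrite -leNgt => cx; rewrite -psiN le_truncn.
- by move=> x [_ /= /ltW cx]; rewrite -psiN le_truncn.
Qed.
End Median.

(** * Counting *)

Section Counting.
Context {d : measure_display} {T : measurableType d} {R : realType}.
Variable mu : probability T R.
Local Notation pr := (pr mu).

(** Integrate the number of the sets [A j] that contain the point. *)
Lemma pr_counting (Q : set T) (n k : nat) (A : nat -> set T) : measurable Q ->
  (forall j, measurable (A j)) ->
  (forall x, Q x -> (\sum_(j < n) (x \in A j) <= k)%N) ->
  \sum_(j < n) pr (Q `&` A j) <= k%:R * pr Q.
Proof.
move=> mQ mA Qk.
have : (\int[mu]_(x in Q) (\sum_(j < n) (\1_(A j) x)%:E) <=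
        \int[mu]_(x in Q) (k%:R : R)%:E)%E.
  apply: ge0_le_integral => //.
  - by move=> x _; apply: sume_ge0 => j _; rewrite lee_fin.
  - apply: emeasurable_sum => j; apply/measurable_EFinP.
    by apply: measurable_funTS; exact: measurable_indic.
  - move=> x Qx; rewrite sumEFin lee_fin.
    rewrite (eq_bigr (fun j : 'I_n => (nat_of_bool (x \in A j))%:R)) // -natr_sum ler_nat.
    exact: Qk.
rewrite ge0_integral_sum //; last first.
  by move=> j; apply/measurable_EFinP; apply: measurable_funTS; exact: measurable_indic.
have -> : (\int[mu]_(x in Q) (k%:R : R)%:E = (k%:R * pr Q)%:E)%E.
  by rewrite integral_cst // EFinM -prE.
rewrite (eq_bigr (fun j : 'I_n => (pr (Q `&` A j))%:E)); last first.
  by move=> j _; rewrite integral_indic // setIC -prE //; exact: measurableI.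
by rewrite sumEFin lee_fin.
Qed.
End Counting.

(** * Towers *)

Section Towers.
Context {d : measure_display} {T : measurableType d} {R : realType}.
Variable mu : probability T R.
Variables (D : groupType) (b : D -> T -> T).
Hypothesis bA : group_action b.
Hypothesis bm : forall g, measurable_fun setT (b g).
Hypothesis autoinv : forall f g : T -> T, cancel f g -> cancel g f ->
  measurable_fun setT f -> measurable_fun setT g -> (forall x, exists h, f x = b h x) ->
  forall A, measurable A -> pr mu (f @^-1` A) = pr mu A.
Variable K : set D.
Hypothesis KS : subgroup_set K.
Hypothesis cD : countable [set: D].
Hypothesis erg : ergodic_under mu b K.
Local Notation pr := (pr mu).

Definition inner (f f' : T -> T) : Prop :=
  [/\ cancel f f', cancel f' f, measurable_fun setT f, measurable_fun setT f' &
      forall x, exists2 h, K h & f x = b h x].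

Lemma inner_id : inner id id.
Proof.
have [b1 bM] := bA; have [K1 _ _] := KS.
by split=> // x; exists 1%g; rewrite ?b1.
Qed.

Lemma inner_comp f f' g g' : inner f f' -> inner g g' -> inner (f \o g) (g' \o f').
Proof.
have [b1 bM] := bA; have [_ KM _] := KS.
move=> [fK f'K mf mf' fh] [gK g'K mg mg' gh]; split.
- by move=> x /=; rewrite fK gK.
- by move=> x /=; rewrite g'K f'K.
- exact: measurableT_comp.
- exact: measurableT_comp.
move=> x /=; have [h Kh ->] := gh x; have [k Kk ->] := fh (b h x).
by exists (k * h)%g; rewrite ?bM //; exact: KM.
Qed.

Lemma inner_inv f f' : inner f f' -> inner f' f.
Proof.
have [b1 bM] := bA; have [_ _ KV] := KS.
move=> [fK f'K mf mf' fh]; split=> // x; have [h Kh E] := fh (f' x).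
exists h^-1%g; first exact: KV.
by rewrite f'K in E; rewrite [in RHS]E -bM mulVg b1.
Qed.

Lemma inner_iter f f' n : inner f f' -> inner (iter n f) (iter n f').
Proof.
move=> ff'; elim: n => [|n IHn]; first exact: inner_id.
rewrite (_ : iter n.+1 f = iter n f \o f); last by apply/funext => x; rewrite iterSr.
exact: inner_comp.
Qed.

Lemma inner_pre f f' A : inner f f' -> measurable A -> measurable (f @^-1` A).
Proof. by case=> _ _ mf _ _ mA; rewrite -[X in measurable X]setTI; exact: mf. Qed.

Lemma inner_pr f f' A : inner f f' -> measurable A -> pr (f @^-1` A) = pr A.
Proof.
case=> fK f'K mf mf' fh mA; apply: (@autoinv f f') => // x.
by have [h _ E] := fh x; exists h.
Qed.

Lemma binv g A : measurable A -> pr (b g @^-1` A) = pr A.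
Proof.
have [b1 bM] := bA.
apply: (@autoinv (b g) (b g^-1%g)) => // x; last by exists g.
  by rewrite -bM mulVg b1.
by rewrite -bM mulgV b1.
Qed.

Lemma inner_invariant f f' (G : set T) : inner f f' ->
  (forall g x, G x -> G (b g x)) -> forall x, G x -> G (f x).
Proof. by case=> _ _ _ _ fh GD x Gx; have [h _ ->] := fh x; exact: GD. Qed.

(** The exact version of a Rokhlin tower: its levels are the images of the base under
the powers of the map, and they fill the space up to the complement of the conull
invariant set of good points, on which the map is periodic. *)
Record tower := Tower {
  tower_map : T -> T;
  tower_inv : T -> T;
  tower_base : set T;
  tower_good : set T }.

Definition is_tower (N : nat) (t : tower) : Prop :=
  [/\ inner (tower_map t) (tower_inv t),
      [/\ measurable (tower_base t) & N%:R * pr (tower_base t) = 1],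
      [/\ measurable (tower_good t), pr (tower_good t) = 1 & forall g x, tower_good t x -> tower_good t (b g x)] &
      forall x, tower_good t x ->
      [/\ exists2 j, (j < N)%N & tower_base t (iter j (tower_map t) x),
          tower_base t x -> forall j, (0 < j < N)%N -> ~ tower_base t (iter j (tower_map t) x) &
          iter N (tower_map t) x = x]].

Definition visits (f : T -> T) (N : nat) (A : set T) (x : T) : nat :=
  \sum_(j < N) (iter j f x \in A).

Lemma visits_le f N A x : (visits f N A x <= N)%N.
Proof.
rewrite /visits -[X in (_ <= X)%N]card_ord -sum1_card; apply: leq_sum => j _.
exact: leq_b1.
Qed.

(** Gluing the orbits of [t] in pairs amounts to exchanging the points at which the two
orbits of a pair enter the base. *)
Definition refines (t u : tower) : Prop :=
  exists2 s : T -> T, [/\ involutive s, forall x, ~ tower_base t x -> s x = x,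
    tower_map u = s \o tower_map t & tower_inv u = tower_inv t \o s] &
  tower_base u `<=` tower_base t /\ tower_good u `<=` tower_good t.

Definition balanced (N : nat) (t : tower) (A : set T) : Prop :=
  exists2 m, (m <= N)%N & forall x, tower_good t x -> tower_base t x ->
    (m <= visits (tower_map t) N.*2 A x <= N + m)%N.

Variable phi : T -> R.
Hypotheses (mphi : measurable_fun setT phi) (phi01 : forall x, 0 <= phi x < 1).
Hypotheses (phi_inj : injective phi) (atomless : forall x, pr [set x] = 0).

(** Placing the part of the base with few visits to [A] below the part with many
visits makes the numbers of visits to [A] differ by at most half of the new height. *)
Lemma tower_step (N : nat) (t : tower) (A : set T) : (0 < N)%N -> measurable A ->
  is_tower N t ->
  exists u, [/\ is_tower N.*2 u, refines t u & balanced N u A].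
Proof.
case: t => f f' B G N0 mA [/= ff' [mB prB] [mG prG GD] tG].
have [b1 bM] := bA.
have [||H [L [m [[mH mL] [HUL HIL] [prH prL] Hm Lm]]]] :=
    @integer_median _ _ _ mu B (visits f N A) N.+1 phi mB _ _ mphi phi01 phi_inj atomless.
- rewrite (_ : (fun x => _) = fun x => \sum_(j < N) \1_(iter j f @^-1` A) x).
    apply: measurable_sum => j; apply: measurable_indic.
    exact: inner_pre (inner_iter j ff') mA.
  by apply/funext => x; rewrite /visits natr_sum.
- by move=> x; rewrite ltnS visits_le.
have [s [H' [L' [[sK ms sh] [mH' mL' HH' LL'] [prHH' prLL'] [sH sL sid]]]]] :=
  matching bA bm binv KS cD erg mH mL HIL (etrans prH (esym prL)).
have ss : inner s s by [].
pose bad := (H `\` H') `|` (L `\` L').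
have mbad : measurable bad by apply: measurableU; exact: measurableD.
have prbad : pr bad = 0.
  apply/eqP; rewrite eq_le pr_ge0 andbT.
  by apply: le_trans (pr_leU mu _ _) _; rewrite ?prHH' ?prLL' ?addr0 //; exact: measurableD.
pose G' := G `&` [set x | forall g, ~ bad (b g x)].
have mbadg g : measurable (b g @^-1` bad) by exact: (bpre bm).
have mN : measurable [set x | forall g, ~ bad (b g x)].
  by apply: mset_all => // g; apply: mset_not; exact: mbadg.
have mG' : measurable G' by exact: measurableI.
have prG' : pr G' = 1.
  have : pr (~` G') = 0.
    rewrite (_ : ~` G' = ~` G `|` \bigcup_g (b g @^-1` bad)).
      have mU : measurable (\bigcup_g (b g @^-1` bad)) by exact: countable_bigcupT_measurable.
      apply/eqP; rewrite eq_le pr_ge0 andbT; apply: le_trans (pr_leU mu (measurableC mG) mU) _.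
      rewrite pr_C // prG subrr add0r pr_bigcup0 // => g; by rewrite binv.
    apply/seteqP; split=> x.
      have [Gx|nGx] := pselect (G x); last by left.
      move=> nG'; right; have : ~ forall g, ~ bad (b g x) by move=> h; apply: nG'.
      by move/existsNP => [g /contrapT ?]; exists g.
    by move=> [nGx [Gx]|[g _ bg] [_ /(_ g)]].
  by rewrite pr_C //; lra.
have G'D g x : G' x -> G' (b g x).
  move=> [Gx nb]; split=> [|k]; first exact: GD.
  by rewrite -bM; exact: nb.
have G'G : G' `<=` G by move=> x [].
have HH z : G' z -> H z -> H' z.
  move=> [_ /(_ 1%g)]; rewrite b1 => nb Hz; apply: contrapT => nH; apply: nb; left; split=> //.
have LL z : G' z -> L z -> L' z.
  move=> [_ /(_ 1%g)]; rewrite b1 => nb Hz; apply: contrapT => nH; apply: nb; right; split=> //.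
have sHL z : G' z -> H z -> L (s z) by move=> Gz /(HH _ Gz)/sH/LL'.
have sLH z : G' z -> L z -> H (s z) by move=> Gz /(LL _ Gz)/sL/HH'.
have HB : H `<=` B by rewrite -HUL; left.
have LB : L `<=` B by rewrite -HUL; right.
have BHL z : B z -> H z \/ L z by rewrite -HUL.
have HL z : H z -> ~ L z by move=> Hz Lz; have : (H `&` L) z by []; rewrite HIL.
have sB z : ~ B z -> s z = z.
  by move=> nB; apply: sid => [/HH'/HB|/LL'/LB].
pose f1 := s \o f.
have f1i : inner f1 (f' \o s) by exact: inner_comp.
have iterG j x g g' : inner g g' -> G' x -> G' (iter j g x).
  by move=> gi; apply: inner_invariant (inner_iter j gi) G'D _.
have sG x : G' x -> G' (s x) by exact: inner_invariant ss G'D _.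
have up j x : G' x -> (forall i, (0 < i <= j)%N -> ~ B (iter i f x)) -> iter j f1 x = iter j f x.
  move=> Gx; elim: j => // j IHj nB /=; rewrite IHj; last first.
    by move=> i /andP[i0 ij]; apply: nB; rewrite i0 leqW.
  by rewrite /f1 /= sB //; apply: (nB j.+1); rewrite leqnn.
have tow y j : G' y -> B y -> (j < N)%N -> iter j f1 y = iter j f y.
  move=> Gy By jN; apply: up => // i /andP[i0 ij].
  have [_ + _] := tG _ (G'G _ Gy); move=> /(_ By); apply.
  by rewrite i0 (leq_ltn_trans ij).
have top y : G' y -> B y -> iter N f1 y = s y.
  move=> Gy By; case: N N0 tG tow {Hm Lm prB} => // n _ tG tow.
  by rewrite /= tow // /f1 /= -iterS; have [_ _ ->] := tG _ (G'G _ Gy).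
have sBB y : G' y -> B y -> B (s y).
  by move=> Gy /BHL[/(sHL _ Gy)/LB|/(sLH _ Gy)/HB].
have tow2 y j : G' y -> B y -> (j < N)%N -> iter (j + N) f1 y = iter j f (s y).
  by move=> Gy By jN; rewrite iterD top // tow //; [exact: sG|exact: sBB].
have per y : G' y -> B y -> iter N.*2 f1 y = y.
  by move=> Gy By; rewrite -addnn iterD top // top ?sK //; [exact: sG|exact: sBB].
have hit x : G' x -> exists2 j, (j < N)%N & B (iter j f1 x).
  move=> Gx; have [[j0 j0N Bj0] _ _] := tG _ (G'G _ Gx).
  have ex : exists j, `[< B (iter j f x) >] by exists j0; apply/asboolP.
  case: (ex_minnP ex) => j /asboolP Bj jmin.
  have jN : (j < N)%N by apply: leq_ltn_trans j0N; apply: jmin; apply/asboolP.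
  exists j => //; case: j jmin Bj jN => // j jmin Bj jN /=.
  rewrite up // => [|i /andP[i0 ij]]; last first.
    by move/asboolP/jmin; rewrite ltnNge ij.
  by rewrite /f1 /=; apply: sBB => //; apply: iterG (j.+1) _ _ _ ff' Gx.
exists (Tower f1 (f' \o s) H G'); split; first split=> //=.
- by split=> //; rewrite prH -addnn natrD; move: prB; lra.
- move=> x Gx; split.
  + have [j jN Bj] := hit x Gx; have Gj : G' (iter j f1 x) by exact: iterG f1i Gx.
    have [Hj|Lj] := BHL _ Bj; first by exists j => //; lia.
    by exists (N + j)%N; [lia|rewrite iterD top //; exact: sLH].
  + move=> Hx j /andP[j0 j2]; have Bx := HB _ Hx.
    have [jN|Nj] := ltnP j N.
      rewrite tow //; have [_ + _] := tG _ (G'G _ Gx); move=> /(_ Bx) h /HB; apply: h.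
      by rewrite j0.
    rewrite -(subnK Nj) tow2 //; last lia.
    have [->|jN] := eqVneq j N; first by rewrite subnn /= => /HL; apply; exact: sHL.
    have [_ + _] := tG _ (G'G _ (sG _ Gx)); move=> /(_ (sBB _ Gx Bx)) h /HB; apply: h.
    lia.
  + have [j jN Bj] := hit x Gx.
    have [f1K _ _ _ _] := inner_iter j f1i; apply: (can_inj f1K).
    rewrite -iterD addnC iterD per //; exact: iterG f1i Gx.
- exists s; last by split.
  by split.
- exists (minn m N); first exact: geq_minr.
  move=> x Gx Hx /=; have Bx := HB _ Hx.
  have -> : visits f1 N.*2 A x = (visits f N A x + visits f N A (s x))%N.
    rewrite /visits -addnn big_split_ord /=; congr addn; apply: eq_bigr => j _.
      by rewrite tow.
    by rewrite addnC tow2.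
  rewrite (leq_trans (geq_minl m N)) ?(leq_trans (Hm _ Hx)) ?leq_addr //=.
  by rewrite leq_add ?visits_le // leq_min visits_le Lm //; exact: sHL.
Qed.

Variable A_ : nat -> set T.
Hypothesis mA : forall i, measurable (A_ i).
Hypothesis A_dense : forall B, measurable B -> forall e : R, 0 < e ->
  exists i, pdist mu B (A_ i) < e.
Variable h0 : D.
Hypotheses (Kh0 : K h0) (h0F : forall n x, iter n.+1 (b h0) x <> x).

Lemma tower_sequence : exists t : nat -> tower,
  [/\ forall n, is_tower (2 ^ n) (t n), forall n, refines (t n) (t n.+1) &
      forall n, balanced (2 ^ n) (t n.+1) (A_ n)].
Proof.
have nxt (p : nat * tower) : exists u, is_tower (2 ^ p.1) p.2 ->
    [/\ is_tower (2 ^ p.1.+1) u, refines p.2 u & balanced (2 ^ p.1) u (A_ p.1)].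
  have [tp|ntp] := pselect (is_tower (2 ^ p.1) p.2); last by exists p.2.
  have N0 : (0 < 2 ^ p.1)%N by rewrite expn_gt0.
  have [u [tu ru bu]] := tower_step N0 (mA p.1) tp.
  by exists u => _; split=> //; rewrite expnS mul2n.
have [g gP] := choice nxt.
pose t := fix t n := if n is n'.+1 then g (n', t n') else Tower id id setT setT.
have tt n : is_tower (2 ^ n) (t n).
  elim: n => [|n IHn]; last by have [] := gP (n, t n) IHn.
  split=> //=.
  - exact: inner_id.
  - by split=> //; rewrite prT mulr1.
  - by split=> //; rewrite prT.
  - move=> x _; split=> //; first by exists 0%N.
    by move=> _ [|j].
by exists t; split=> // n; have [] := gP (n, t n) (tt n).
Qed.

Lemma pr_eq0_pow C : measurable C -> (forall n, 2 ^+ n * pr C <= 1) -> pr C = 0.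
Proof.
move=> mC h; apply/eqP; rewrite eq_le pr_ge0 andbT leNgt; apply/negP => C0.
have [n] := ltr_add_invr C0; rewrite add0r => nC.
have := h n; apply/negP; rewrite -ltNge.
have n0 : 0 < n.+1%:R :> R by rewrite ltr0n.
have n2 : n.+1%:R <= 2 ^+ n :> R by rewrite -natrX ler_nat; exact: ltn_expl.
apply: lt_le_trans (_ : n.+1%:R * pr C <= _); last by rewrite ler_wpM2r // pr_ge0.
by rewrite -[X in X < _](mulfV (lt0r_neq0 n0)) ltr_pM2l.
Qed.

(** A point that a tower does not take to its base is moved in the same way by all the
later towers; this defines the limit [F]. An orbit of [F] is infinite, since some base
would avoid a finite one. Suppose that [C] is invariant and neither null nor conull.
Then each good orbit of a tower is either in [C] or outside [C], since [F] follows it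
except for its last step. An [A_ i] that is close to [C] would have nearly [N.*2] visits
on most orbits in [C] and nearly none on most others, although all these numbers differ
by at most [N]. *)
Theorem ergodic_automorphism : exists F F' : T -> T,
  [/\ inner F F', forall n x, iter n.+1 F x <> x &
   forall C, measurable C -> (forall x, C x <-> C (F x)) -> pr C = 0 \/ pr C = 1].
Proof.
have [t [tt tr tb]] := tower_sequence; have [b1 bM] := bA.
pose f n := tower_map (t n); pose f' n := tower_inv (t n); pose B n := tower_base (t n).
have fi n : inner (f n) (f' n) by have [] := tt n.
have mB n : measurable (B n) by have [_ []] := tt n.
have prB n : 2 ^+ n * pr (B n) = 1 by have [_ [_]] := tt n; rewrite natrX.
have Bdec n m : (n <= m)%N -> B m `<=` B n.
  elim: m => [|m IHm]; first by rewrite leqn0 => /eqP ->.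
  rewrite leq_eqVlt ltnS => /predU1P[->//|/IHm]; apply: subset_trans.
  by have [s _ []] := tr m.
have fst n m x : (n <= m)%N -> ~ B n (f n x) -> f m x = f n x.
  move=> nm nB; elim: m nm => [|m IHm]; first by rewrite leqn0 => /eqP ->.
  rewrite leq_eqVlt ltnS => /predU1P[->//|nm]; rewrite -IHm //.
  have [s [_ sB fE _] _] := tr m; rewrite /f fE /= sB //.
  by rewrite -/(f m) IHm // => /(Bdec _ _ nm).
have f'st n m y : (n <= m)%N -> ~ B n y -> f' m y = f' n y.
  move=> nm nB; elim: m nm => [|m IHm]; first by rewrite leqn0 => /eqP ->.
  rewrite leq_eqVlt ltnS => /predU1P[->//|nm]; rewrite -IHm //.
  have [s [_ sB _ fE] _] := tr m; rewrite /f' fE /= sB //.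
  by move=> /(Bdec _ _ nm).
(* The limit exists off the null set [bad]; where the orbit of [D] meets [bad], the
   aperiodic [b h0] replaces it. *)
pose bad := [set x | forall n, B n x] `|` [set x | forall n, B n (f n x)] `|`
  \bigcup_n ~` tower_good (t n).
have cN : countable [set: nat] by exact: countableP.
have mBf n : measurable (f n @^-1` B n) by exact: inner_pre (fi n) (mB n).
have m1 : measurable [set x | forall n, B n x] by exact: mset_all.
have m2 : measurable [set x | forall n, B n (f n x)] by exact: mset_all.
have mG n : measurable (tower_good (t n)) by have [_ _ []] := tt n.
have m3 : measurable (\bigcup_n ~` tower_good (t n)).
  by apply: bigcupT_measurable => n; exact: measurableC.
have mbad : measurable bad by apply: measurableU => //; exact: measurableU.
have bad0 : pr bad = 0.
  have p1 : pr [set x | forall n, B n x] = 0.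
    apply: pr_eq0_pow => // n; rewrite -[X in _ <= X](prB n) ler_wpM2l // ?exprn_ge0 //.
    by apply: pr_le => // x.
  have p2 : pr [set x | forall n, B n (f n x)] = 0.
    apply: pr_eq0_pow => // n; rewrite -[X in _ <= X](prB n) -(inner_pr (fi n) (mB n)) ler_wpM2l // ?exprn_ge0 //.
    by apply: pr_le => // x /=; apply.
  have p3 : pr (\bigcup_n ~` tower_good (t n)) = 0.
    apply: pr_bigcup0 => // n; first exact: measurableC.
    by rewrite pr_C //; have [_ _ [_ -> _]] := tt n; rewrite subrr.
  apply/eqP; rewrite eq_le pr_ge0 andbT.
  apply: le_trans (pr_leU mu (measurableU _ _ m1 m2) m3) _; rewrite p3 addr0.
  by apply: le_trans (pr_leU mu m1 m2) _; rewrite p1 p2 addr0.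
pose G := [set x | forall g, ~ bad (b g x)].
have mG' : measurable G.
  by apply: mset_all => // g; apply: mset_not; exact: (bpre bm g mbad).
have prG : pr (~` G) = 0.
  rewrite (_ : ~` G = \bigcup_g (b g @^-1` bad)); last first.
    apply/seteqP; split=> x; last by move=> [g _ bg] /(_ g).
    by move/existsNP => [g /contrapT ?]; exists g.
  by apply: pr_bigcup0 => // g; [exact: (bpre bm g mbad)|rewrite binv].
have GD g x : G x -> G (b g x) by move=> Gx k; rewrite -bM; exact: Gx.
have G1 x : G x -> exists n, ~ B n x.
  move=> /(_ 1%g); rewrite b1 => nb; apply/existsNP => h; apply: nb; left; left; exact: h.
have G2 x : G x -> exists n, ~ B n (f n x).
  move=> /(_ 1%g); rewrite b1 => nb; apply/existsNP => h; apply: nb; left; right; exact: h.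
have G3 x n : G x -> tower_good (t n) x.
  move=> /(_ 1%g); rewrite b1 => nb; apply: contrapT => h; apply: nb; right; exists n => //.
have exF x : exists y, (forall n, G x -> ~ B n (f n x) -> y = f n x) /\
    (~ G x -> y = b h0 x).
  have [Gx|nG] := pselect (G x); last by exists (b h0 x); split.
  have [n nB] := G2 x Gx; exists (f n x); split=> // m _ mB'.
  by have [/fst->|/ltnW/fst->] := leqP n m.
have exF' x : exists y, (forall n, G x -> ~ B n x -> y = f' n x) /\
    (~ G x -> y = b h0^-1%g x).
  have [Gx|nG] := pselect (G x); last by exists (b h0^-1%g x); split.
  have [n nB] := G1 x Gx; exists (f' n x); split=> // m _ mB'.
  by have [/f'st->|/ltnW/f'st->] := leqP n m.
have [F FP] := choice exF; have [F' F'P] := choice exF'.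
have FG x n : G x -> ~ B n (f n x) -> F x = f n x by have [+ _] := FP x => h; exact: h.
have FnG x : ~ G x -> F x = b h0 x by have [_] := FP x.
have F'G x n : G x -> ~ B n x -> F' x = f' n x by have [+ _] := F'P x => h; exact: h.
have F'nG x : ~ G x -> F' x = b h0^-1%g x by have [_] := F'P x.
have nGD g x : ~ G x -> ~ G (b g x).
  by move=> nG /(GD g^-1%g); rewrite -bM mulVg b1.
have fG n x : G x -> G (f n x) by exact: inner_invariant (fi n) GD x.
have f'G n x : G x -> G (f' n x) by exact: inner_invariant (inner_inv (fi n)) GD x.
have fK n : cancel (f n) (f' n) by case: (fi n).
have f'K n : cancel (f' n) (f n) by case: (fi n).
have FF' : inner F F'.
  split.
  - move=> x; have [Gx|nG] := pselect (G x).
      have [n nB] := G2 x Gx; rewrite (FG _ _ Gx nB) (F'G _ n) ?fK //; exact: fG.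
    by rewrite FnG // F'nG; [rewrite -bM mulVg b1|exact: nGD].
  - move=> x; have [Gx|nG] := pselect (G x).
      have [n nB] := G1 x Gx; rewrite (F'G _ _ Gx nB) (FG _ n) ?f'K //; exact: f'G.
    by rewrite F'nG // FnG; [rewrite -bM mulgV b1|exact: nGD].
  - apply: (@measurable_fun_countable _ _ _ _ (option nat) F
      (fun x i => if i is Some n then G x /\ ~ B n (f n x) else ~ G x)
      (fun i => if i is Some n then f n else b h0)).
    + exact: countableP.
    + by move=> [n|]; [apply: mset_and => //; apply: mset_not; exact: mBf|exact: mset_not].
    + by move=> [n|] //; case: (fi n).
    + move=> x; have [Gx|nG] := pselect (G x); last by exists None; rewrite ?FnG.
      by have [n nB] := G2 x Gx; exists (Some n) => //; exact: FG.
    + by move=> x [n [Gx nB]|nG]; [exact: FG|exact: FnG].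
  - apply: (@measurable_fun_countable _ _ _ _ (option nat) F'
      (fun x i => if i is Some n then G x /\ ~ B n x else ~ G x)
      (fun i => if i is Some n then f' n else b h0^-1%g)).
    + exact: countableP.
    + by move=> [n|]; [apply: mset_and => //; apply: mset_not; exact: mB|exact: mset_not].
    + by move=> [n|] //; case: (fi n).
    + move=> x; have [Gx|nG] := pselect (G x); last by exists None; rewrite ?F'nG.
      by have [n nB] := G1 x Gx; exists (Some n) => //; exact: F'G.
    + by move=> x [n [Gx nB]|nG]; [exact: F'G|exact: F'nG].
  - move=> x; have [Gx|nG] := pselect (G x); last by exists h0 => //; exact: FnG.
    by have [n nB] := G2 x Gx; rewrite (FG _ _ Gx nB); have [_ _ _ _] := fi n; apply.
have FGx x : G x -> G (F x) by exact: inner_invariant FF' GD x.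
have FGi x i : G x -> G (iter i F x) by move=> Gx; elim: i => //= i; exact: FGx.
exists F, F'; split=> //.
  move=> k x; have [Gx|nG] := pselect (G x) => Fx; last first.
    have nGi i : ~ G (iter i (b h0) x) by elim: i => //= i; exact: nGD.
    have E i : iter i F x = iter i (b h0) x by elim: i => //= i ->; rewrite FnG.
    by apply: (@h0F k x); rewrite -E.
  have [n nB] : exists n, forall i, (i <= k)%N -> ~ B n (iter i F x).
    elim: k {Fx} => [|k [n nB]].
      by have [n nB] := G1 x Gx; exists n => i; rewrite leqn0 => /eqP ->.
    have [m mB'] := G1 _ (FGi x k.+1 Gx); exists (maxn n m) => i.
    rewrite leq_eqVlt ltnS => /predU1P[->|/nB h] /Bdec; last by move/(_ _ (leq_maxl n m)).
    by move/(_ _ (leq_maxr n m)).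
  have {}nB i : ~ B n (iter i F x).
    elim/ltn_ind: i => i IHi; have [/nB//|ki] := leqP i k.
    by rewrite -(subnK ki) iterD Fx; apply: IHi; lia.
  have E i : iter i (f n) x = iter i F x.
    elim: i => //= i ->; have FK : cancel F F' by case: FF'.
    rewrite -[RHS](f'K n); congr (f n _).
    rewrite -(F'G (F (iter i F x)) n) ?FK //; first exact: (FGi x i.+1).
    exact: (nB i.+1).
  have [_ _ _ /(_ x (G3 x n Gx))[[j _ Bj] _ _]] := tt n.
  by apply: (nB j); rewrite -E.
move=> C mC CF; apply: contrapT => /not_orP[C0 C1].
have {}C0 : 0 < pr C by rewrite lt_neqAle pr_ge0 andbT eq_sym; apply/eqP.
have {}C1 : 0 < 1 - pr C by rewrite subr_gt0 lt_neqAle pr_le1 // andbT; apply/eqP.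
(* With [q3] and [q6], the definition of [e] gives [m > 3 / 4 * N] ([h3]); with [q4]
   and [q7], it gives [m < N / 4] ([h4]). *)
pose e := Num.min (pr C) (1 - pr C) / 8.
have e0 : 0 < e by rewrite divr_gt0 // lt_min C0.
have [i Ai] := A_dense mC e0; pose N := (2 ^ i)%N; pose g := f i.+1.
have [m mN visE] := tb i; have [gi [mBi _] _ gt] := tt i.+1.
have N2 : (2 ^ i.+1 = N.*2)%N by rewrite expnS mul2n.
rewrite -/(f i.+1) -/(f' i.+1) -/g in visE gi gt; rewrite N2 in gt.
have inB j y : G y -> B i.+1 y -> (0 < j < N.*2)%N -> ~ B i.+1 (iter j g y).
  by move=> Gy By; have [_ + _] := gt _ (G3 _ i.+1 Gy); apply.
have Cg j y : G y -> B i.+1 y -> (j < N.*2)%N -> C (iter j g y) <-> C y.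
  move=> Gy By; elim: j => // j IHj jN; rewrite -IHj; last exact: ltnW.
  have Gj : G (iter j g y) by exact: inner_invariant (inner_iter j gi) GD _ _.
  rewrite /= [C (iter j g y)]CF (FG _ i.+1) //.
  exact: (inB j.+1).
pose Q P := P `&` (B i.+1 `&` G).
have mQ P : measurable P -> measurable (Q P).
  by move=> mP; apply: measurableI => //; exact: measurableI.
(* The part of [W] in each level has the measure of its preimage in the base, and a
   point of the base has at most [k] images in [W]. *)
have key P W k : P = C \/ P = ~` C -> measurable W -> W `<=` P ->
    (forall y, tower_good (t i.+1) y -> B i.+1 y -> (visits g N.*2 W y <= k)%N) ->
    pr W <= k%:R * pr (Q P).
  move=> PC mW WP Wk; have mP : measurable P by case: PC => ->; [|exact: measurableC].
  have Pg j y : G y -> B i.+1 y -> (j < N.*2)%N -> P (iter j g y) -> P y.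
    by move=> Gy By jN; case: PC => -> /=; rewrite Cg.
  have mg j : measurable (iter j g @^-1` W) by exact: inner_pre (inner_iter j gi) mW.
  have mQW j : measurable (Q P `&` iter j g @^-1` W).
    by apply: measurableI => //; exact: mQ.
  have cnt : \sum_(j < N.*2) pr (Q P `&` iter j g @^-1` W) <= k%:R * pr (Q P).
    apply: (@pr_counting _ _ _ mu (Q P) N.*2 k (fun j => iter j g @^-1` W) (mQ _ mP) mg).
    move=> y [_ [By Gy]]; apply: leq_trans (Wk y (G3 _ _ Gy) By).
    apply: leq_sum => j _; rewrite (_ : (y \in _) = (iter j g y \in W)) //.
  apply: le_trans cnt.
  pose im j := iter j (f' i.+1) @^-1` (Q P `&` iter j g @^-1` W).
  have mim j : measurable (im j).
    exact: inner_pre (inner_iter j (inner_inv gi)) (mQW j).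
  have prim j : pr (im j) = pr (Q P `&` iter j g @^-1` W).
    exact: inner_pr (inner_iter j (inner_inv gi)) (mQW j).
  have [mU prU] : measurable (\big[setU/set0]_(j < N.*2) im j) /\
      pr (\big[setU/set0]_(j < N.*2) im j) <= \sum_(j < N.*2) pr (im j).
    elim: (N.*2) => [|n [IH1 IH2]]; first by rewrite !big_ord0 pr0.
    rewrite !big_ord_recr /=; split; first exact: measurableU.
    by apply: le_trans (pr_leU mu IH1 (mim n)) _; rewrite lerD2r.
  rewrite (eq_bigr (fun j : 'I__ => pr (im j))) //; apply: le_trans prU.
  have mWG : measurable (W `&` G) by exact: measurableI.
  have -> : pr W = pr (W `&` G).
    rewrite (pr_DI mu mW mG') (_ : pr (W `\` G) = 0) ?add0r //.
    apply/eqP; rewrite eq_le pr_ge0 andbT -prG; apply: pr_le.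
    + exact: measurableD.
    + exact: measurableC.
    + by move=> x [].
  apply: pr_le => // x [Wx Gx]; rewrite -bigcup_mkord.
  have [[j jN Bj] _ perx] := gt _ (G3 _ i.+1 Gx).
  have N0 : (0 < N)%N by rewrite expn_gt0.
  have Gj : G (iter j g x) by exact: inner_invariant (inner_iter j gi) GD _ _.
  pose l := if j is 0 then 0%N else (N.*2 - j)%N.
  have lN : (l < N.*2)%N by rewrite /l; case: (j); lia.
  have lx : iter l g (iter j g x) = x.
    by rewrite /l; case: (j) jN => // j' j'N; rewrite -iterD subnK // ltnW.
  exists l => //; have gK : cancel (iter l g) (iter l (f' i.+1)).
    by have [] := inner_iter l gi.
  rewrite /im /= -lx gK; split; last by rewrite /= lx.
  split=> //; apply: (Pg l) => //; rewrite lx; exact: WP.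
have mCC : measurable (~` C) by exact: measurableC.
have mAc : measurable (~` A_ i) by exact: measurableC.
have half W : W `<=` setT -> forall y, tower_good (t i.+1) y -> B i.+1 y -> (visits g N.*2 W y <= N.*2)%N.
  by move=> _ y _ _; exact: visits_le.
have q1 := key C C N.*2 (or_introl erefl) mC (@subset_refl _ _) (half C (@subsetT _ _)).
have q2 := key (~` C) (~` C) N.*2 (or_intror erefl) mCC (@subset_refl _ _)
  (half (~` C) (@subsetT _ _)).
have q3 : pr (A_ i `&` C) <= (N + m)%:R * pr (Q C).
  apply: key => //; [by left|exact: measurableI|].
  move=> y Gy By; have /andP[_] := visE y Gy By; apply: leq_trans.
  apply: leq_sum => j _; by rewrite in_setI; case: (_ \in A_ i); rewrite ?leq_b1.
have q4 : pr (~` A_ i `&` ~` C) <= (N.*2 - m)%:R * pr (Q (~` C)).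
  apply: key => //; [by right|exact: measurableI|].
  move=> y Gy By; have /andP[+ _] := visE y Gy By => mv.
  apply: leq_trans (leq_sub2l N.*2 mv); rewrite leq_subRL ?visits_le // /visits -big_split /=.
  rewrite -[X in (_ <= X)%N]card_ord -sum1_card; apply: leq_sum => j _.
  by rewrite in_setI in_setC; case: (_ \in A_ i); rewrite ?andbF //= leq_b1.
have q5 : N.*2%:R * (pr (Q C) + pr (Q (~` C))) <= 1.
  rewrite -[X in _ <= X](prB i.+1) -natrX N2 ler_wpM2l //.
  rewrite -pr_U; [|exact: mQ|exact: mQ|]; last first.
    by rewrite /Q setIACA setICr set0I.
  apply: pr_le => //; first by apply: measurableU; exact: mQ.
  by move=> x [[_ []]|[_ []]].
have q6 : pr C - e < pr (A_ i `&` C).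
  have := Ai; rewrite /pdist (pr_DI mu mC (mA i)) setIC.
  by have := pr_ge0 mu (A_ i `\` C); lra.
have q7 : 1 - pr C - e < pr (~` A_ i `&` ~` C).
  have E1 : ~` C `\` A_ i = ~` A_ i `&` ~` C by rewrite setDE setIC.
  have E2 : ~` C `&` A_ i = A_ i `\` C by rewrite setDE setIC.
  have := Ai; rewrite /pdist -pr_C // (pr_DI mu mCC (mA i)) E1 E2.
  by have := pr_ge0 mu (C `\` A_ i); lra.
have [eC eC'] : e <= pr C / 8 /\ e <= (1 - pr C) / 8.
  by split; rewrite /e ler_pM2r // ge_min lexx ?orbT.
have N0 : 0 < N%:R :> R by rewrite ltr0n expn_gt0.
have mN' : m%:R <= N%:R :> R by rewrite ler_nat.
move: q1 q2 q3 q4 q5; rewrite -addnn natrB ?(leq_trans mN) ?leq_addr // !natrD pr_C //.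
move: (N%:R : R) (m%:R : R) (pr (Q C)) (pr (Q (~` C))) N0 mN' => n k q q' N0 mN' q1 q2 q3 q4 q5.
have Eq : (n + n) * q = pr C by lra.
have Eq' : (n + n) * q' = 1 - pr C by lra.
have h1 : (n + n) * (pr C - e) < (n + k) * pr C.
  by rewrite -Eq mulrCA ltr_pM2l ?addr_gt0 //; lra.
have h2 : (n + n) * (1 - pr C - e) < (n + n - k) * (1 - pr C).
  by rewrite -Eq' mulrCA ltr_pM2l ?addr_gt0 //; lra.
have h3 : n * (3 / 4) < k.
  rewrite -(ltr_pM2r C0); have : n * e <= n * (pr C / 8) by rewrite ler_pM2l.
  lra.
have h4 : k < n / 4.
  rewrite -(ltr_pM2r C1); have : n * e <= n * ((1 - pr C) / 8) by rewrite ler_pM2l.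
  lra.
lra.
Qed.
End Towers.

(** * Coding points by reals *)

Section TernarySum.
Variable R : realType.
Implicit Types u v : nat -> bool.

Definition ternary_psum u n : R := \sum_(k < n) (u k)%:R / 3 ^+ k.+1.

Definition ternary_sum u : R := limn (ternary_psum u).

Lemma ternary_psum_ge0 u n : 0 <= ternary_psum u n.
Proof. by apply: sumr_ge0 => k _; rewrite divr_ge0 // exprn_ge0. Qed.

Lemma ternary_psumS u n :
  ternary_psum u n.+1 = (u 0%N)%:R / 3 + ternary_psum (fun k => u k.+1) n / 3.
Proof.
rewrite /ternary_psum big_ord_recl /= expr1 mulr_suml; congr (_ + _).
by apply: eq_bigr => k _; rewrite /bump /= add1n [3 ^+ k.+2]exprSr invfM mulrA.
Qed.

Lemma ternary_psum_le u n : ternary_psum u n <= 1 / 2.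
Proof.
elim: n u => [|n IHn] u; first by rewrite /ternary_psum big_ord0; lra.
rewrite ternary_psumS; have := IHn (fun k => u k.+1).
have : (u 0%N)%:R <= 1 :> R by case: (u 0%N).
lra.
Qed.

Lemma ternary_cvg u : ternary_psum u n @[n --> \oo] --> ternary_sum u.
Proof.
apply: nondecreasing_is_cvgn; last first.
  by exists (1 / 2) => _ [n _ <-]; exact: ternary_psum_le.
apply/nondecreasing_seqP => n; rewrite /ternary_psum big_ord_recr /= lerDl.
by rewrite divr_ge0 // exprn_ge0.
Qed.

Lemma ternary_sumS u :
  ternary_sum u = (u 0%N)%:R / 3 + ternary_sum (fun k => u k.+1) / 3.
Proof.
have cS := @ternary_cvg u; rewrite -cvg_shiftS in cS.
apply: (cvg_unique (@norm_hausdorff _ _) cS).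
rewrite (_ : (fun n => _) = fun n => (u 0%N)%:R / 3 + ternary_psum (fun k => u k.+1) n / 3).
  by apply: cvgD; [exact: cvg_cst|apply: cvgMl; exact: ternary_cvg].
by apply/funext => n; exact: ternary_psumS.
Qed.

Lemma ternary_sum_bounds u : 0 <= ternary_sum u <= 1 / 2.
Proof.
have c := @ternary_cvg u; have ic : cvgn (ternary_psum u) by apply/cvg_ex; eexists; exact: c.
apply/andP; split.
  by apply: limr_ge => //; near=> n; exact: ternary_psum_ge0.
by apply: limr_le => //; near=> n; exact: ternary_psum_le.
Unshelve. all: by end_near.
Qed.

Lemma ternary_sum_inj u v : ternary_sum u = ternary_sum v -> forall i, u i = v i.
Proof.
move=> + i; elim: i u v => [|i IHi] u v.
  rewrite (ternary_sumS u) (ternary_sumS v); have := ternary_sum_bounds (fun k => u k.+1).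
  have := ternary_sum_bounds (fun k => v k.+1).
  by case: (u 0%N); case: (v 0%N) => //=; lra.
move=> uv; apply: (IHi (fun k => u k.+1) (fun k => v k.+1)).
have uv0 : u 0%N = v 0%N.
  move: uv; rewrite (ternary_sumS u) (ternary_sumS v); have := ternary_sum_bounds (fun k => u k.+1).
  have := ternary_sum_bounds (fun k => v k.+1).
  by case: (u 0%N); case: (v 0%N) => //=; lra.
by move: uv; rewrite (ternary_sumS u) (ternary_sumS v) uv0; lra.
Qed.
End TernarySum.

Section Coding.
Context {d : measure_display} {T : measurableType d} {R : realType}.
Variable U : nat -> set T.
Hypothesis mU : forall i, measurable (U i).
Hypothesis U_sep : forall x y, (forall i, U i x <-> U i y) -> x = y.

(** The points are told apart by the sets [U i] that contain them; these are the digits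
of a ternary expansion without the digit two, which is unique. *)
Lemma injective_coding : exists phi : T -> R,
  [/\ measurable_fun setT phi, forall x, 0 <= phi x < 1 & injective phi].
Proof.
exists (fun x => ternary_sum R (fun i => `[< U i x >])); split.
- apply: (@measurable_fun_cvg _ _ _ setT
    (fun n x => ternary_psum R (fun i => `[< U i x >]) n)); last first.
    by move=> x _; exact: ternary_cvg.
  move=> n; apply: measurable_sum => k; apply: measurable_funM => //.
  rewrite (_ : (fun x => _) = \1_(U k)); first exact: measurable_indic.
  apply/funext => x; rewrite indicE; suff -> : (x \in U k) = `[< U k x >] by [].
  by apply/idP/idP => [/set_mem/asboolP|/asboolP/mem_set].
- by move=> x; have := ternary_sum_bounds R (fun i => `[< U i x >]); lra.
- move=> x y /ternary_sum_inj h; apply: U_sep => i; have := h i.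
  by move=> E; split=> /asboolP; [rewrite E|rewrite -E] => /asboolP.
Qed.

(** * Cylinders are dense in the measure algebra *)

Variable mu : probability T R.
Local Notation pr := (pr mu).
Hypothesis U_gen : forall A, measurable A -> <<s range U >> A.

Definition bits n (x : T) : seq bool := [seq `[< U i x >] | i <- iota 0 n].

Lemma size_bits n x : size (bits n x) = n.
Proof. by rewrite size_map size_iota. Qed.

Lemma take_bits n m x : (n <= m)%N -> take n (bits m x) = bits n x.
Proof. by move=> nm; rewrite /bits -map_take take_iota (minn_idPl nm). Qed.

Definition cylinder n (Q : pred (seq bool)) : set T := [set x | Q (bits n x)].

Lemma measurable_cylinder n Q : measurable (cylinder n Q).
Proof.
rewrite /cylinder (_ : [set x | _] = [set x | exists s, Q s /\ bits n x = s]); last first.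
  by apply/seteqP; split=> x /=; [exists (bits n x)|move=> [s [Qs ->]]].
apply: mset_ex => [|s]; first exact: countableP.
apply: mset_and; first exact: mset_cst.
rewrite (_ : [set x | _] = [set x | size s = n /\
    forall i, (i < n)%N -> (nth false s i <-> U i x)]); last first.
  have nE i x : (i < n)%N -> nth false (bits n x) i = `[< U i x >].
    by move=> ni; rewrite (nth_map 0%N) ?size_iota // nth_iota.
  apply/seteqP; split=> x /= => [<-|[sn h]].
    split=> [|i ni]; first exact: size_bits.
    by rewrite nE //; split=> /asboolP.
  apply: (@eq_from_nth _ false); rewrite size_bits // => i ni.
  by rewrite nE //; apply/asboolP/idP => /h; apply.
apply: mset_and; first exact: mset_cst.
apply: mset_all => [|i]; first exact: countableP.
apply: mset_imp; first exact: mset_cst.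
by apply: mset_and; apply: mset_imp; (exact: mset_cst || exact: mU).
Qed.

(** The approximable sets form a sigma-algebra ([approximableC], [approximable_bigcup])
that contains the sets [U i]. *)
Definition approximable (B : set T) : Prop := measurable B /\
  forall e : R, 0 < e -> exists n Q, pdist mu B (cylinder n Q) < e.

Lemma approximable0 : approximable set0.
Proof.
split=> // e e0; exists 0%N, xpred0.
by rewrite (_ : cylinder _ _ = set0) ?/pdist ?setDv ?pr0 ?addr0 //; apply/seteqP; split.
Qed.

Lemma approximableC B : approximable B -> approximable (~` B).
Proof.
move=> [mB aB]; split=> [|e /aB [n [Q h]]]; first exact: measurableC.
exists n, (predC Q).
have E (X Y : set T) : ~` X `\` ~` Y = Y `\` X by rewrite !setDE setCK setIC.
have -> : cylinder n (predC Q) = ~` cylinder n Q.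
  by apply/seteqP; split=> x /=; [move=> /negP|move=> /negP].
by rewrite /pdist !E -/(pdist mu (cylinder n Q) B) pdist_sym.
Qed.

Lemma approximableU A B : approximable A -> approximable B -> approximable (A `|` B).
Proof.
move=> [mA aA] [mB aB]; split=> [|e e0]; first exact: measurableU.
have e2 : 0 < e / 2 by lra.
have [n [P hP]] := aA _ e2; have [m [Q hQ]] := aB _ e2.
exists (maxn n m), (fun s => P (take n s) || Q (take m s)).
have -> : cylinder (maxn n m) (fun s => P (take n s) || Q (take m s)) =
    cylinder n P `|` cylinder m Q.
  by apply/seteqP; split=> x; rewrite /cylinder /= !take_bits ?leq_maxl ?leq_maxr // => /orP.
have [mP mQ] := (measurable_cylinder n P, measurable_cylinder m Q).
have sub (A' B' P' Q' : set T) : measurable A' -> measurable B' -> measurable P' ->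
    measurable Q' -> pr ((A' `|` B') `\` (P' `|` Q')) <= pr (A' `\` P') + pr (B' `\` Q').
  move=> mA' mB' mP' mQ'.
  apply: le_trans (pr_leU mu (measurableD mA' mP') (measurableD mB' mQ')).
  apply: pr_le; [by apply: measurableD; exact: measurableU|
    by apply: measurableU; exact: measurableD|].
  by move=> x [[Ax|Bx] n']; [left|right]; split=> // h; apply: n'; [left|right].
have := sub _ _ _ _ mA mB mP mQ; have := sub _ _ _ _ mP mQ mA mB.
move: hP hQ; rewrite /pdist; lra.
Qed.

Lemma approximable_bigcup (F : nat -> set T) :
  (forall n, approximable (F n)) -> approximable (\bigcup_n F n).
Proof.
move=> aF; have mF : measurable (\bigcup_n F n).
  by apply: bigcupT_measurable => n; have [] := aF n.
split=> // e e0; pose V n := \big[setU/set0]_(i < n) F i.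
have aV n : approximable (V n).
  elim: n => [|n IHn]; first by rewrite /V big_ord0; exact: approximable0.
  by rewrite /V big_ord_recr; exact: approximableU.
have mV n : measurable (V n) by case: (aV n).
have VF : \bigcup_n F n = \bigcup_n V n.
  apply/seteqP; split=> x [n _]; last by rewrite /V -bigcup_mkord => -[i _ Fx]; exists i.
  by move=> Fx; exists n.+1 => //; rewrite /V big_ord_recr; right.
have e2 : 0 < e / 2 by lra.
have cV : pr (V n) @[n --> \oo] --> pr (\bigcup_n F n).
  rewrite VF; apply: pr_cvg => // n x; rewrite /V big_ord_recr; by left.
move/cvgrPdist_lt: cV => /(_ _ e2)[n _ /(_ n (leqnn n)) /= nV].
have [m [Q hQ]] := (aV n).2 _ e2; exists m, Q.
apply: le_lt_trans (pdist_tri mu mF (mV n) (measurable_cylinder m Q)) _.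
have VS : V n `<=` \bigcup_n F n by rewrite VF => x Vx; exists n.
have : pdist mu (\bigcup_n F n) (V n) < e / 2.
  rewrite /pdist (_ : V n `\` _ = set0) ?pr0 ?addr0; last by rewrite setD_eq0.
  apply: le_lt_trans nV; rewrite [X in `|X - _|](pr_DI mu mF (mV n)) (setIidr VS).
  by rewrite addrK ler_norm.
lra.
Qed.

Lemma all_approximable B : measurable B -> approximable B.
Proof.
move=> mB; have := U_gen mB; apply: smallest_sub; last first.
  move=> _ [i _ <-]; split=> // e e0; exists i.+1, (fun s => nth false s i).
  rewrite (_ : cylinder _ _ = U i) ?/pdist ?setDv ?pr0 ?addr0 //.
  rewrite /cylinder; apply/seteqP; split=> x /=.
    by rewrite (nth_map 0%N) ?size_iota // nth_iota // => /asboolP.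
  by move=> Ux; rewrite (nth_map 0%N) ?size_iota // nth_iota //; apply/asboolP.
split; first exact: approximable0.
  by move=> A aA; rewrite setTD; exact: approximableC.
exact: approximable_bigcup.
Qed.

Lemma dense_sequence : exists A_ : nat -> set T, (forall i, measurable (A_ i)) /\
  forall B, measurable B -> forall e : R, 0 < e -> exists i, pdist mu B (A_ i) < e.
Proof.
pose A_ k := if unpickle k is Some (n, Q) then cylinder n (mem (Q : seq (seq bool))) else set0.
exists A_; split=> [i|B /all_approximable [_ aB] e e0].
  by rewrite /A_; case: unpickle => [[n Q]|] //; exact: measurable_cylinder.
have [n [Q h]] := aB e e0.
pose s := [seq val t | t <- enum {: n.-tuple bool} & Q (val t)].
exists (pickle (n, s)); rewrite /A_ pickleK (_ : cylinder n _ = cylinder n Q) //.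
apply/seteqP; split=> x; rewrite /cylinder /=.
  by move=> /mapP[t]; rewrite mem_filter => /andP[Qt _] ->.
move=> Qx; apply/mapP; exists (Tuple (introT eqP (size_bits n x))) => //.
by rewrite mem_filter mem_enum Qx.
Qed.

(** * Free actions of infinite groups have no atoms *)

Lemma measurable_point (phi : T -> R) x : measurable_fun setT phi -> injective phi ->
  measurable ([set x] : set T).
Proof.
move=> mphi phi_inj; rewrite (_ : [set x] = [set y | phi y = cst (phi x) y]).
  by apply: (@mset_eq _ _ _ phi (cst (phi x))) => //; exact: measurable_cst.
by apply/seteqP; split=> y /= => [->|/phi_inj].
Qed.

(** The points of an infinite orbit have the same measure. *)
Lemma aperiodic_atomless (f f' : T -> T) : cancel f f' -> cancel f' f ->
  (forall A, measurable A -> pr (f @^-1` A) = pr A) ->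
  (forall n x, iter n.+1 f x <> x) -> (forall x, measurable ([set x] : set T)) ->
  forall x, pr [set x] = 0.
Proof.
move=> fK f'K finv fap m1 x; have mf n : pr [set iter n f x] = pr [set x].
  elim: n => // n <-; rewrite -(finv _ (m1 _)); congr pr.
  by apply/seteqP; split=> y /= => [/(can_inj fK)|->].
apply/eqP; rewrite eq_le pr_ge0 andbT leNgt; apply/negP => p0.
have [n] := ltr_add_invr p0; rewrite add0r => nC.
pose F n := \big[setU/set0]_(i < n) [set iter i f x].
have [mF prF] : measurable (F n.+1) /\ pr (F n.+1) = n.+1%:R * pr [set x].
  elim: n.+1 => [|k [mk pk]]; first by rewrite /F big_ord0 pr0 mul0r.
  rewrite /F big_ord_recr /=; split; first exact: measurableU.
  rewrite pr_U // ?pk ?mf -1?natr1; first by rewrite mulrDl mul1r.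
  apply/seteqP; split=> // y [+ /= yE]; rewrite -(bigcup_mkord k (fun i => [set iter i f x])) => -[i /= ik].
  rewrite yE => E; apply: (fap (k - i.+1)%N (iter i f x)).
  by rewrite -iterD addSnnS subnK.
have := pr_le1 mu mF; rewrite prF leNgt => /negP; apply.
have n0 : 0 < n.+1%:R :> R by rewrite ltr0n.
by rewrite -[X in X < _](mulfV (lt0r_neq0 n0)) ltr_pM2l.
Qed.
End Coding.

(** * Borel sets of Polish spaces *)

Section PolishBase.
Variables (R : realType) (X : ptopologicalType).

Definition countable_base (U : nat -> set X) : Prop :=
  [/\ forall i, open (U i), forall x y, (forall i, U i x <-> U i y) -> x = y &
      forall (O : set X) x, open O -> O x -> exists2 i, U i x & U i `<=` O].

Lemma polish_base : polish R X -> exists U, countable_base U.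
Proof.
move=> [[D0 cD0 dD0] [dd [[d0 dE dC dT] dN _]]].
have opE (O : set X) : open O <-> forall x, O x -> exists2 e : R, 0 < e & [set y | dd x y < e] `<=` O.
  rewrite openE; split=> [h x /h /dN //|h x /h /dN //].
have ball_open x (e : R) : open [set y | dd x y < e].
  apply/opE => y /= xy; exists (e - dd x y); first by rewrite subr_gt0.
  by move=> z /= yz; apply: le_lt_trans (dT x y z) _; lra.
have [x0 Dx0] : D0 !=set0.
  have [|x [_ Dx]] := dD0 setT _ openT; [by exists point|by exists x].
have [e eP] : exists e : nat -> X, forall x, D0 x -> exists n, e n = x.
  move/countable_injP: cD0 => [f finj].
  exists (fun n => if pselect (exists2 x, D0 x & f x = n) is left h then projT1 (cid2 h) else x0).
  move=> x Dx; exists (f x); case: pselect => [h|[]]; last by exists x.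
  by case: cid2 => y Dy yx; apply: finj; rewrite ?inE.
pose U k := if unpickle k is Some (n, m) then [set y | dd (e n) y < m.+1%:R^-1] else set0.
have Ubase (O : set X) x : open O -> O x -> exists2 i, U i x & U i `<=` O.
  move=> oO Ox; have [r r0 rO] := (opE O).1 oO x Ox.
  have r2 : 0 < r / 2 by lra.
  have [m] := ltr_add_invr r2; rewrite add0r => mr.
  have m0 : 0 < m.+1%:R^-1 :> R by rewrite invr_gt0 ltr0n.
  have [|y [/= xy Dy]] := dD0 [set y | dd x y < m.+1%:R^-1] _ (ball_open _ _).
    by exists x => /=; rewrite (dE x x).2.
  have [n en] := eP y Dy; exists (pickle (n, m)); rewrite /U pickleK en /=.
    by rewrite dC.
  by move=> z /= yz; apply: rO => /=; apply: le_lt_trans (dT x y z) _; have := lt_trans yz mr; have := lt_trans xy mr; lra.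
exists U; split=> //.
  by move=> i; rewrite /U; case: unpickle => [[n m]|]; [exact: ball_open|exact: open0].
move=> x y h; apply/dE; apply/eqP; rewrite eq_le d0 andbT leNgt; apply/negP => xy.
have [i Ux Uy] := Ubase _ x (ball_open x (dd x y)) (etrans (congr1 (fun r => r < _) ((dE x x).2 erefl)) xy).
by have := Uy y ((h i).1 Ux); rewrite /= ltxx.
Qed.

Lemma base_generates U : countable_base U ->
  forall A : set (borelType X), measurable A -> <<s range U >> A.
Proof.
move=> [oU _ Ub] A mA; move: mA; apply: smallest_sub; first exact: smallest_sigma_algebra.
move=> O oO; have -> : O = \bigcup_(i in [set i | U i `<=` O]) U i.
  by apply/seteqP; split=> x => [/(Ub _ _ oO)[i Ux UO]|[i /= + Ux]]; [exists i|exact].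
rewrite bigcup_mkcond; apply: sigma_algebra_bigcup => i; case: ifP => _.
  by apply: sub_sigma_algebra; exists i.
exact: sigma_algebra0.
Qed.

Lemma base_measurable U : countable_base U -> forall i, measurable (U i : set (borelType X)).
Proof. by move=> [oU _ _] i; apply: sub_sigma_algebra; exact: oU. Qed.
End PolishBase.

(** * Labels that recur along every orbit *)

Section TwoSidedOrbits.
Variables (T : Type) (w w' : T -> T).
Hypotheses (wK : cancel w w') (w'K : cancel w' w).

Definition dir (e : bool) : T -> T := if e then w' else w.
Definition pt (p : bool * nat) (x : T) : T := iter p.2 (dir p.1) x.

Lemma dirK e : cancel (dir e) (dir (~~ e)).
Proof. by case: e. Qed.

Lemma iter_dirK e n : cancel (iter n (dir e)) (iter n (dir (~~ e))).
Proof.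
by elim: n => [//|n IHn] x; rewrite iterSr [iter n.+1 (dir e) x]iterS dirK IHn.
Qed.

Lemma iter_dir_back e m n x : (m <= n)%N ->
  iter m (dir (~~ e)) (iter n (dir e) x) = iter (n - m) (dir e) x.
Proof. by move=> mn; rewrite -{1}(subnKC mn) iterD iter_dirK. Qed.

Lemma iter_dir_sub e m n x : (m <= n)%N ->
  iter n (dir (~~ e)) (iter m (dir e) x) = iter (n - m) (dir (~~ e)) x.
Proof. by move=> mn; rewrite -{1}(subnK mn) iterD iter_dirK. Qed.

Lemma pt_far e n N p x : (N + p.2 <= n)%N ->
  exists2 k, (N <= k)%N & iter n (dir e) (pt p x) = iter k (dir e) x.
Proof.
case: p => f m /= Nmn; rewrite /pt /=; have [->|fe] := eqVneq f e.
  by exists (n + m)%N; [lia|rewrite iterD].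
have -> : e = ~~ f by case: e fe; case: f.
by exists (n - m)%N; [lia|rewrite iter_dir_sub //; lia].
Qed.

Lemma pt_trans p q x : exists r, pt p (pt q x) = pt r x.
Proof.
case: p q => [e m] [f n]; rewrite /pt /=; have [->|fe] := eqVneq f e.
  by exists (e, m + n)%N; rewrite /= iterD.
have -> : e = ~~ f by case: e fe; case: f.
have [nm|mn] := leqP n m; first by exists (~~ f, m - n)%N; rewrite /= iter_dir_sub.
exists (f, n - m)%N => /=; rewrite -{1}(subnKC (ltnW mn)) iterD.
exact: iter_dirK.
Qed.

Lemma pt_sym p x : exists r, pt r (pt p x) = x.
Proof. by case: p => e n; exists (~~ e, n); rewrite /pt /= iter_dirK. Qed.

Section FirstReturn.
Variables (C : Type) (c : T -> C).

Definition first_return e x y : Prop := exists k, [/\ y = iter k.+1 (dir e) x, c y = c x &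
  forall i, (i < k)%N -> c (iter i.+1 (dir e) x) <> c x].

Hypothesis recurrent : forall e x, exists k, c (iter k.+1 (dir e) x) = c x.

Lemma first_return_ex e x : exists y, first_return e x y.
Proof.
have ex : exists k, `[< c (iter k.+1 (dir e) x) = c x >].
  by have [k kx] := recurrent e x; exists k; apply/asboolP.
case: (ex_minnP ex) => k /asboolP ck kmin; exists (iter k.+1 (dir e) x), k.
by split=> // i ik /asboolP/kmin; rewrite leqNgt ik.
Qed.

Lemma first_return_un e x y z : first_return e x y -> first_return e x z -> y = z.
Proof.
move=> [k [-> ck kmin]] [l [-> cl lmin]].
by case: (ltngtP k l) => [/lmin|/kmin|->].
Qed.

(** No point strictly between [x] and [y] has their label, from whichever side this is
seen. Hence the first return maps in the two directions are inverse to each other. *)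
Lemma first_return_sym e x y : first_return e x y -> first_return (~~ e) y x.
Proof.
move=> [k [-> ck kmin]]; exists k; split=> [||i ik]; first by rewrite iter_dirK.
  by [].
rewrite ck iter_dir_back; last exact: ltnW.
rewrite subSS.
have -> : (k - i = (k - i.+1).+1)%N by lia.
by apply: kmin; lia.
Qed.

Lemma return_maps : exists V V' : T -> T, [/\ cancel V V', cancel V' V,
  forall x, first_return false x (V x) & forall x, first_return true x (V' x)].
Proof.
have [V VP] := choice (first_return_ex false); have [V' V'P] := choice (first_return_ex true).
exists V, V'; split=> // x.
  exact: first_return_un (V'P _) (first_return_sym (VP x)).
exact: first_return_un (VP _) (first_return_sym (V'P x)).
Qed.

Lemma return_iter V n x : (forall x, first_return false x (V x)) ->
  exists2 k, (n <= k)%N & iter n V x = iter k w x.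
Proof.
move=> VP; elim: n => [|n [k nk IHn]]; first by exists 0%N.
have [l [E _ _]] := VP (iter n V x); exists (l.+1 + k)%N; first lia.
by rewrite /= E IHn -iterD.
Qed.

(** The first return map cannot jump over a point with the same label. *)
Lemma return_reaches V k x : (forall x, first_return false x (V x)) ->
  c (iter k w x) = c x -> exists n, iter k w x = iter n V x.
Proof.
move=> VP; elim/ltn_ind: k x => -[|k] IHk x ckx; first by exists 0%N.
have [l [E cE lmin]] := VP x.
have lk : (l <= k)%N by rewrite leqNgt; apply/negP => /lmin.
have kE : iter k.+1 w x = iter (k - l) w (V x).
  by rewrite E (_ : k.+1 = (k - l + l.+1)%N) ?iterD //; lia.
have [n nE] : exists n, iter (k - l) w (V x) = iter n V (V x).
  by apply: IHk; [lia|rewrite -kE ckx cE].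
by exists n.+1; rewrite kE nE iterSr.
Qed.
End FirstReturn.
End TwoSidedOrbits.

Section RecurrentLabels.
Context {d : measure_display} {T : measurableType d} {R : realType}.
Variables (w w' : T -> T).
Hypotheses (wK : cancel w w') (w'K : cancel w' w).
Hypotheses (mw : measurable_fun setT w) (mw' : measurable_fun setT w').
Hypothesis wfree : forall n x, iter n.+1 w x <> x.
Variable phi : T -> R.
Hypotheses (mphi : measurable_fun setT phi) (phi01 : forall x, 0 <= phi x < 1).
Hypothesis phi_inj : injective phi.
Local Notation dirw := (dir w w').
Local Notation ptw := (pt w w').

Let iter_dirK' := iter_dirK wK w'K.

Lemma dir_free e n x : iter n.+1 (dirw e) x <> x.
Proof.
case: e => E; last exact: (wfree E).
apply: (@wfree n x); rewrite -[X in iter _ _ X]E.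
exact: (iter_dirK' true n.+1).
Qed.

Lemma pt_dist_uniq p q x : ptw p x = ptw q x -> p.2 = q.2.
Proof.
wlog pq : p q / (p.2 <= q.2)%N.
  by move=> h; have [/h//|/ltnW/h h' /esym/h'] := leqP p.2 q.2.
move: pq; rewrite leq_eqVlt => /predU1P[//|]; case: p q => [e m] [f n] /= mn.
rewrite /pt /=; have [->|fe] := eqVneq f e.
  rewrite -(subnK mn) -addSnnS iterD => /esym E; exfalso; move: E; exact: dir_free.
have -> : e = ~~ f by case: e fe; case: f.
move/(congr1 (iter m (dirw f))); rewrite -{1}[f]negbK (iter_dirK' (~~ f)) -iterD.
by case: (n) mn => // n' _; rewrite addnS => /esym/dir_free.
Qed.

Lemma measurable_pt p : measurable_fun setT (ptw p).
Proof.
case: p => e n; have md : measurable_fun setT (dirw e) by case: e.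
elim: n => [|n IHn]; first exact: measurable_id.
exact: (measurableT_comp md IHn).
Qed.

Lemma pt_pre p (A : set T) : measurable A -> measurable [set x | A (ptw p x)].
Proof. by move=> mA; apply: mset_preimage => //; exact: measurable_pt. Qed.

Let cp : countable [set: bool * nat]. Proof. exact: countableP. Qed.
Let cn : countable [set: nat]. Proof. exact: countableP. Qed.

(** The levels of the points of an orbit measure how close their codes are to the
infimum of the codes along the orbit. A point whose code is the infimum has no level;
if an orbit has no such point, then arbitrarily large levels occur in it. *)
Definition near_inf n x : Prop := forall p, phi x <= phi (ptw p x) + n.+1%:R^-1.
Definition level n x : Prop := ~ near_inf n x /\ forall m, (m < n)%N -> near_inf m x.

(** The last point of a level in one of the two directions, or the point where the
infimum is attained: if an orbit has such a point, then it has a distinguished point.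
In the remaining orbits, every level that occurs recurs in both directions. *)
Definition special i : set T := if i is n.+1
  then [set x | level n./2 x /\ forall k, ~ level n./2 (iter k.+1 (dirw (odd n)) x)]
  else [set x | forall n, near_inf n x].

Lemma measurable_near n : measurable [set x | near_inf n x].
Proof.
apply: mset_all => // p; apply: mset_le => //.
by apply: measurable_funD => //; apply: measurableT_comp => //; exact: measurable_pt.
Qed.

Lemma measurable_level n : measurable [set x | level n x].
Proof.
apply: mset_and; first by apply: mset_not; exact: measurable_near.
by apply: mset_all => // m; apply: mset_imp; [exact: mset_cst|exact: measurable_near].
Qed.

Lemma measurable_special i : measurable (special i).
Proof.
case: i => [|n] /=; first by apply: mset_all => // n; exact: measurable_near.
apply: mset_and; first exact: measurable_level.
apply: mset_all => // k; apply: mset_not.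
exact: (@pt_pre (odd n, k.+1) _ (measurable_level n./2)).
Qed.

Lemma level_uniq m n x : level m x -> level n x -> m = n.
Proof. by move=> [nm hm] [nn hn]; case: (ltngtP m n) => // [/hn|/hm]. Qed.

Lemma near_decr m n x : (m <= n)%N -> near_inf n x -> near_inf m x.
Proof.
move=> mn h p; apply: le_trans (h p) _; rewrite lerD2l lef_pV2 ?posrE ?ltr0n //.
by rewrite ler_nat.
Qed.

(** The infimum is attained at one point only, as [phi] is injective, and of two points
of a level at most one is the last. *)
Lemma special_uniq i p x : special i x -> special i (ptw p x) -> ptw p x = x.
Proof.
case: i => [|n] /=.
  move=> hx hy; apply: phi_inj; apply/eqP; rewrite eq_le; apply/andP; split.
    have [r rE] := pt_sym wK w'K p x.
    apply/ler_addgt0Pr => e e0; have [m] := ltr_add_invr e0; rewrite add0r => /ltW me.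
    by have := hy m r; rewrite rE => h; apply: le_trans h _; rewrite lerD2l.
  apply/ler_addgt0Pr => e e0; have [m] := ltr_add_invr e0; rewrite add0r => /ltW me.
  by have := hx m p => h; apply: le_trans h _; rewrite lerD2l.
case: p => f [//|k] [lx nx] [ly ny]; have [fE|fE] := eqVneq f (odd n).
  by case: (nx k); rewrite -fE.
case: (ny k); rewrite /pt /= (_ : odd n = ~~ f); last by case: (f) fE; case: (odd n).
by rewrite -iterS (iter_dirK' f k.+1).
Qed.

Definition smooth x : Prop := exists i p, special i (ptw p x).

Lemma smooth_pt p x : smooth (ptw p x) <-> smooth x.
Proof.
split=> [[i [q h]]|[i [q h]]]; exists i.
  by have [r rE] := pt_trans wK w'K q p x; exists r; rewrite -rE.
have [r rE] := pt_sym wK w'K p x; have [s sE] := pt_trans wK w'K q r (ptw p x).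
by exists s; rewrite -sE rE.
Qed.

Definition attained n x : Prop := exists p, level n (ptw p x).

Lemma attained_pt n p x : attained n (ptw p x) <-> attained n x.
Proof.
split=> [[q h]|[q h]].
  by have [r rE] := pt_trans wK w'K q p x; exists r; rewrite -rE.
have [r rE] := pt_sym wK w'K p x; have [s sE] := pt_trans wK w'K q r (ptw p x).
by exists s; rewrite -sE rE.
Qed.

(** Only the levels that occur in the orbit are numbered, so that all the numbers are
used if infinitely many levels occur. *)
Definition rank n x : nat := count id (bits (fun m => [set x | attained m x]) n x).

Lemma rankS n x : rank n.+1 x = (rank n x + `[< attained n x >])%N.
Proof. by rewrite /rank /bits -addn1 iotaD map_cat count_cat /= addn0. Qed.

Lemma rank_pt n p x : rank n (ptw p x) = rank n x.
Proof.
elim: n => // n IHn; rewrite !rankS IHn; congr (_ + nat_of_bool _)%N.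
by apply/asboolP/asboolP => /attained_pt.
Qed.

(** On an orbit with a distinguished point, the label depends on the distance to this
point, in such a way that each label occurs at arbitrarily large distances; on the other
orbits it numbers the levels. *)
Definition labelled x l : Prop :=
  (exists i p, [/\ rep p.2 = l, special i (ptw p x) &
     forall i' q, (i' < i)%N -> ~ special i' (ptw q x)]) \/
  (~ smooth x /\ exists n, level n x /\ rank n x = l).

Lemma labelled_ex x : exists l, labelled x l.
Proof.
have [[i0 [p0 h0]]|ns] := pselect (smooth x).
  have ex : exists i, `[< exists p, special i (ptw p x) >] by exists i0; apply/asboolP; exists p0.
  case: (ex_minnP ex) => i /asboolP [p h] imin; exists (rep p.2); left; exists i, p.
  by split=> // i' q i'i h'; have := imin i'; rewrite leqNgt i'i => /(_ _)/negP; case=> //; apply/asboolP; exists q.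
have ex : exists n, `[< ~ near_inf n x >].
  apply: contrapT => h; apply: ns; exists 0%N, (false, 0%N) => n /=; apply: contrapT => nn.
  by apply: h; exists n; apply/asboolP.
case: (ex_minnP ex) => n /asboolP nn nmin; exists (rank n x); right; split=> //; exists n.
split=> //; split=> // m mn; apply: contrapT => nm; have := nmin m; rewrite leqNgt mn.
by move=> /(_ _)/negP; case=> //; apply/asboolP.
Qed.

Lemma labelled_un x k l : labelled x k -> labelled x l -> k = l.
Proof.
case=> [[i [p [<- hi imin]]]|[nk [n [ln <-]]]]; case=> [[j [q [<- hj jmin]]]|[nl [m [lm <-]]]].
- have ij : i = j by case: (ltngtP i j) => // [/jmin|/imin]; [move=> /(_ p)|move=> /(_ q)].
  subst j; congr rep; have [r rE] := pt_sym wK w'K p x.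
  have [s sE] := pt_trans wK w'K q r (ptw p x); rewrite rE in sE.
  apply: (@pt_dist_uniq _ _ x); rewrite sE; apply/esym.
  by apply: (special_uniq hi); rewrite -sE.
- by case: nl; exists i, p.
- by case: nk; exists j, q.
- by rewrite (level_uniq ln lm).
Qed.

Lemma measurable_labelled l : measurable [set x | labelled x l].
Proof.
apply: mset_or.
  apply: mset_ex => // i; apply: mset_ex => // p.
  rewrite (_ : [set x | _] = [set x | rep p.2 = l /\ (special i (ptw p x) /\
    forall i' q, (i' < i)%N -> ~ special i' (ptw q x))]); last first.
    by apply/seteqP; split=> x [? // []].
  apply: mset_and; first exact: mset_cst.
  apply: mset_and; first by apply: pt_pre; exact: measurable_special.
  apply: mset_all => // i'; apply: mset_all => // q; apply: mset_imp; first exact: mset_cst.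
  by apply: mset_not; apply: pt_pre; exact: measurable_special.
apply: mset_and.
  apply: mset_not; apply: mset_ex => // i; apply: mset_ex => // p.
  by apply: pt_pre; exact: measurable_special.
apply: mset_ex => // n; apply: mset_and; first exact: measurable_level.
rewrite (_ : [set x | _] =
    cylinder (fun m => [set x | attained m x]) n (fun s => count id s == l)); last first.
  by apply/seteqP; split=> x /eqP.
apply: measurable_cylinder => m.
by apply: mset_ex => // p; apply: pt_pre; exact: measurable_level.
Qed.

Lemma nonsmooth_recurrent e n x N : ~ smooth x -> attained n x ->
  exists2 k, (N <= k)%N & level n (iter k (dirw e) x).
Proof.
move=> ns [p lp].
have next y : (exists q, y = ptw q x) -> level n y -> exists k, level n (iter k.+1 (dirw e) y).
  move=> [q ->] ly; apply: contrapT => h; apply: ns; exists (n.*2 + e).+1%N, q => /=.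
  have -> : ((n.*2 + e)./2 = n)%N by rewrite addnC half_bit_double.
  have -> : odd (n.*2 + e) = e by rewrite oddD odd_double; case: (e).
  by split=> // k lk; apply: h; exists k.
have far M : exists2 k, (M <= k)%N & level n (iter k (dirw e) (ptw p x)).
  elim: M => [|M [k Mk lk]]; first by exists 0%N.
  have [|l ll] := next _ _ lk.
    by have [r rE] := pt_trans wK w'K (e, k) p x; exists r; rewrite -rE.
  by exists (l.+1 + k)%N; [lia|rewrite iterD].
have [k Mk lk] := far (N + p.2)%N.
by have [l Nl E] := pt_far wK w'K e x Mk; exists l => //; rewrite -E.
Qed.

Lemma nonsmooth_attained n x : ~ smooth x -> exists2 m, (n < m)%N & attained m x.
Proof.
move=> ns; pose P := [set phi (ptw p x) | p in [set: bool * nat]].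
have infP : has_inf P.
  split; first by exists (phi x), (false, 0%N).
  by exists 0 => _ [p _ <-]; case/andP: (phi01 (ptw p x)).
have n0 : 0 < n.+1%:R^-1 :> R by rewrite invr_gt0 ltr0n.
have [_ [p _ <-] hp] := inf_adherent n0 infP.
have np : near_inf n (ptw p x).
  move=> q; have [r ->] := pt_trans wK w'K q p x; apply/ltW; apply: lt_le_trans hp _.
  by rewrite lerD2r; apply: ge_inf; [case: infP|exists r].
have [l] := labelled_ex (ptw p x); case=> [[i [q [_ h _]]]|[_ [m [lm _]]]].
  by case: ns; apply/(smooth_pt p x); exists i, q.
exists m; last by exists p.
by rewrite ltnNge; apply/negP => mn; case: lm => + _; apply; exact: near_decr np.
Qed.

Lemma rank_surj l x : ~ smooth x -> exists2 n, attained n x & rank n x = l.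
Proof.
move=> ns.
have incr m n : (m <= n)%N -> (rank m x <= rank n x)%N.
  elim: n => [|n IHn]; first by rewrite leqn0 => /eqP ->.
  by rewrite leq_eqVlt ltnS => /predU1P[->//|/IHn h]; rewrite rankS (leq_trans h) ?leq_addr.
have ex : exists n, (l < rank n.+1 x)%N.
  elim: l => [|l [n hn]]; have [m nm am] := nonsmooth_attained 0 ns.
    by exists m; rewrite rankS (_ : `[< _ >]) ?addn1 //; apply/asboolP.
  have {m nm am} [m nm am] := nonsmooth_attained n ns.
  exists m; rewrite rankS (_ : `[< _ >]) ?addn1 ?ltnS; last by apply/asboolP.
  by apply: leq_trans hn _; exact: incr.
case: (ex_minnP ex) => n ln nmin; exists n.
  apply: contrapT => na; move: ln; rewrite rankS (_ : `[< _ >] = false) ?addn0.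
    case: n nmin na => [//|n] nmin _ /nmin; by rewrite ltnn.
  by apply/asboolP.
have rl : (rank n x <= l)%N.
  by case: n nmin ln => // n nmin _; rewrite leqNgt; apply/negP => /nmin; rewrite ltnn.
by move: ln; rewrite rankS; case: `[< _ >]; lia.
Qed.

Lemma labelled_recurrent e l x N : exists2 k, (N <= k)%N & labelled (iter k (dirw e) x) l.
Proof.
have [[i0 [p0 h0]]|ns] := pselect (smooth x); last first.
  have [n an rn] := rank_surj l ns.
  have [k Nk lk] := nonsmooth_recurrent e N ns an; exists k => //; right.
  split; first by move/(smooth_pt (e, k) x).
  by exists n; split=> //; rewrite -rn; exact: (rank_pt n (e, k) x).
have ex : exists i, `[< exists p, special i (ptw p x) >] by exists i0; apply/asboolP; exists p0.
case: (ex_minnP ex) => i /asboolP [p h] imin.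
have [n Nn rn] := rep_inf l (N + p.2).
have [k Nk kE] := pt_far wK w'K e x Nn; exists k => //; rewrite -kE; left.
exists i, (~~ e, n); split=> //; first by rewrite /pt /= iter_dirK'.
move=> i' q i'i; rewrite kE => h'; have := imin i'; rewrite leqNgt i'i => /(_ _)/negP; case=> //.
apply/asboolP; have [r rE] := pt_trans wK w'K q (e, k) x; exists r; rewrite -rE; exact: h'.
Qed.

Theorem recurrent_labels (L : countType) : L -> exists lam : T -> L,
  (forall l, measurable [set x | lam x = l]) /\
  forall e l x N, exists2 k, (N <= k)%N & lam (iter k (dirw e) x) = l.
Proof.
move=> l0; have [j jP] := choice labelled_ex.
have jE x n : (j x = n) = labelled x n.
  by apply/propext; split=> [<-//|]; exact: labelled_un (jP x).
exists (fun x => odflt l0 (unpickle (j x))); split=> [l|e l x N].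
  rewrite (_ : [set x | _] = [set x | exists n, odflt l0 (unpickle n) = l /\ labelled x n]).
    apply: mset_ex => // n; apply: mset_and; [exact: mset_cst|exact: measurable_labelled].
  apply/seteqP; split=> x /= => [<-|[n [<-]]]; last by rewrite -jE => ->.
  by exists (j x).
have [k Nk] := labelled_recurrent e (pickle l) x N.
by rewrite -jE => jk; exists k => //; rewrite jk pickleK.
Qed.
End RecurrentLabels.

(** * Strictly increasing partitions of a countable set of labels *)

Section RealFilter.
Variable R : realType.
Implicit Types (l m : seq rat) (r s : R).

Definition above r l : seq rat := [seq q <- l | r <= ratr q].

Lemma above_le r s l m : r <= s -> above r l = above r m -> above s l = above s m.
Proof.
move=> rs E; have aa k : above s (above r k) = above s k.
  rewrite /above -filter_predI; apply: eq_filter => q /=.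
  by case: leP => //= sq; rewrite (le_trans rs).
by rewrite -[LHS]aa E aa.
Qed.

(** A rational between [r] and [s] is deleted by [above s] but not by [above r]. *)
Lemma above_lt r s l : r < s -> exists2 m, above s m = above s l & above r m <> above r l.
Proof.
move=> rs; have [q] := rat_in_itvoo rs; rewrite in_itv /= => /andP[rq qs].
exists (q :: l); rewrite /above /=.
  by rewrite leNgt qs.
by rewrite (ltW rq) => /(congr1 size) /=; lia.
Qed.

Lemma measurable_above d (Y : measurableType d) (rr : Y -> R) l m :
  (forall c, measurable [set y | rr y <= c]) -> measurable [set y | above (rr y) l = m].
Proof.
move=> mrr; elim: l m => [|q l IHl] m /=; first exact: mset_cst.
rewrite (_ : [set y | _] = [set y | (rr y <= ratr q /\ q :: above (rr y) l = m) \/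
    (~ (rr y <= ratr q) /\ above (rr y) l = m)]); last first.
  rewrite /above; apply/seteqP; split=> y /=.
    by case: leP => h E; [left|right]; split=> //; rewrite leNgt h.
  by case: leP => h; case=> -[h1 E] //; move: h1; rewrite leNgt h.
apply: mset_or; apply: mset_and => //; last exact: mset_not.
case: m => [|q' m].
  by rewrite (_ : [set y | _] = set0) //; apply/seteqP; split.
rewrite (_ : [set y | _] = [set y | q = q' /\ above (rr y) l = m]).
  by apply: mset_and => //; exact: mset_cst.
by apply/seteqP; split=> y /= [-> ->].
Qed.
End RealFilter.

(** * Preimages of Borel sets *)

Lemma borel_preimage (S T : topologicalType) (f : S -> T) (A : set T) :
  continuous f -> borel A -> borel (f @^-1` A).
Proof.
move=> /continuousP cf; apply: (@smallest_sub _ _ _ [set A | borel (f @^-1` A)]).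
  split=> /=; first exact: sigma_algebra0.
    move=> B bB; rewrite setTD -preimage_setC -setTD; exact: sigma_algebraCD.
  by move=> F bF; rewrite preimage_bigcup; exact: sigma_algebra_bigcup.
by move=> O /cf oO; apply: sub_sigma_algebra.
Qed.

(** * The actions of the stratification *)

Section Stratification.
Context {d : measure_display} {T : measurableType d} {R : realType}.
Variable mu : probability T R.
Local Notation pr := (pr mu).
Variables (D : groupType) (b : D -> T -> T) (bF : free_action b).
Hypothesis bm : forall g, measurable_fun setT (b g).
Hypothesis cD : countable [set: D].
Variables (K C : nat -> set D) (KC : pingpong K C).
Variable z : nat -> D.
Hypotheses (zK : forall j, K j (z j)) (z_inf : forall j n, (z j ^+ n.+1)%g <> 1%g).
Variables (F F' : T -> T).
Hypothesis FF' : inner b (K 0%N) F F'.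
Hypothesis F_free : forall n x, iter n.+1 F x <> x.
Hypothesis F_ergodic : forall C, measurable C -> (forall x, C x <-> C (F x)) ->
  pr C = 0 \/ pr C = 1.
Variable lam : T -> seq rat.
Hypothesis mlam : forall l, measurable [set x | lam x = l].
Let w := b (z 1%N).
Let w' := b (z 1%N)^-1%g.
Hypothesis lam_rec : forall e l x N, exists2 k, (N <= k)%N & lam (iter k (dir w w' e) x) = l.
Variables (G : groupType) (S : set G) (Sfree : freely_generates S).
Variables (i0 i1 : G) (Si0 : S i0) (Si1 : S i1) (i01 : i0 <> i1).
Hypothesis cG : countable [set: G].
Variable num : G -> nat.
Hypothesis num_inj : injective num.

Let wK : cancel w w' := actK bF (z 1%N).
Let w'K : cancel w' w := actVK bF (z 1%N).

Lemma iter_act g n x : iter n (b g) x = b (g ^+ n)%g x.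
Proof.
have [[b1 bM] _] := bF; elim: n => [|n IHn]; first by rewrite expg0 b1.
by rewrite iterS IHn expgS bM.
Qed.

Definition rlabel (r : R) (x : T) : seq rat := above r (lam x).

Lemma rlabel_rec r e x : exists k, rlabel r (iter k.+1 (dir w w' e) x) = rlabel r x.
Proof.
have [[|k] // k1 kE] := lam_rec e (lam x) x 1%N.
by exists k; rewrite /rlabel kE.
Qed.

Lemma return_family : exists V V' : R -> T -> T, forall r, [/\ cancel (V r) (V' r),
  cancel (V' r) (V r), forall x, first_return w w' (rlabel r) false x (V r x) &
  forall x, first_return w w' (rlabel r) true x (V' r x)].
Proof.
have ex r : exists VV : (T -> T) * (T -> T), [/\ cancel VV.1 VV.2, cancel VV.2 VV.1,
    forall x, first_return w w' (rlabel r) false x (VV.1 x) &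
    forall x, first_return w w' (rlabel r) true x (VV.2 x)].
  have [V [V' VV']] := return_maps wK w'K (rlabel_rec r); by exists (V, V').
have [VV VVP] := choice ex.
by exists (fun r => (VV r).1), (fun r => (VV r).2).
Qed.

Variables (V V' : R -> T -> T).
Hypothesis VP : forall r, [/\ cancel (V r) (V' r), cancel (V' r) (V r),
  forall x, first_return w w' (rlabel r) false x (V r x) &
  forall x, first_return w w' (rlabel r) true x (V' r x)].

Definition zone (s : G) : nat := if s == i0 then 0%N else if s == i1 then 1%N else (num s).+2.

(** The block of [i0] is the ergodic one, the block of [i1] contains the automorphism
whose orbits carry the labels, and each other letter has a block of its own. *)
Definition gen (r : R) (s : G) : T -> T :=
  if s == i0 then F else if s == i1 then V r else b (z (zone s)).
Definition gen' (r : R) (s : G) : T -> T :=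
  if s == i0 then F' else if s == i1 then V' r else b (z (zone s))^-1%g.

Definition strat_act r : G -> T -> T := free_act Sfree (gen r) (gen' r).

Lemma genK r s : cancel (gen r s) (gen' r s).
Proof.
rewrite /gen /gen'; case: eqP => _; first by case: FF'.
by case: eqP => _; [case: (VP r)|exact: actK].
Qed.

Lemma gen'K r s : cancel (gen' r s) (gen r s).
Proof.
rewrite /gen /gen'; case: eqP => _; first by case: FF'.
by case: eqP => _; [case: (VP r)|exact: actVK].
Qed.

Lemma zone_inj s t : S s -> S t -> zone s = zone t -> s = t.
Proof.
move=> _ _; rewrite /zone; case: (s =P i0) => [->|_]; case: (t =P i0) => [->|_] //.
- by case: ifP.
- by case: ifP.
case: (s =P i1) => [->|_]; case: (t =P i1) => [->|_] //.
by move=> [/num_inj].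
Qed.

Lemma K_expg j g n : K j g -> K j (g ^+ n)%g.
Proof.
have [KS _ _ _] := KC; have [K1 KM _] := KS j => Kg.
by elim: n => [|n IHn]; rewrite ?expg0 // expgS; exact: KM.
Qed.

Lemma genD r s x : S s -> exists2 h, K (zone s) h & gen r s x = b h x.
Proof.
move=> _; rewrite /gen /zone; case: eqP => _; first by case: FF'.
case: eqP => _; last by exists (z (num s).+2).
have [_ _ /(_ x)[k [-> _ _]] _] := VP r.
by exists (z 1%N ^+ k.+1)%g; [exact: K_expg|exact: iter_act].
Qed.

Lemma gen_aperiodic r s n x : S s -> iter n.+1 (gen r s) x <> x.
Proof.
move=> _; rewrite /gen; case: eqP => _; first exact: F_free.
have [_ bf] := bF.
case: eqP => _; last by rewrite iter_act => /bf/z_inf.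
have [_ _ rV _] := VP r.
have [[|k] // nk ->] := @return_iter _ w w' _ (rlabel r) (V r) n.+1 x rV.
by rewrite iter_act => /bf/z_inf.
Qed.

Lemma strat_act_free r : free_action (strat_act r).
Proof.
exact: (free_act_free Sfree (genK r) (gen'K r) bF KC zone_inj (genD r) (@gen_aperiodic r)).
Qed.

Lemma strat_act_gen r s : S s -> strat_act r s = gen r s.
Proof. by move=> Ss; exact: (free_act_gen Sfree (gen r) (gen' r) false Ss). Qed.

Lemma strat_actD r g x : exists h, strat_act r g x = b h x.
Proof.
have [[b1 bM] _] := bF; rewrite /strat_act /free_act; have [lg _ _] := nfP Sfree g.
elim: (nf Sfree g) lg => [|l v IHv] lg; first by exists 1%g; rewrite b1.
have [Sl lv] := (letters_cons S l v).1 lg; have [h /= ->] := IHv lv.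
have [k _ ->] := lmapD (gen'K r) bF KC (genD r) (b h x) Sl.
by exists (k * h)%g; rewrite bM.
Qed.

Section Measurability.
Context {d' : measure_display} {Y : measurableType d'}.
Variable rr : Y -> R.
Hypothesis mrr : forall c, measurable [set y | rr y <= c].

Lemma measurable_rlabel_eq (f g : Y -> T) : measurable_fun setT f -> measurable_fun setT g ->
  measurable [set y | rlabel (rr y) (f y) = rlabel (rr y) (g y)].
Proof.
move=> mf mg; rewrite (_ : [set y | _] = [set y | exists l, exists m, exists n,
    (lam (f y) = l /\ lam (g y) = m) /\ (above (rr y) l = n /\ above (rr y) m = n)]); last first.
  apply/seteqP; split=> y /=.
    by move=> E; exists (lam (f y)), (lam (g y)), (above (rr y) (lam (g y))).
  by rewrite /rlabel => -[l [m [n [[-> ->] [-> ->]]]]].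
have cs : countable [set: seq rat] by exact: countableP.
apply: mset_ex => // l; apply: mset_ex => // m; apply: mset_ex => // n.
apply: mset_and; apply: mset_and; [| |exact: measurable_above|exact: measurable_above].
  exact: (mset_preimage mf (mlam l)).
exact: (mset_preimage mg (mlam m)).
Qed.

Lemma measurable_return e (W : R -> T -> T) (f : Y -> T) :
  (forall r x, first_return w w' (rlabel r) e x (W r x)) ->
  measurable_fun setT f -> measurable_fun setT (fun y => W (rr y) (f y)).
Proof.
move=> Wr mf.
have mit k : measurable_fun setT (fun y => iter k (dir w w' e) (f y)).
  by apply: measurableT_comp => //; exact: (@measurable_pt _ _ w w' (bm _) (bm _) (e, k)).
have cn : countable [set: nat] by exact: countableP.
apply: (@measurable_fun_countable _ _ _ _ nat _
  (fun y k => rlabel (rr y) (iter k.+1 (dir w w' e) (f y)) = rlabel (rr y) (f y) /\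
     forall i, (i < k)%N -> ~ rlabel (rr y) (iter i.+1 (dir w w' e) (f y)) = rlabel (rr y) (f y))
  (fun k y => iter k.+1 (dir w w' e) (f y))) => //.
- move=> k; apply: mset_and; first exact: measurable_rlabel_eq.
  apply: mset_all => // i; apply: mset_imp; first exact: mset_cst.
  by apply: mset_not; exact: measurable_rlabel_eq.
- by move=> y; have [k [E cE kmin]] := Wr (rr y) (f y); exists k => //; split=> //; rewrite -E.
- move=> y k [ck kmin]; apply: first_return_un (Wr (rr y) (f y)) _; by exists k.
Qed.

Lemma measurable_lmap l (f : Y -> T) : measurable_fun setT f ->
  measurable_fun setT (fun y => lmap (gen (rr y)) (gen' (rr y)) l (f y)).
Proof.
move=> mf; case: l => s []; rewrite /lmap /gen /gen' /=; case: eqP => _.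
- by apply: measurableT_comp => //; case: FF'.
- case: eqP => _; last exact: measurableT_comp.
  by apply: (@measurable_return true) => // r; case: (VP r).
- by apply: measurableT_comp => //; case: FF'.
- case: eqP => _; last exact: measurableT_comp.
  by apply: (@measurable_return false) => // r; case: (VP r).
Qed.

(** The real [rr y] varies with the point, so that this covers the joint measurability
of the family in the real and the point. *)
Lemma measurable_strat_act g (f : Y -> T) : measurable_fun setT f ->
  measurable_fun setT (fun y => strat_act (rr y) g (f y)).
Proof.
move=> mf; rewrite /strat_act /free_act /wmap; elim: (nf Sfree g) => // l v IHv /=.
exact: measurable_lmap.
Qed.
End Measurability.

(** Points with the same label for [r] have the same label for [s], so that the first
return map for [s] reaches the first return for [r]. *)
Lemma orbit_le r s g x : r <= s -> exists h, strat_act r g x = strat_act s h x.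
Proof.
move=> rs; have [s1 sM] := (strat_act_free s).1.
have genr t : S t -> forall y, exists h, gen r t y = strat_act s h y.
  move=> St y; have [t1|t1] := eqVneq t i1; last first.
    by exists t; rewrite (strat_act_gen s St) /gen (negbTE t1).
  have t0 : (i1 == i0) = false by apply/eqP => E; apply: i01.
  rewrite /gen t1 t0 eqxx; have [_ _ rV _] := VP r; have [k [E cE _]] := rV y.
  have [_ _ sV _] := VP s.
  have [n nE] := @return_reaches _ w w' _ (rlabel s) (V s) k.+1 y sV (above_le rs (etrans (esym (congr1 (rlabel r) E)) cE)).
  exists (i1 ^+ n)%g; rewrite E nE; elim: n {nE} => [|n IHn]; first by rewrite expg0 s1.
  by rewrite iterS IHn expgS sM (strat_act_gen s Si1) /gen t0 eqxx.
rewrite {1}/strat_act /free_act; have [lg _ _] := nfP Sfree g.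
elim: (nf Sfree g) lg => [|[t e] v IHv] lg; first by exists 1%g; rewrite s1.
have [St lv] := (letters_cons S _ v).1 lg; have [h /= ->] := IHv lv.
rewrite /lmap /=; case: e St {lg} => /= St; last first.
  by have [k ->] := genr t St (strat_act s h x); exists (k * h)%g; rewrite sM.
have [k] := genr t St (gen' r t (strat_act s h x)); rewrite gen'K => E.
exists (k^-1 * h)%g; rewrite sM [in RHS]E.
by rewrite (actK (strat_act_free s)).
Qed.

(** As all the labels recur, there is a point [iter k w x] that has the same label as [x]
for [s] but not for [r]. By ping-pong, the action for [r] could reach it from [x] only
by the generator [i1], which keeps the label for [r]. *)
Lemma orbit_strict r s x : r < s ->
  exists h, forall g, strat_act r g x <> strat_act s h x.
Proof.
move=> rs; have [s1 sM] := (strat_act_free s).1.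
have [m mE mN] := above_lt (lam x) rs.
have [k _ kE] := lam_rec false m x 0%N.
have [_ _ sV _] := VP s; have [_ _ rV rV'] := VP r.
have t0 : (i1 == i0) = false by apply/eqP => E; apply: i01.
have [n nE] := @return_reaches _ w w' _ (rlabel s) (V s) k x sV (etrans (congr1 (above s) kE) mE).
exists (i1 ^+ n)%g => g.
have -> : strat_act s (i1 ^+ n)%g x = iter k w x.
  rewrite nE; elim: n {nE} => [|n IHn]; first by rewrite expg0 s1.
  by rewrite iterS -IHn expgS sM (strat_act_gen s Si1) /gen t0 eqxx.
have zi1 : zone i1 = 1%N by rewrite /zone t0 eqxx.
rewrite iter_act => gE.
have Kz : K (zone i1) (z 1%N ^+ k)%g by rewrite zi1; exact: K_expg.
have [n' [e E]] := free_act_block (gen'K r) bF KC zone_inj (genD r)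
  (@gen_aperiodic r) Si1 Kz gE.
have lE : rlabel r (iter k w x) = rlabel r x.
  rewrite iter_act -gE /strat_act E /lmap /=; case: e {E}; rewrite /gen /gen' t0 eqxx.
    elim: n' => //= n' <-; have [k' [_ -> _]] := rV' (iter n' (V' r) x); by [].
  elim: n' => //= n' <-; have [k' [_ -> _]] := rV (iter n' (V r) x); by [].
by apply: mN; move: lE; rewrite /rlabel kE.
Qed.

Lemma strat_act_ergodic r A : measurable A ->
  (forall g x, A x -> A (strat_act r g x)) -> pr A = 0 \/ pr A = 1.
Proof.
move=> mA inv_A; have E : strat_act r i0 = F by rewrite strat_act_gen // /gen eqxx.
apply: F_ergodic => // x; split=> [|AF]; first by rewrite -E; exact: inv_A.
by rewrite -(actK (strat_act_free r) i0 x) E; exact: inv_A.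
Qed.

Lemma measurable_strat r g : measurable_fun setT (strat_act r g).
Proof.
apply: (@measurable_strat_act _ T (cst r) _ g id); last exact: measurable_id.
by move=> c; exact: (mset_cst (r <= c)%R).
Qed.

Hypothesis autoinv : forall f g : T -> T, cancel f g -> cancel g f ->
  measurable_fun setT f -> measurable_fun setT g -> (forall x, exists h, f x = b h x) ->
  forall A, measurable A -> pr (f @^-1` A) = pr A.

Variable phi : T -> R.
Hypotheses (mphi : measurable_fun setT phi) (phi_inj : injective phi).

(** If [N] is positive, then by ergodicity almost every point is equivalent to a point
of [N] under the action for [r], and so are all the points of its orbit under the action
for [s]. Take two points of this orbit that are not equivalent for [r]: the points of [N]
to which they are equivalent for [r] are equivalent to each other for [s], hence for [r]
since they are in [N], a contradiction. *)
Lemma strat_act_strict r s (B : set T) : measurable B -> r < s ->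
  let N := [set x | B x /\ forall g, B (strat_act s g x) ->
              exists h, strat_act r h x = strat_act s g x] in
  measurable N /\ pr N = 0.
Proof.
move=> mB rs N.
have [r1 rM] := (strat_act_free r).1; have [s1 sM] := (strat_act_free s).1.
have pre t g (A : set T) : measurable A -> measurable [set x | A (strat_act t g x)].
  by move=> mA; apply: mset_preimage => //; exact: measurable_strat.
have [b1 bM] := bF.1.
have mb h : measurable_fun setT (fun x => b h x) by exact: bm.
have mN : measurable N.
  apply: mset_and => //; apply: mset_all => // g; apply: mset_imp; first exact: pre.
  apply: mset_ex => // h.
  rewrite (_ : [set x | _] = [set x | phi (strat_act r h x) = phi (strat_act s g x)]).
    by apply: mset_eq; apply: measurableT_comp => //; exact: measurable_strat.
  by apply/seteqP; split=> x /= => [->|/phi_inj].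
split=> //; pose A := [set x | exists g, N (strat_act r g x)].
have mA : measurable A by apply: mset_ex => // g; exact: pre.
have NA : N `<=` A by move=> x Nx; exists 1%g; rewrite r1.
have [|A0|A1] := @strat_act_ergodic r A mA.
- move=> g x [h Nh]; exists (h * g^-1)%g.
  by rewrite -rM -mulgA mulVg mulg1.
- by apply/eqP; rewrite eq_le pr_ge0 andbT -A0; exact: pr_le.
exfalso; pose X0 := [set x | forall g, A (strat_act s g x)].
have mX0 : measurable X0 by apply: mset_all => // g; exact: pre.
have prX0 : pr (~` X0) = 0.
  rewrite (_ : ~` X0 = \bigcup_g (strat_act s g @^-1` (~` A))); last first.
    apply/seteqP; split=> x; last by move=> [g _ nA] /(_ g).
    by move=> /existsNP[g nA]; exists g.
  apply: pr_bigcup0 => // g; first by apply: (pre s g); exact: measurableC.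
  rewrite (@autoinv _ (strat_act s g^-1%g)) ?pr_C ?A1 ?subrr //.
  - exact: (actK (strat_act_free s)).
  - exact: (actVK (strat_act_free s)).
  - exact: measurable_strat.
  - exact: measurable_strat.
  - exact: strat_actD.
  - exact: measurableC.
have [x X0x] : X0 !=set0.
  apply/set0P/eqP => E; move: prX0; rewrite E setC0 prT.
  by apply/eqP; rewrite oner_eq0.
have [g xg] := orbit_strict x rs.
have [h [Bx Nx]] : A x by have := X0x 1%g; rewrite s1.
have [k [Bg _]] := X0x g.
have [h' h'E] := orbit_le h x (ltW rs); have [k' k'E] := orbit_le k (strat_act s g x) (ltW rs).
have [|l lE] := Nx (k' * g * h'^-1)%g.
  by rewrite h'E -sM mulgVK sM -k'E.
apply: (xg (k^-1 * l * h)%g); rewrite !rM lE h'E -sM mulgVK sM -k'E.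
by rewrite (actK (strat_act_free r)).
Qed.
End Stratification.

(** * Stratifications by free actions *)

Lemma continuous_pairing (S T1 T2 : topologicalType) (f : S -> T1) (g : S -> T2) :
  continuous f -> continuous g -> continuous (fun x => (f x, g x)).
Proof.
move=> cf cg x P [[P1 P2] /= [n1 n2] sub].
have h1 : nbhs x (f @^-1` P1) := cf x _ n1; have h2 : nbhs x (g @^-1` P2) := cg x _ n2.
by apply: filterS (filterI h1 h2) => y hy; exact: (sub (f y, g y)).
Qed.

Lemma borelI (S : topologicalType) (A B : set S) : borel A -> borel B -> borel (A `&` B).
Proof.
move=> bA bB; rewrite -[A `&` B]setCK setCI -setTD; apply: sigma_algebraCD.
rewrite -bigcup2E; apply: sigma_algebra_bigcup => -[|[|i]] /=.
- by rewrite -setTD; exact: sigma_algebraCD.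
- by rewrite -setTD; exact: sigma_algebraCD.
- exact: sigma_algebra0.
Qed.

Lemma orbit_equivalenceP (G : groupType) (X : Type) (a : G -> X -> X) :
  group_action a -> equivalence (orbit_equivalence a).
Proof.
move=> [a1 aM]; split=> [x|x y [g /= <-]|x y z' [g /= <-] [h /= <-]].
- by exists 1%g; rewrite /= a1.
- by exists g^-1%g; rewrite /= -aM mulVg a1.
- by exists (h * g)%g; rewrite /= aM.
Qed.

Lemma borel_action_measurable (D : groupType) (X : ptopologicalType) (b : D -> X -> X) :
  borel_action b -> forall g, measurable_fun setT (b g : borelType X -> borelType X).
Proof.
move=> bB g _ A mA; rewrite setTI; have := bB A mA.
apply: (@borel_preimage X _ (fun x : X => (g, x) : discrete_topology D * X)) => x.
move=> P [[P1 P2] /= [n1 n2] sub]; apply: filterS n2 => y y2.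
by apply: (sub (g, y)); split=> //=; exact: n1.
Qed.

(** The spikes with even index form the ergodic block [0], in which [t] takes each value
infinitely often; each spike with odd index generates a block by itself. *)
Lemma ergodic_pingpong d (T : measurableType d) (R : realType) (mu : probability T R)
    (D : groupType) (b : D -> T -> T) (U : nat -> set T) :
  countable_nonabelian_free_group D -> group_action b ->
  (forall g, measurable_fun setT (b g)) ->
  (forall g A, measurable A -> pr mu (b g @^-1` A) = pr mu A) ->
  ergodic_under mu b setT ->
  (forall i, measurable (U i)) -> (forall A, measurable A -> <<s range U >> A) ->
  exists (K C : nat -> set D) (z : nat -> D), [/\ pingpong K C, forall j, K j (z j),
    forall j n, (z j ^+ n.+1)%g <> 1%g & ergodic_under mu b (K 0%N)].
Proof.
move=> [cD [S Sfree] nab] bA bm binv erg mU U_gen.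
have [x [y [Sx Sy xy]]] := nonabelian_two Sfree nab.
have [A_ [mA A_dense]] := dense_sequence (T := T) mU mu U_gen.
pose f i m := pr mu (b (spike x y m) @^-1` A_ i `&` A_ i).
have f01 i m : 0 <= f i m <= 1.
  rewrite pr_ge0 pr_le1 //; apply: measurableI => //; exact: (bpre bm).
have [m_ [q [m0 mgap mq]]] := simultaneous_subseq f01.
have [e eP] := countable_enum cD 1%g.
pose e' n := if pselect (S (e n)) is left _ then e n else 1%g.
pose t k := if odd k then 1%g else e' (rep k./2).
have tS k : t k = 1%g \/ S (t k).
  by rewrite /t /e'; case: odd; [left|case: pselect => [Se|_]; [right|left]].
pose blk k := if odd k then k./2.+1 else 0%N.
pose c k := (spike x y (m_ k) * t k)%g.
have KC := spike_pingpong Sfree Sx Sy xy m0 mgap tS blk.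
pose z j := if j is j'.+1 then c j'.*2.+1 else c 0%N.
exists (block c blk), (block_zone (spike_zone Sfree x y m_ t) blk), z; split=> //.
- move=> [|j]; first exact: (@block_gen _ _ _ c blk 0%N).
  have := @block_gen _ _ _ c blk j.*2.+1; rewrite /blk /= odd_double /=.
  by rewrite uphalf_double.
- by move=> [|j] n; exact: (spike_order Sfree Sx Sy xy m0 mgap tS).
have [KS _ _ _] := KC.
apply: (ergodic_twins bA bm binv mA A_dense (free_gen_ind Sfree) cD erg
  (g := fun k => spike x y (m_ k)) (t := t) (q := q)) => // s Ss N.
have [i ti] : exists i, e' i = s.
  case: Ss => [->|Ss]; last first.
    by have [i ei] := eP s; exists i; rewrite /e'; case: pselect => //; rewrite ei.
  have [n en] := eP 1%g; exists n; rewrite /e'; case: pselect => // _; exact: en.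
have [n Nn rn] := rep_inf i N; exists n.*2.
have tn : t n.*2 = s by rewrite /t odd_double doubleK rn.
split=> //; first lia.
have := @block_gen _ _ _ c blk n.*2; by rewrite /blk odd_double.
Qed.

Theorem proposition2p2 (R : realType) (X : ptopologicalType)
    (polishX : polish R X)
    (E : set (X * X)) (cberE : countable_borel_equivalence E)
    (mu : probability (borelType X) R) (muE : measure_invariant mu E)
    (ergodic_free_subaction :
       exists (D : groupType) (b : D -> X -> X),
         [/\ countable_nonabelian_free_group D,
             free_action b, borel_action b,
             subequivalence (orbit_equivalence b) E &
             ergodic mu (orbit_equivalence b)]) :
  forall G : groupType, countable_nonabelian_free_group G ->
  exists a : R -> G -> X -> X,
    [/\ forall r, free_action (a r),
        borel_action_sequence a,
        mu_stratification mu E (fun r => orbit_equivalence (a r)) &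
        forall r, ergodic mu (orbit_equivalence (a r))].
Proof.
move=> G [cG [S Sfree] nabG].
have [D [b [freeD bF bB [eqb bE] erg_b]]] := ergodic_free_subaction.
have [cD _ _] := freeD; have [bA bf] := bF; have [b1 bM] := bA.
have [_ Esym Etrans] : equivalence E by case: cberE.
pose T : measurableType _ := borelType X.
have bm : forall g, measurable_fun setT (b g : T -> T) := borel_action_measurable bB.
have bE' h x : E (x, b h x) by apply: bE; exists h.
have autoinv (f g : T -> T) : cancel f g -> cancel g f ->
    measurable_fun setT f -> measurable_fun setT g -> (forall x, exists h, f x = b h x) ->
    forall A, measurable A -> pr mu (f @^-1` A) = pr mu A.
  move=> fK gK mf mg fh A mA.
  have -> : f @^-1` A = g @` A.
    apply/seteqP; split=> [x Ax|_ [x Ax <-]] /=; last by rewrite gK.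
    by exists (f x) => //; exact: fK.
  rewrite /pr -(muE g) //.
  - exists f; first by split.
    by split=> B mB; rewrite -[X in borel X]setTI; [exact: mg|exact: mf].
  - by move=> x; apply: Esym; have [h hE] := fh (g x); rewrite -{2}[x]gK hE.
have binv g (A : set T) : measurable A -> pr mu (b g @^-1` A) = pr mu A.
  apply: (autoinv _ (b g^-1%g)) => //; [exact: actK|exact: actVK|by move=> x; exists g].
have conull (A : set T) : measurable A -> mu A = 0%E \/ mu (~` A) = 0%E <->
    pr mu A = 0 \/ pr mu A = 1.
  move=> mA; rewrite !pr_eq0 ?pr_C //; last exact: measurableC.
  by split=> -[|] h; [left|right; lra|left|right; rewrite h subrr].
have erg : ergodic_under mu b setT.
  move=> B mB Binv; apply/(conull B) => //; apply: erg_b => // x y [g /= <-]; exact: Binv.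
have [U Ubase] := polish_base polishX.
have mU : forall i, measurable (U i : set T) := base_measurable Ubase.
have U_gen := base_generates Ubase; have [oU U_sep _] := Ubase.
have [phi [mphi phi01 phi_inj]] := @injective_coding _ T R U mU U_sep.
have [K [C [z [KC zK z_inf ergK]]]] := ergodic_pingpong (T := T) (b := b) freeD bA bm binv erg mU U_gen.
have iter_free j n x : iter n.+1 (b (z j)) x <> x.
  by rewrite (iter_act (T := T) bF) => /bf/z_inf.
have mpt (x : T) : measurable ([set x] : set T) by exact: (measurable_point x mphi phi_inj).
have atomless x : pr mu [set x] = 0.
  exact: (aperiodic_atomless (T := T) (actK bF (z 0%N)) (actVK bF (z 0%N)) (binv _) (iter_free 0%N) mpt).
have [A_ [mA A_dense]] := dense_sequence (T := T) mU mu U_gen.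
have [KS _ _ _] := KC.
have [F [F' [FF' F_free F_erg]]] := ergodic_automorphism (T := T) (b := b) bA bm autoinv (KS 0%N) cD ergK
  mphi phi01 phi_inj atomless mA A_dense (zK 0%N) (iter_free 0%N).
have [lam [mlam lam_rec]] := recurrent_labels (T := T) (actK bF (z 1%N)) (actVK bF (z 1%N))
  (bm _) (bm _) (iter_free 1%N) mphi phi01 phi_inj ([::] : seq rat).
have [V [V' VP]] := return_family (T := T) (R := R) (lam := lam) bF lam_rec.
have [i0 [i1 [Si0 Si1 i01]]] := nonabelian_two Sfree nabG.
have [num num_inj] : exists num : G -> nat, injective num.
  by move/countable_injP: cG => [num ni]; exists num => x y; apply: ni; rewrite inE.
pose a : R -> G -> T -> T := strat_act (T := T) b z F F' Sfree i0 i1 num V V'.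
have aF r : free_action (a r).
  exact: (strat_act_free (T := T) bF KC zK z_inf FF' F_free Sfree i0 i1 num_inj VP r).
have aM r := (aF r).1.
have aD r g x : exists h, a r g x = b h x by exact: (strat_actD (T := T) bF KC zK FF' Sfree i0 i1 num VP).
have ma r g : measurable_fun setT (a r g).
  exact: (measurable_strat (T := T) bm FF' mlam Sfree i0 i1 num VP r g).
have aerg r A : measurable A -> (forall g x, A x -> A (a r g x)) -> pr mu A = 0 \/ pr mu A = 1.
  exact: (strat_act_ergodic (T := T) bF KC zK z_inf FF' F_free F_erg Si0 num_inj VP).
have ale r s g x : r <= s -> exists h, a r g x = a s h x.
  exact: (orbit_le (T := T) bF KC zK z_inf FF' F_free Sfree Si1 i01 num_inj VP).
have alt r s x : r < s -> exists h, forall g, a r g x <> a s h x.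
  exact: (orbit_strict (T := T) bF KC zK z_inf FF' F_free lam_rec Sfree Si1 i01 num_inj VP).
exists a; split=> //.
- have cr : continuous (fun y : R * (X * X) => y.1) by move=> y; exact: cvg_fst.
  have cx : continuous (fun y : R * (X * X) => y.2.1).
    by move=> y; apply: (@continuous_comp _ _ _ snd fst); [exact: cvg_snd|exact: cvg_fst].
  have cy : continuous (fun y : R * (X * X) => y.2.2).
    by move=> y; apply: (@continuous_comp _ _ _ snd snd); [exact: cvg_snd|exact: cvg_snd].
  pose Y : measurableType _ := borelType (R * (X * X))%type.
  have mproj (f : R * (X * X) -> X) : continuous f -> measurable_fun setT (f : Y -> T).
    by move=> cf _ A0 mA0; rewrite setTI; exact: borel_preimage.
  have mr c : measurable [set y : Y | y.1 <= c].
    rewrite (_ : [set y | _] = ~` [set y : Y | c < y.1]); last first.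
      by apply/seteqP; split=> y /=; rewrite leNgt => /negP.
    apply: measurableC; apply: sub_sigma_algebra.
    have := open_comp (f := fun y : R * (X * X) => y.1) (fun x _ => cr x) (@open_gt R c).
    by [].
  have mg g : borel [set y : R * (X * X) | a y.1 g y.2.1 = y.2.2].
    rewrite (_ : [set y | _] = [set y : Y | phi (a y.1 g y.2.1) = phi y.2.2]); last first.
      by apply/seteqP; split=> y /= => [->|/phi_inj].
    apply: (@mset_eq _ Y R (fun y => phi (a y.1 g y.2.1)) (fun y => phi y.2.2)); last first.
      exact: (measurableT_comp mphi (mproj _ cy)).
    apply: (measurableT_comp mphi); apply: (measurable_strat_act (T := T) bm FF' mlam Sfree
      i0 i1 num VP mr g); exact: mproj.
  pose pr3 (p : R * ((discrete_topology G * X) * X)) := (p.1, (p.2.1.2, p.2.2)).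
  have c1 : continuous (fun p : R * ((discrete_topology G * X) * X) => p.2.1.1).
    move=> p; apply: (@continuous_comp _ _ _ snd (fun q => q.1.1)); first exact: cvg_snd.
    by apply: (@continuous_comp _ _ _ fst fst); [exact: cvg_fst|exact: cvg_fst].
  have c3 : continuous pr3.
    apply: continuous_pairing => [p|]; first exact: cvg_fst.
    apply: continuous_pairing => p; last first.
      by apply: (@continuous_comp _ _ _ snd snd); [exact: cvg_snd|exact: cvg_snd].
    apply: (@continuous_comp _ _ _ snd (fun q => q.1.2)); first exact: cvg_snd.
    by apply: (@continuous_comp _ _ _ fst snd); [exact: cvg_fst|exact: cvg_snd].
  have [e eP] := countable_enum cG 1%g.
  rewrite /borel_action_sequence (_ : [set p | _] =
    \bigcup_n ([set p | p.2.1.1 = e n] `&` pr3 @^-1` [set y | a y.1 (e n) y.2.1 = y.2.2])).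
    apply: sigma_algebra_bigcup => n; apply: borelI; last exact: borel_preimage.
    apply: (borel_preimage (A := [set e n : discrete_topology G]) c1).
    by apply: sub_sigma_algebra; exact: discrete_open.
  apply/seteqP; split=> [p h|p [n _ [/= <-]]] //.
  by have [n en] := eP p.2.1.1; exists n => //; split; rewrite /= en.
- split.
    split=> [r|r s rs x].
      split; first exact: orbit_equivalenceP (aM r).
      by move=> [x y] [g /= <-]; have [h ->] := aD r g x.
    exists x; split=> [y [g /= <-]|sub].
      by have [h hE] := ale r s g x (ltW rs); exists h.
    have [h nh] := alt r s x rs; have [g /= gE] := sub (a s h x) (ex_intro _ h erefl).
    exact: nh gE.
  move=> B mB B0 r s rs.
  have [mN N0] := strat_act_strict (T := T) bF bm KC zK z_inf FF' F_free F_erg mlam lam_rec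
    Sfree Si0 Si1 i01 cG num_inj VP autoinv mphi phi_inj mB rs.
  set N := [set x | _] in mN N0.
  exists N; split=> //.
    rewrite /mrestr (_ : N `&` B = N); last by apply/setIidl => x [].
    by apply/pr_eq0.
  move=> x /= nx; apply: contrapT => nN; apply: nx => Bx; exists x => //.
  split=> [y [[g /= <-] [_ By]]|sub].
    by have [h hE] := ale r s g x (ltW rs); split=> //; exists h.
  apply: nN; split=> // g Bg.
  by have [[h /= hE] _] := sub (a s g x) (conj (ex_intro _ g erefl) (conj Bx Bg)); exists h.
- move=> r B mB Binv; apply/(conull B) => //; apply: (aerg r) => // g x; apply: Binv.
  by exists g.
Qed.
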